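(* Let $\Delta$ be a triangulated orientable 4-manifold with a chosen total order on its vertices, let $l_e\in\mathbb{R}_+$ be labels on the edges $e$ such that for every 4-simplex of $\Delta$ the ten labels on its edges are the edge lengths of a non-degenerate Euclidean 4-simplex, and let $s_t\in\mathbb{Z}$ be labels on the triangles $t$. Define $$ W_\Delta(l_e,s_t)=\prod_{t}2A_t(l_e)\;\prod_{\tau}(-1)^{\sum_{i=1}^4 s_{t_i}}\;\prod_{\sigma}\left\{\begin{array}{ccc} l_{e_1}&\cdots&l_{e_{10}}\\ s_{t_1}&\cdots&s_{t_{10}}\end{array}\right\}, $$ where the products are over the triangles $t$, tetrahedra $\tau$ and 4-simplices $\sigma$ of $\Delta$ (in the case of a manifold with boundary, only over triangles and tetrahedra not lying on the boundary), $t_1,\dots,t_4$ are the four triangles of $\tau$, $A_t(l_e)$ is the area of the Euclidean triangle with the edge lengths of $t$, and the last factor is the 10$j$ 2-symbol (defined in the context) of the labels on the ten edges and ten triangles of $\sigma$. If $\Delta$ is closed, then $$ W_\Delta(l_e,s_t)=\prod_{t}2A_t(l_e)\;\prod_{\sigma}\frac{\cos\left[\sum_{t\subset\sigma}s_t\,\phi^\sigma_t(l_e)\right]}{V_\sigma(l_e)}, $$ where $\phi_t^\sigma\in[0,\pi]$ is the interior dihedral angle between the two tetrahedra of $\sigma$ that meet at $t$, and $V_\sigma(l_e)$ is $4!$ times the volume of the Euclidean 4-simplex with the edge lengths of $\sigma$. If $\Delta$ has a boundary, the two expressions (with the product over $t$ restricted to triangles not lying on the boundary) agree up to a global sign depending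 only on the boundary data, i.e. on the labels on the boundary.
   Context: Basic notation. $e_1,\dots,e_4$ is the standard basis of $\mathbb{R}^4$. $h_\phi\in \mathrm{SO}(4)$ is the rotation fixing $e_1,e_2$ and rotating the oriented plane $(e_3,e_4)$ by the angle $\phi$; $\mathrm{U}(1)=\{h_\phi\}$. $\mathrm{SO}(3)\subset \mathrm{SO}(4)$ denotes the stabilizer of $e_4$. For each $s\in\mathbb{Z}$ fix a nowhere vanishing function $\Phi^s:\mathrm{SO}(4)\to\mathbb{C}$ with $\Phi^s(1)=1$ and $\Phi^s(gh_\theta)=e^{is\theta}\Phi^s(g)$ for all $g\in \mathrm{SO}(4)$ and all $\theta$. The 10$j$ 2-symbol is attached to the standard 4-simplex $[12345]$ with labels $l_{ij}$ ($i<j$) on edges and $s_{ijk}$ ($i<j<k$) on triangles; for a 4-simplex $\sigma$ of $\Delta$, its vertices are identified with $1,\dots,5$ in increasing order. Embedded simplices. Simplices in $\mathbb{R}^4$ are considered up to translation and are given by edge vectors $x_{ij}\in\mathbb{R}^4$ ($i<j$), with $x_{ij}+x_{jk}=x_{ik}$ and $|x_{ij}|=l_{ij}$. $\mathrm{SO}(4)$ acts on them by acting on all edge vectors. Reference triangles. For $a<b<c$, the reference triangle $\triangle^o_{abc}$ is the one with $x_{ab}=l_{ab}e_1$, $x_{ac}=l_{ac}(\cos\gamma\, e_1+\sin\gamma\, e_2)$ for some $\gamma\in[0,\pi]$. Reference tetrahedra. For $j<k<l<m$, the reference tetrahedron $\tau^o_{jklm}$ is the one with $x_{jk}=l_{jk}e_1$,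 $x_{jl}=l_{jl}(\cos\gamma\, e_1+\sin\gamma\, e_2)$, $x_{jm}=l_{jm}\cos\gamma'\,e_1+l_{jm}\sin\gamma'(\cos\theta\, e_2+\sin\theta\, e_3)$ for some $\gamma,\gamma',\theta\in[0,\pi]$. The flipped reference tetrahedron is $\bar\tau^o_{jklm}=h_\pi\tau^o_{jklm}$. For each of the four faces $abc$ of $jklm$, let $k_{abc}\in \mathrm{SO}(3)$ (resp. $\bar k_{abc}\in \mathrm{SO}(3)$) be the unique element of $\mathrm{SO}(3)$ mapping $\triangle^o_{abc}$ to the face $abc$ of $\tau^o_{jklm}$ (resp. of $\bar\tau^o_{jklm}$). Normalized 2-intertwiners. For an embedded non-degenerate tetrahedron $\tau=[jklm]$ ($j<k<l<m$), let $g,\bar g\in \mathrm{SO}(4)$ be the unique rotations with $\tau=g\,\tau^o_{jklm}=\bar g\,\bar\tau^o_{jklm}$. Define the complex numbers $$m_{\tau}=\frac{\Phi^{s_{jkm}}(g k_{jkm})\,\Phi^{s_{klm}}(g k_{klm})}{\Phi^{s_{jkl}}(g k_{jkl})\,\Phi^{s_{jlm}}(g k_{jlm})},\qquad \bar m_{\tau}=\frac{\Phi^{s_{jkl}}(\bar g \bar k_{jkl})\,\Phi^{s_{jlm}}(\bar g \bar k_{jlm})}{\Phi^{s_{jkm}}(\bar g \bar k_{jkm})\,\Phi^{s_{klm}}(\bar g \bar k_{klm})}.$$ Pentagons. The exterior edges are $(12),(23),(34),(45),(15)$ and the interior edges are $(13),(14),(24),(25),(35)$. Let $\mathcal{P}$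 be the set of pentagons $(x_{12},x_{23},x_{34},x_{45},x_{15})$ in $\mathbb{R}^4$ with $|x_{ij}|=l_{ij}$ on exterior edges and $x_{12}+x_{23}+x_{34}+x_{45}=x_{15}$, with the measure $$d\mu_{\mathcal{P}}=\prod_{\mathrm{ext.}\,(ij)}d^3_{l_{ij}}x_{ij}\;\delta^4(x_{12}+x_{23}+x_{34}+x_{45}-x_{15}),\qquad d^3_lx=\frac1\pi\, d^4x\,\delta(|x|^2-l^2).$$ Put $x_{ij}=x_{i\,i+1}+\dots+x_{j-1\,j}$ for $i<j$. For given interior lengths, $\mathcal{P}_\ell\subset\mathcal{P}$ is the subset of pentagons with $|x_{ij}|=l_{ij}$ for all $i<j$; each of its points is an embedded 4-simplex $[12345]$ in $\mathbb{R}^4$. The measure $\mu_{\mathcal{P}_\ell}$ on $\mathcal{P}_\ell$ is defined by the decomposition $\mu_{\mathcal{P}}=\kappa\int\prod_{\mathrm{int.}\,(ij)}dl_{ij}^2\;\mu_{\mathcal{P}_\ell}$ (with $dl^2=2l\,dl$), i.e. $$d\mu_{\mathcal{P}_\ell}=\frac{1}{\kappa\pi^5}\prod_{i=1}^4d^4x_{i\,i+1}\prod_{1\le i<j\le5}\delta(|x_{ij}|^2-l_{ij}^2),\qquad \kappa=\frac{1}{2^5\pi}.$$ 10$j$ 2-symbol. For a point $p\in\mathcal{P}_\ell$, let $\tau_{\hat\imath}(p)$ be the tetrahedron of the embedded 4-simplex opposite to vertex $i$. Define $$\left\{\begin{array}{ccc} l_{e_1}&\cdots&l_{e_{10}}\\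 s_{t_1}&\cdots&s_{t_{10}}\end{array}\right\}:=\int_{\mathcal{P}_\ell}d\mu_{\mathcal{P}_\ell}(p)\;\;\bar m_{\tau_{\hat2}(p)}\,\bar m_{\tau_{\hat4}(p)}\,m_{\tau_{\hat1}(p)}\,m_{\tau_{\hat3}(p)}\,m_{\tau_{\hat5}(p)} .$$ *)

(* Defs.v *)
(* The real numbers are an arbitrary R : realType, the complex numbers R[i]. *)
From HB Require Import structures.
From mathcomp Require Import all_boot all_order all_algebra.
From mathcomp Require Import all_classical all_reals all_analysis.
From mathcomp Require Import complex.

Set Implicit Arguments.
Unset Strict Implicit.
Unset Printing Implicit Defensive.

Import Order.TTheory GRing.Theory Num.Theory.
Import numFieldNormedType.Exports.

Local Open Scope classical_set_scope.
Local Open Scope ring_scope.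
Local Open Scope complex_scope.

Section EuclideanSimplices.
Variable R : realType.

Definition dotp n (x y : 'cV[R]_n) : R := \sum_(i < n) x i ord0 * y i ord0.

Definition enorm n (x : 'cV[R]_n) : R := Num.sqrt (dotp x x).

(* A simplex in R^n is given by its vertices p : 'I_k -> 'cV[R]_n; where
   simplices are taken up to translation, only the edge vectors matter. *)
Definition edge k n (p : 'I_k -> 'cV[R]_n) (i j : 'I_k) : 'cV[R]_n :=
  p j - p i.

Definition same_simplex k n (p q : 'I_k -> 'cV[R]_n) : Prop :=
  forall i j, edge p i j = edge q i j.

Definition rotate k n (g : 'M[R]_n) (p : 'I_k -> 'cV[R]_n) : 'I_k -> 'cV[R]_n :=
  fun i => g *m p i.

(* Only the lengths l i j with i < j are relevant. *)
Definition realizes k n (l : 'I_k -> 'I_k -> R) (p : 'I_k -> 'cV[R]_n) : Prop :=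
  forall i j : 'I_k, (i < j)%N -> enorm (edge p i j) = l i j.

Definition nondegenerate k n (p : 'I_k.+1 -> 'cV[R]_n) : Prop :=
  row_free (\matrix_(i < k) (edge p ord0 (lift ord0 i))^T).

Definition simplex_lengths k (l : 'I_k.+1 -> 'I_k.+1 -> R) : Prop :=
  exists p : 'I_k.+1 -> 'cV[R]_k, nondegenerate p /\ realizes l p.

(* A k-simplex in R^k with edge lengths l, unique up to isometry. *)
Definition euclidean_simplex k (l : 'I_k.+1 -> 'I_k.+1 -> R) :
    'I_k.+1 -> 'cV[R]_k :=
  xget (fun=> 0) [set p | realizes l p].

Definition conv_hull k n (p : 'I_k -> 'cV[R]_n) : set 'cV[R]_n :=
  [set x | exists w : 'I_k -> R,
    [/\ forall i, 0 <= w i, \sum_i w i = 1 & x = \sum_i w i *: p i]].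

Definition space2 : Type := (R * R)%type.
Definition space4 : Type := (R * R * R * R)%type.

Definition vec2 (x : space2) : 'cV[R]_2 := \col_(i < 2) [:: x.1; x.2]`_i.

Definition vec4 (x : space4) : 'cV[R]_4 :=
  \col_(i < 4) [:: x.1.1.1; x.1.1.2; x.1.2; x.2]`_i.

Definition lebesgue1 : set R -> \bar R := lebesgue_measure.
Definition lebesgue2 : set space2 -> \bar R := (lebesgue1 \x lebesgue1)%E.
Definition lebesgue4 : set space4 -> \bar R :=
  (lebesgue1 \x lebesgue1 \x lebesgue1 \x lebesgue1)%E.

Definition triangle_area (l : 'I_3 -> 'I_3 -> R) : R :=
  fine (lebesgue2 (vec2 @^-1` conv_hull (euclidean_simplex l))).

Definition simplex4_volume (l : 'I_5 -> 'I_5 -> R) : R :=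
  fine (lebesgue4 (vec4 @^-1` conv_hull (euclidean_simplex l))).

Definition V4 (l : 'I_5 -> 'I_5 -> R) : R := 4`!%:R * simplex4_volume l.

(* The outward unit normal of the facet opposite to the vertex a. *)
Definition outward_normal n (p : 'I_n.+1 -> 'cV[R]_n) (a : 'I_n.+1) : 'cV[R]_n :=
  xget 0 [set u | [/\ enorm u = 1,
    forall i j, i != a -> j != a -> dotp u (edge p i j) = 0 &
    forall i, i != a -> dotp u (edge p i a) < 0]].

(* The interior dihedral angle between the facets opposite to the vertices a
   and b: the supplement of the angle between their outward normals. *)
Definition dihedral_angle (l : 'I_5 -> 'I_5 -> R) (a b : 'I_5) : R :=
  let p := euclidean_simplex l in
  pi - acos (dotp (outward_normal p a) (outward_normal p b)).

End EuclideanSimplices.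

Section Intertwiners.
Variable R : realType.

(* basis4 0, ..., basis4 3 are the vectors e_1, ..., e_4. *)
Definition basis4 (k : nat) : 'cV[R]_4 := delta_mx (inord k) ord0.

Definition SO4 : set 'M[R]_4 := [set g | g *m g^T = 1%:M /\ \det g = 1].

Definition SO3 : set 'M[R]_4 := [set g | SO4 g /\ g *m basis4 3 = basis4 3].

Definition plane_rotation (phi : R) : 'M[R]_2 :=
  \matrix_(i < 2, j < 2)
    if i == j then cos phi else if i == ord0 then - sin phi else sin phi.

Definition h (phi : R) : 'M[R]_4 :=
  (block_mx 1%:M 0 0 (plane_rotation phi) : 'M[R]_(2 + 2)).

Definition phase_family (Phi : int -> 'M[R]_4 -> R[i]) : Prop :=
  forall s : int,
    [/\ forall g, SO4 g -> Phi s g != 0,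
        Phi s 1%:M = 1 &
        forall g theta, SO4 g ->
          Phi s (g *m h theta) =
            (cos (s%:~R * theta) +i* sin (s%:~R * theta)) * Phi s g].

(* The vertices of a simplex are indexed by 'I_k in increasing order. *)
Definition is_ref_triangle (l : 'I_3 -> 'I_3 -> R) (p : 'I_3 -> 'cV[R]_4) :=
  realizes l p /\
  let v0 := inord 0 : 'I_3 in let v1 := inord 1 : 'I_3 in
  let v2 := inord 2 : 'I_3 in
  exists gamma : R,
    [/\ 0 <= gamma <= pi,
        edge p v0 v1 = l v0 v1 *: basis4 0 &
        edge p v0 v2 =
          l v0 v2 *: (cos gamma *: basis4 0 + sin gamma *: basis4 1)].

Definition ref_triangle (l : 'I_3 -> 'I_3 -> R) : 'I_3 -> 'cV[R]_4 :=
  xget (fun=> 0) [set p | is_ref_triangle l p].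

Definition is_ref_tetrahedron (l : 'I_4 -> 'I_4 -> R) (p : 'I_4 -> 'cV[R]_4) :=
  realizes l p /\
  let v0 := inord 0 : 'I_4 in let v1 := inord 1 : 'I_4 in
  let v2 := inord 2 : 'I_4 in let v3 := inord 3 : 'I_4 in
  exists gamma gamma' theta : R,
    [/\ 0 <= gamma <= pi, 0 <= gamma' <= pi & 0 <= theta <= pi] /\
    [/\ edge p v0 v1 = l v0 v1 *: basis4 0,
        edge p v0 v2 =
          l v0 v2 *: (cos gamma *: basis4 0 + sin gamma *: basis4 1) &
        edge p v0 v3 =
          (l v0 v3 * cos gamma') *: basis4 0 +
          (l v0 v3 * sin gamma') *:
            (cos theta *: basis4 1 + sin theta *: basis4 2)].

Definition ref_tetrahedron (l : 'I_4 -> 'I_4 -> R) : 'I_4 -> 'cV[R]_4 :=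
  xget (fun=> 0) [set p | is_ref_tetrahedron l p].

Definition flipped_ref_tetrahedron (l : 'I_4 -> 'I_4 -> R) :
    'I_4 -> 'cV[R]_4 :=
  rotate (h pi) (ref_tetrahedron l).

(* The element of G mapping p to q. *)
Definition mapping_elt k (G : set 'M[R]_4) (p q : 'I_k -> 'cV[R]_4) : 'M[R]_4 :=
  xget 1%:M [set g | G g /\ same_simplex q (rotate g p)].

(* The faces of a tetrahedron jklm are indexed by the omitted vertex: klm, jlm,
   jkm and jkl are the faces 0, 1, 2 and 3. *)
Definition face_elt (tau0 : 'I_4 -> 'cV[R]_4) (l : 'I_4 -> 'I_4 -> R)
    (a : 'I_4) : 'M[R]_4 :=
  mapping_elt SO3 (ref_triangle (fun i j => l (lift a i) (lift a j)))
                  (tau0 \o lift a).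

Definition face_label (s : 'I_4 -> 'I_4 -> 'I_4 -> int) (a : 'I_4) : int :=
  s (lift a (inord 0)) (lift a (inord 1)) (lift a (inord 2)).

(* Phi^{s_abc}(g k_abc) for the face abc omitting a, where g maps tau0 to tau. *)
Definition face_phase (Phi : int -> 'M[R]_4 -> R[i])
    (tau0 : 'I_4 -> 'cV[R]_4) (l : 'I_4 -> 'I_4 -> R)
    (s : 'I_4 -> 'I_4 -> 'I_4 -> int) (tau : 'I_4 -> 'cV[R]_4) (a : 'I_4) :
    R[i] :=
  Phi (face_label s a) (mapping_elt SO4 tau0 tau *m face_elt tau0 l a).

Definition m_tet (Phi : int -> 'M[R]_4 -> R[i]) (l : 'I_4 -> 'I_4 -> R)
    (s : 'I_4 -> 'I_4 -> 'I_4 -> int) (tau : 'I_4 -> 'cV[R]_4) : R[i] :=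
  let ph k := face_phase Phi (ref_tetrahedron l) l s tau (inord k) in
  (ph 2 * ph 0) / (ph 3 * ph 1).

Definition mbar_tet (Phi : int -> 'M[R]_4 -> R[i]) (l : 'I_4 -> 'I_4 -> R)
    (s : 'I_4 -> 'I_4 -> 'I_4 -> int) (tau : 'I_4 -> 'cV[R]_4) : R[i] :=
  let ph k := face_phase Phi (flipped_ref_tetrahedron l) l s tau (inord k) in
  (ph 3 * ph 1) / (ph 2 * ph 0).

End Intertwiners.

Section TenJSymbol.
Variable R : realType.

(* A pentagon is given by its edges (x_12, x_23, x_34, x_45), x_15 being their
   sum.  The vertices 1, ..., 5 are indexed by 'I_5, vertex 1 at the origin. *)
Definition pentagon : Type :=
  (space4 R * space4 R * space4 R * space4 R)%type.

Definition pentagon_edge (p : pentagon) (k : nat) : 'cV[R]_4 :=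
  vec4 (nth p.2 [:: p.1.1.1; p.1.1.2; p.1.2; p.2] k).

Definition pentagon_simplex (p : pentagon) : 'I_5 -> 'cV[R]_4 :=
  fun i => \sum_(k < i) pentagon_edge p k.

(* d^4x_12 d^4x_23 d^4x_34 d^4x_45 *)
Definition pentagon_lebesgue : set pentagon -> \bar R :=
  (@lebesgue4 R \x @lebesgue4 R \x @lebesgue4 R \x @lebesgue4 R)%E.

Definition P_l (l : 'I_5 -> 'I_5 -> R) : set pentagon :=
  [set p | realizes l (pentagon_simplex p)].

Definition kappa : R := (2 ^+ 5 * pi)^-1.

Definition delta_approx (eps u : R) : R :=
  if `|u| < eps then (2 * eps)^-1 else 0.

(* mu is the measure
     1 / (kappa pi^5) prod_i d^4x_{i,i+1} prod_{i<j} delta(|x_ij|^2 - l_ij^2),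
   the delta functions being the limit of delta_approx eps as eps -> 0+, tested
   against continuous functions with compact support. *)
Definition is_P_l_measure (l : 'I_5 -> 'I_5 -> R)
    (mu : {measure set pentagon -> \bar R}) : Prop :=
  forall f : pentagon -> R, continuous f ->
  (exists2 C : set pentagon, compact C & forall p, ~ C p -> f p = 0) ->
  (fun eps : R =>
    \int[pentagon_lebesgue]_p
      ((kappa * pi ^+ 5)^-1 * f p *
       \prod_(i < 5) \prod_(j < 5 | (i < j)%N)
         delta_approx eps
           (enorm (edge (pentagon_simplex p) i j) ^+ 2 - l i j ^+ 2))%:E)%E
    @ 0^'+ --> (\int[mu]_p (f p)%:E)%E.

Definition tenj_integrand (Phi : int -> 'M[R]_4 -> R[i])
    (l : 'I_5 -> 'I_5 -> R) (s : 'I_5 -> 'I_5 -> 'I_5 -> int)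
    (p : pentagon) : R[i] :=
  let on_tet (m : ('I_4 -> 'I_4 -> R) -> ('I_4 -> 'I_4 -> 'I_4 -> int) ->
                  ('I_4 -> 'cV[R]_4) -> R[i]) (k : nat) :=
    let c : 'I_4 -> 'I_5 := lift (inord k.-1) in
    m (fun i j => l (c i) (c j)) (fun i j k => s (c i) (c j) (c k))
      (pentagon_simplex p \o c) in
  on_tet (mbar_tet Phi) 2 * on_tet (mbar_tet Phi) 4 *
  on_tet (m_tet Phi) 1 * on_tet (m_tet Phi) 3 * on_tet (m_tet Phi) 5.

Definition tenj_symbol (Phi : int -> 'M[R]_4 -> R[i])
    (mu : ('I_5 -> 'I_5 -> R) -> {measure set pentagon -> \bar R})
    (l : 'I_5 -> 'I_5 -> R) (s : 'I_5 -> 'I_5 -> 'I_5 -> int) : R[i] :=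
  Rintegral (mu l) (P_l l) (fun p => complex.Re (tenj_integrand Phi l s p)) +i*
  Rintegral (mu l) (P_l l) (fun p => complex.Im (tenj_integrand Phi l s p)).

End TenJSymbol.

Section Triangulations.
Variables (R : realType) (d : Order.disp_t) (V : finOrderType d).
Implicit Types (K L : {set {set V}}) (F T : {set V}).

Definition simplicial_complex K : Prop :=
  (finset.set0 \notin K) /\
  forall F T, T \in K -> F \subset T -> F != finset.set0 -> F \in K.

Definition link K F : {set {set V}} :=
  [set T in K | [disjoint T & F] && (T :|: F \in K)]%SET.

Definition realization L : set 'rV[R]_#|V| :=
  [set x | [/\ forall i, 0 <= x ord0 i, \sum_i x ord0 i = 1 &
               [set v | x ord0 (enum_rank v) != 0]%SET \in L]].

Definition sphere n : set 'rV[R]_n := [set x | \sum_i x ord0 i ^+ 2 = 1].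

Definition cball n : set 'rV[R]_n := [set x | \sum_i x ord0 i ^+ 2 <= 1].

Definition homeomorphic (X Y : topologicalType) (A : set X) (B : set Y) : Prop :=
  exists (f : X -> Y) (g : Y -> X),
    [/\ {within A, continuous f}, {within B, continuous g},
        forall x, A x -> B (f x) /\ g (f x) = x &
        forall y, B y -> A (g y) /\ f (g y) = y].

(* Finite triangulation of a compact 4-manifold with (possibly empty) boundary:
   the link of each k-simplex is a sphere S^(3-k) or a ball B^(3-k).  Here
   #|F| = k + 1; for k = 4 the link is S^(-1), i.e. empty. *)
Definition triangulated_4manifold K : Prop :=
  simplicial_complex K /\
  forall F, F \in K -> (#|F| <= 5)%N /\
    (homeomorphic (realization (link K F)) (@sphere (5 - #|F|)) \/
     (#|F| < 5)%N /\
       homeomorphic (realization (link K F)) (@cball (4 - #|F|))).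

(* Position of v in the increasing enumeration of F. *)
Definition position F (v : V) : nat := #|[set w in F | (w < v)%O]%SET|.

(* There is an orientation o of the 4-simplices, relative to the vertex order,
   inducing opposite orientations on each tetrahedron T shared by two of them. *)
Definition orientable K : Prop :=
  exists o : {set V} -> bool,
  forall T v w, #|T| = 4 -> v \notin T -> w \notin T -> v != w ->
    (v |: T)%SET \in K -> (w |: T)%SET \in K ->
    o (v |: T)%SET (+) odd (position (v |: T)%SET v) !=
    o (w |: T)%SET (+) odd (position (w |: T)%SET w).

(* Faces of the tetrahedra that lie in exactly one 4-simplex. *)
Definition boundary K : {set {set V}} :=
  [set F in K | [exists T in K, [&& #|T| == 4, F \subset T &
     #|[set S in K | (#|S| == 5) && (T \subset S)]%SET| == 1]]]%SET.

Definition vertex_set k (f : 'I_k -> V) : {set V} := [set f i | i : 'I_k]%SET.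

(* The k-simplices of K, with their vertices in increasing order. *)
Definition simplices k K : {set {ffun 'I_k.+1 -> V}} :=
  [set f : {ffun 'I_k.+1 -> V} |
     [forall i : 'I_k.+1, forall j : 'I_k.+1,
        (i < j)%N ==> (f i < f j)%O] &&
     (vertex_set f \in K)]%SET.

Definition interior_simplices k K : {set {ffun 'I_k.+1 -> V}} :=
  [set f in simplices k K | vertex_set f \notin boundary K]%SET.

Definition edge_labels k (l : {set V} -> R) (f : 'I_k -> V) :
    'I_k -> 'I_k -> R :=
  fun i j => l [set f i; f j]%SET.

Definition triangle_labels k (s : {set V} -> int) (f : 'I_k -> V) :
    'I_k -> 'I_k -> 'I_k -> int :=
  fun i j k => s [set f i; f j; f k]%SET.

Definition admissible_lengths K (l : {set V} -> R) : Prop :=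
  (forall F, F \in K -> #|F| = 2 -> 0 < l F) /\
  (forall f, f \in simplices 4 K -> simplex_lengths (edge_labels l f)).

Definition triangle_factor K (l : {set V} -> R) : R :=
  \prod_(f in interior_simplices 2 K) (2 * triangle_area (edge_labels l f)).

Definition W (Phi : int -> 'M[R]_4 -> R[i])
    (mu : ('I_5 -> 'I_5 -> R) -> {measure set pentagon R -> \bar R})
    K (l : {set V} -> R) (s : {set V} -> int) : R[i] :=
  (triangle_factor K l)%:C *
  \prod_(f in interior_simplices 3 K)
    (-1) ^ (\sum_(a < 4) s (vertex_set (f \o lift a))) *
  \prod_(f in simplices 4 K)
    tenj_symbol Phi mu (edge_labels l f) (triangle_labels s f).

(* The sum over the triangles t of the 4-simplex is indexed by the two vertices
   a < b not in t, so that t is the intersection of the tetrahedra opposite to a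
   and to b. *)
Definition W_angles K (l : {set V} -> R) (s : {set V} -> int) : R[i] :=
  (triangle_factor K l *
   \prod_(f in simplices 4 K)
     (cos (\sum_(a < 5) \sum_(b < 5 | (a < b)%N)
             (s (vertex_set f :\ f a :\ f b)%SET)%:~R *
             dihedral_angle (edge_labels l f) a b)
      / V4 (edge_labels l f)))%:C.

(* Two labellings with the same restrictions to a subcomplex B. *)
Definition same_labels (B : {set {set V}}) (l l' : {set V} -> R)
    (s s' : {set V} -> int) : Prop :=
  forall F, F \in B ->
    (#|F| = 2 -> l F = l' F) /\ (#|F| = 3 -> s F = s' F).

End Triangulations.

(* Main.v *)
Require Import Defs.
From HB Require Import structures.
From mathcomp Require Import all_boot all_order all_algebra fingroup perm.
From mathcomp Require Import all_classical all_reals all_analysis.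
From mathcomp Require Import measurable_realfun complex.
From mathcomp Require Import ring lra.

Set Implicit Arguments.
Unset Strict Implicit.
Unset Printing Implicit Defensive.

Import Order.TTheory GRing.Theory Num.Theory.
Import numFieldNormedType.Exports.

Local Open Scope classical_set_scope.
Local Open Scope ring_scope.
Local Open Scope complex_scope.

(** Everything happens inside one 4-simplex; the manifold only enters through a
    count of tetrahedra modulo 2.

    Inside a 4-simplex, the configurations P_l are the congruence classes of the
    simplex under translation: two orbits of SO(4), one for each orientation.
    Two facts give the 10j symbol.

    First, the integrand is constant on each orbit. Let the triangle t be the
    intersection of the tetrahedra a and b. The rotations which carry the
    reference triangle to t inside a and inside b agree on the plane of t, so
    they differ by some h theta, and the quotient of their phases is
    exp (i s theta) (pair_phase). Both rotations send e_4 to the normal of their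
    tetrahedron (face_frame). The use of the flipped reference tetrahedron for
    every other facet makes all these normals point outward for one orientation
    of the simplex and inward for the other (tet_frame), so theta is, up to the
    orientation, the angle of the outward normals, that is, the supplement of
    the dihedral angle. The supplement produces the factor (-1)^s, and the
    integrand is the product over the triangles of (-1)^s exp (+- i s phi)
    (integrandE).

    Second, each orbit has mass 1 / (2 V) (oriented_mass). The regularized delta
    functions are normalized indicators of a tube around P_l. Its Lebesgue
    measure is found by adding the edges of the pentagon one by one: given the
    earlier edges, the admissible set for the next one is a neighbourhood of a
    sphere, described by its scalar products with the earlier edges and by its
    distance to their span (edge_slice_bounds). The resulting four densities are
    continuous in the edge lengths (near_length_density), so the fibres of the
    tube have nearly constant volume (tube_bounds), and the product of the
    densities telescopes to pi^4 / V (prod_length_density). Test functions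
    supported in small tubes transfer this to the measure on P_l. Moreover V is
    4! times the volume of the convex hull, by a linear change of variables
    (V4E).

    Hence the two orbits contribute conjugate values with equal weights, and the
    10j symbol is the product of the signs (-1)^s with cos (sum s phi) / V
    (tenj_symbolE).

    For the signs, a tetrahedron lies in two 4-simplices, or in one if it is on
    the boundary, because its link is a 0-dimensional sphere or ball
    (tet_degreeP). Counting the flags around a triangle, the number of
    4-simplices plus the number of interior tetrahedra is, modulo 2, half the
    number of boundary tetrahedra. So all signs cancel except those of the
    boundary triangles (total_sign). *)

(** * Lebesgue measure as an iterated product *)

Section ProductMeasure.
Context d1 d2 (T1 : measurableType d1) (T2 : measurableType d2) (R : realType).
Variables (m1 : {sigma_finite_measure set T1 -> \bar R})
  (m2 : {sigma_finite_measure set T2 -> \bar R}).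

Definition prodm : set (T1 * T2) -> \bar R := (m1 \x m2)%E.

HB.instance Definition _ := Measure.on prodm.

Let sigma_finite_prodm : sigma_finite setT prodm.
Proof.
have /sigma_finiteP[F [FT ndF F_fin]] := sigma_finiteT m1.
have /sigma_finiteP[G [GT ndG G_fin]] := sigma_finiteT m2.
exists (fun n => F n `*` G n).
  apply/esym/seteqP; split=> // -[x y] _.
  have [] : (\bigcup_n F n) x /\ (\bigcup_n G n) y by rewrite -FT -GT.
  move=> [n _ Fx] [k _ Gy]; exists (maxn n k) => //; split.
    by move: x Fx; exact/subsetPset/ndF/leq_maxl.
  by move: y Gy; exact/subsetPset/ndG/leq_maxr.
move=> n; have [mF Foo] := F_fin n; have [mG Goo] := G_fin n.
split; first exact: measurableX.
by rewrite /prodm product_measure1E// lte_mul_pinfty// ge0_fin_numE.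
Qed.

HB.instance Definition _ :=
  Measure_isSigmaFinite.Build _ _ _ prodm sigma_finite_prodm.

End ProductMeasure.

Section ImageMeasure.
Context d1 d2 (T1 : measurableType d1) (T2 : measurableType d2) (R : realType).
Variables (m : {measure set T1 -> \bar R}) (f : T1 -> T2).
Hypothesis mf : measurable_fun setT f.

Definition image_measure : {measure set T2 -> \bar R} :=
  measure_function_pushforward__canonical__measure_function_Measure m mf.

Lemma image_measureE A : image_measure A = m (f @^-1` A).
Proof. by []. Qed.

End ImageMeasure.

Section ScaledMeasure.
Context d (T : measurableType d) (R : realType).
Variables (m : {measure set T -> \bar R}) (c : R).
Hypothesis c0 : 0 <= c.

Definition scaled_measure : {measure set T -> \bar R} := mscale (NngNum c0) m.

Lemma scaled_measureE A : scaled_measure A = (c%:E * m A)%E.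
Proof. by []. Qed.

End ScaledMeasure.

Section LebesgueMeasures.
Variable R : realType.

Let lebesgue1_0 : @lebesgue1 R set0 = 0%E.
Proof. exact: measure0. Qed.

Let lebesgue1_ge0 A : (0 <= @lebesgue1 R A)%E.
Proof. exact: measure_ge0. Qed.

Let lebesgue1_semi_sigma_additive : semi_sigma_additive (@lebesgue1 R).
Proof. exact: (@measure_semi_sigma_additive _ _ _ (@lebesgue_measure R)). Qed.

HB.instance Definition _ := isMeasure.Build _ _ _ (@lebesgue1 R)
  lebesgue1_0 lebesgue1_ge0 lebesgue1_semi_sigma_additive.

Let sigma_finite_lebesgue1 : sigma_finite setT (@lebesgue1 R).
Proof. exact: (@sigma_finiteT _ _ _ (@lebesgue_measure R)). Qed.

HB.instance Definition _ :=
  Measure_isSigmaFinite.Build _ _ _ (@lebesgue1 R) sigma_finite_lebesgue1.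

Definition lam1 : {sigma_finite_measure set R -> \bar R} := @lebesgue1 R.
Definition lam2 : {sigma_finite_measure set (R * R)%type -> \bar R} :=
  prodm lam1 lam1.
Definition lam3 : {sigma_finite_measure set (R * R * R)%type -> \bar R} :=
  prodm lam2 lam1.
Definition lam4 : {sigma_finite_measure set (space4 R) -> \bar R} :=
  prodm lam3 lam1.

Lemma lebesgue4E : @lebesgue4 R = lam4.
Proof. reflexivity. Qed.

Lemma pentagon_lebesgueE : @pentagon_lebesgue R =
  prodm (prodm (prodm lam4 lam4) lam4) lam4.
Proof. reflexivity. Qed.

End LebesgueMeasures.

(** * Maps scaling a measure *)

Section ScalingMaps.
Variable R : realType.

(** The image of m under T is c times n; the change-of-variables statements
    below say that a map scales Lebesgue measure by the inverse of its
    Jacobian. *)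
Definition scales d1 d2 (X : measurableType d1) (Y : measurableType d2)
    (m : set X -> \bar R) (n : set Y -> \bar R) (c : R) (T : X -> Y) : Prop :=
  [/\ 0 < c, measurable_fun setT T &
      forall A, measurable A -> m (T @^-1` A) = (c%:E * n A)%E].

Lemma measurable_preimageT d1 d2 (X : measurableType d1) (Y : measurableType d2)
    (T : X -> Y) A :
  measurable_fun setT T -> measurable A -> measurable (T @^-1` A).
Proof. by move=> mT mA; rewrite -[X in measurable X]setTI; exact: mT. Qed.

Lemma scales_comp d1 d2 d3 (X : measurableType d1) (Y : measurableType d2)
    (Z : measurableType d3) (m : set X -> \bar R) (n : set Y -> \bar R)
    (p : set Z -> \bar R) (c c' : R) (T : Y -> Z) (T' : X -> Y) :
  scales n p c T -> scales m n c' T' -> scales m p (c * c') (T \o T').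
Proof.
move=> [c0 mT cT] [c0' mT' cT']; split; first exact: mulr_gt0.
  exact: measurableT_comp.
move=> A mA; rewrite comp_preimage cT'; last exact: measurable_preimageT.
by rewrite cT// muleA -EFinM mulrC.
Qed.

Lemma scales_id d (X : measurableType d) (m : set X -> \bar R) :
  scales m m 1 idfun.
Proof. by split=> [//||A mA]; [exact: measurable_id|rewrite mul1e]. Qed.

Lemma scales_inv d1 d2 (X : measurableType d1) (Y : measurableType d2)
    (m : set X -> \bar R) (n : set Y -> \bar R) (T : X -> Y) (T' : Y -> X) :
  measurable_fun setT T' -> cancel T T' ->
  scales m n 1 T -> scales n m 1 T'.
Proof.
move=> mT' TK [_ mT cT]; split=> // A mA.
have := cT _ (measurable_preimageT mT' mA); rewrite mul1e => <-.
by rewrite mul1e -comp_preimage (_ : T' \o T = idfun)//; apply/funext.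
Qed.

Lemma scales_rect d1 d2 d3 (X : measurableType d1) (Y : measurableType d2)
    (Z : measurableType d3) (m : {measure set Z -> \bar R})
    (n1 : {sigma_finite_measure set X -> \bar R})
    (n2 : {sigma_finite_measure set Y -> \bar R}) (c : R) (f : Z -> X * Y) :
  0 < c -> measurable_fun setT f ->
  (forall A B, measurable A -> measurable B ->
     m (f @^-1` (A `*` B)) = (c%:E * (n1 A * n2 B))%E) ->
  scales m (prodm n1 n2) c f.
Proof.
move=> c0 mf fE; split=> // A mA.
have ic0 : 0 <= c^-1 by rewrite invr_ge0 ltW.
pose nu := scaled_measure (image_measure m mf) ic0.
have -> : prodm n1 n2 A = nu A.
  apply: product_measure_unique => // B C mB mC.
  rewrite scaled_measureE image_measureE [X in (_ * X = _)%E]fE//.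
  by rewrite muleA -EFinM mulVf ?mul1e// gt_eqF.
rewrite scaled_measureE image_measureE muleA -EFinM divff ?mul1e//.
by rewrite gt_eqF.
Qed.

End ScalingMaps.

Section AffineLine.
Variable R : realType.

Let affine_mfun (a b : R) : measurable_fun setT (fun y : R => a * y + b).
Proof.
apply: measurable_funD; last exact: measurable_cst.
exact: measurable_funM.
Qed.

Lemma lebesgue1_itv (i : interval R) : lam1 R [set` i] =
  (if i.1 < i.2 then (i.2 : \bar R) - i.1 else 0)%E.
Proof. exact: lebesgue_measure_itv. Qed.

Lemma scales_affine (a b : R) : a != 0 ->
  scales (lam1 R) (lam1 R) `|a|^-1 (fun y => a * y + b).
Proof.
move=> a0; have na0 : 0 < `|a| by rewrite normr_gt0.
split; [by rewrite invr_gt0|exact: affine_mfun|move=> A mA].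
pose f : measurableTypeR R -> measurableTypeR R := fun y => a * y + b.
have mf : measurable_fun setT f by exact: affine_mfun.
pose nu := scaled_measure (image_measure (@lebesgue_measure R) mf) (ltW na0).
have -> : lam1 R A = nu A.
  apply: lebesgue_measure_unique => // _ [[u v] _ <-].
  rewrite scaled_measureE image_measureE lebesgue_measure_itv/= lte_fin.
  have [a_gt0|a_lt0|a_eq0] := ltgtP 0 a; last by rewrite -a_eq0 eqxx in a0.
    have -> : f @^-1` `]u, v] = `](u - b) / a, (v - b) / a]%classic.
      apply/seteqP; split=> y; rewrite /f/= !in_itv/=.
        by move=> /andP[uy yv]; rewrite ltr_pdivrMr// ler_pdivlMr//; apply/andP;
           split; lra.
      by rewrite ltr_pdivrMr// ler_pdivlMr// => /andP[uy yv]; apply/andP;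
        split; lra.
    rewrite lebesgue_measure_itv/= lte_fin ltr_pM2r ?invr_gt0// ltrD2r.
    case: ifPn => uv; last by rewrite mule0.
    rewrite -!EFinB -EFinM gtr0_norm//; congr EFin.
    by field; rewrite gt_eqF.
  have -> : f @^-1` `]u, v] = `[(v - b) / a, (u - b) / a[%classic.
    apply/seteqP; split=> y; rewrite /f/= !in_itv/=.
      by move=> /andP[uy yv]; rewrite ltr_ndivlMr// ler_ndivrMr//; apply/andP;
         split; lra.
    by rewrite ltr_ndivlMr// ler_ndivrMr// => /andP[uy yv]; apply/andP;
      split; lra.
  rewrite lebesgue_measure_itv/= lte_fin ltr_nM2r ?invr_lt0// ltrD2r.
  case: ifPn => uv; last by rewrite mule0.
  rewrite -!EFinB -EFinM ltr0_norm//; congr EFin.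
  by field; rewrite lt_eqF.
rewrite scaled_measureE image_measureE muleA -EFinM mulVf ?mul1e//.
by rewrite gt_eqF.
Qed.

End AffineLine.

Section SkewProduct.
Context d (X : measurableType d) (R : realType).
Variable m : {sigma_finite_measure set X -> \bar R}.

(** Shearing the last coordinate by a function of the others preserves volume,
    by Fubini; this is how triangular matrices act. *)
Lemma scales_skew (c a : R) (T : X -> X) (b : X -> R) :
  scales m m c T -> a != 0 -> measurable_fun setT b ->
  scales (prodm m (lam1 R)) (prodm m (lam1 R)) (c * `|a|^-1)
    (fun z => (T z.1, a * z.2 + b z.1)).
Proof.
move=> [c0 mT cT] a0 mb.
pose f (z : X * R) := (T z.1, a * z.2 + b z.1).
have mf : measurable_fun setT f.
  apply: measurable_fun_pair; first exact: measurableT_comp.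
  apply: measurable_funD; last exact: measurableT_comp.
  by apply: measurable_funM => //; exact: measurable_cst.
have k0 : 0 < c * `|a|^-1 by rewrite mulr_gt0 ?invr_gt0 ?normr_gt0.
apply: scales_rect => // B C mB mC.
rewrite [LHS](_ : _ =
    (\int[m]_x ((`|a|^-1)%:E * lam1 R C * (\1_(T @^-1` B) x)%:E))%E); last first.
  apply: eq_integral => x _ /=.
  have [xB|xB] := boolP (x \in T @^-1` B).
    rewrite indicE xB mule1.
    have [_ _ <-//] := scales_affine (b x) a0.
    congr (lam1 R _); apply/seteqP; split=> y.
      by rewrite /xsection/= in_setE => -[].
    by rewrite /xsection/= in_setE /f/= => ?; split=> //; rewrite inE in xB.
  rewrite indicE (negbTE xB) mule0.
  rewrite (_ : xsection _ _ = set0) ?measure0//.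
  apply/seteqP; split=> y //; rewrite /xsection/= in_setE => -[/= TB _].
  by move: xB; rewrite notin_setE.
have mTB := measurable_preimageT mT mB.
rewrite ge0_integralZl//; last 2 first.
- by apply/measurable_EFinP; exact: measurable_indic.
- by rewrite mule_ge0// lee_fin.
rewrite integral_indic// setIT.
rewrite [X in (_ * X = _)%E](_ : _ = (c%:E * m B)%E); last exact: cT.
by rewrite muleACA -EFinM [`|a|^-1 * c]mulrC [(lam1 R C * _)%E]muleC.
Qed.

End SkewProduct.

Section Rearrangements.
Variable R : realType.
Context d1 d2 d3 (X : measurableType d1) (Y : measurableType d2)
  (Z : measurableType d3).
Variables (m : {sigma_finite_measure set X -> \bar R})
  (n : {sigma_finite_measure set Y -> \bar R})
  (p : {sigma_finite_measure set Z -> \bar R}).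

Lemma prodmX A B : measurable A -> measurable B ->
  prodm m n (A `*` B) = (m A * n B)%E.
Proof. by move=> mA mB; rewrite /prodm product_measure1E. Qed.

Lemma scales_swap : scales (prodm m n) (prodm n m) 1 (fun z => (z.2, z.1)).
Proof.
apply: scales_rect => //; first exact: measurable_fun_pair.
move=> A B mA mB; rewrite mul1e muleC -[RHS]prodmX//.
by congr (prodm m n _); apply/seteqP; split=> -[x y] [].
Qed.

Lemma scales_assoc : scales (prodm (prodm m n) p) (prodm m (prodm n p)) 1
  (fun z => (z.1.1, (z.1.2, z.2))).
Proof.
have mf : measurable_fun setT (fun z : X * Y * Z => (z.1.1, (z.1.2, z.2))).
  apply: measurable_fun_pair; first exact: measurableT_comp.
  by apply: measurable_fun_pair => //; exact: measurableT_comp.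
apply: scales_rect => // A B mA mB; rewrite mul1e.
pose phi (z : X * Y) := ((\1_A z.1)%:E * p (xsection B z.2))%E.
have mphi : measurable_fun setT phi.
  apply: emeasurable_funM.
    apply/measurable_EFinP.
    by apply: measurableT_comp => //; exact: measurable_indic.
  have mpB := measurable_fun_xsection p mB.
  by apply: (measurableT_comp mpB).
transitivity (\int[prodm m n]_z phi z)%E.
  apply: eq_integral => -[x y] _; rewrite /phi/= indicE.
  have [xA|xA] := boolP (x \in A).
    rewrite mul1e; congr (p _); apply/seteqP; split=> z; rewrite /xsection/=.
      by rewrite !in_setE => -[].
    by rewrite !in_setE => ?; split=> //; rewrite inE in xA.
  rewrite mul0e (_ : xsection _ _ = set0) ?measure0//.
  apply/seteqP; split=> z //; rewrite /xsection/= in_setE => -[/= xA' _].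
  by move: xA; rewrite notin_setE.
rewrite [LHS](@fubini_tonelli1 _ _ _ _ _ m n phi)//; last first.
  by move=> z; rewrite mule_ge0// lee_fin.
transitivity (\int[m]_x ((\1_A x)%:E * prodm n p B))%E.
  apply: eq_integral => x _; rewrite /fubini_F /phi/= ge0_integralZl//.
  exact: measurable_fun_xsection.
rewrite ge0_integralZr//; last by apply/measurable_EFinP; exact: measurable_indic.
by rewrite integral_indic// setIT.
Qed.

End Rearrangements.

Section RearrangeLast.
Variable R : realType.
Context d1 d2 d3 (X : measurableType d1) (Y : measurableType d2)
  (Z : measurableType d3).
Variables (m : {sigma_finite_measure set X -> \bar R})
  (n : {sigma_finite_measure set Y -> \bar R})
  (p : {sigma_finite_measure set Z -> \bar R}).

Lemma scales_pair d4 (X' : measurableType d4)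
    (m' : {sigma_finite_measure set X' -> \bar R}) d5 (Y' : measurableType d5)
    (n' : {sigma_finite_measure set Y' -> \bar R}) (c c' : R)
    (f : X -> X') (g : Y -> Y') :
  scales m m' c f -> scales n n' c' g ->
  scales (prodm m n) (prodm m' n') (c * c') (fun z => (f z.1, g z.2)).
Proof.
move=> [c0 mf cf] [c0' mg cg]; apply: scales_rect; first exact: mulr_gt0.
  by apply: measurable_fun_pair; exact: measurableT_comp.
move=> A B mA mB.
transitivity (prodm m n ((f @^-1` A) `*` (g @^-1` B))) => //.
rewrite prodmX; [|exact: measurable_preimageT..].
by rewrite cf// cg// muleACA.
Qed.

Lemma scales_unassoc : scales (prodm m (prodm n p)) (prodm (prodm m n) p) 1
  (fun z => ((z.1, z.2.1), z.2.2)).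
Proof.
apply: scales_inv (scales_assoc m n p) => //; last by move=> [[]].
apply: measurable_fun_pair; last exact: measurableT_comp.
by apply: measurable_fun_pair => //; exact: measurableT_comp.
Qed.

End RearrangeLast.

Lemma scales_swap_last (R : realType) d1 d2 d3 (X : measurableType d1)
    (Y : measurableType d2) (Z : measurableType d3)
    (m : {sigma_finite_measure set X -> \bar R})
    (n : {sigma_finite_measure set Y -> \bar R})
    (p : {sigma_finite_measure set Z -> \bar R}) :
  scales (prodm (prodm m n) p) (prodm (prodm m p) n) 1
    (fun z => ((z.1.1, z.2), z.1.2)).
Proof.
have := scales_comp (scales_unassoc m p n)
  (scales_comp (scales_pair (scales_id m) (scales_swap n p))
     (scales_assoc m n p)).
by rewrite !mulr1.
Qed.

(** * Linear change of variables in dimension 4 *)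

Notation o0 := (@Ordinal 4 0 isT).
Notation o1 := (@Ordinal 4 1 isT).
Notation o2 := (@Ordinal 4 2 isT).
Notation o3 := (@Ordinal 4 3 isT).

Lemma sum_ord4 (V : nmodType) (F : 'I_4 -> V) :
  \sum_(i < 4) F i = F o0 + F o1 + F o2 + F o3.
Proof.
by rewrite !big_ord_recr/= big_ord0 add0r; do !congr (_ + _); congr F;
   apply: val_inj.
Qed.

Lemma prod_ord4 (V : pzRingType) (F : 'I_4 -> V) :
  \prod_(i < 4) F i = F o0 * F o1 * F o2 * F o3.
Proof.
by rewrite !big_ord_recr/= big_ord0 mul1r; do !congr (_ * _); congr F;
   apply: val_inj.
Qed.

Lemma ord4P (P : 'I_4 -> Prop) :
  P o0 -> P o1 -> P o2 -> P o3 -> forall i, P i.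
Proof.
by move=> P0 P1 P2 P3 [[|[|[|[|//]]]] iP];
  [move: P0|move: P1|move: P2|move: P3]; congr P; apply: val_inj.
Qed.

Section LinearChangeOfVariables.
Variable R : realType.
Implicit Types (A B : 'M[R]_4) (x : space4 R).

Definition unvec4 (v : 'cV[R]_4) : space4 R :=
  (v o0 ord0, v o1 ord0, v o2 ord0, v o3 ord0).

Lemma vec4K : cancel (@vec4 R) unvec4.
Proof. by move=> [[[a b] c] d]; rewrite /unvec4 !mxE. Qed.

Lemma unvec4K : cancel unvec4 (@vec4 R).
Proof.
by move=> v; apply/matrixP=> i j; rewrite mxE (ord1 j); move: i; apply: ord4P.
Qed.

Definition lin4 A x : space4 R := unvec4 (A *m vec4 x).

Lemma lin4M A B : lin4 (A *m B) = lin4 A \o lin4 B.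
Proof. by apply/funext=> x; rewrite /lin4/= unvec4K mulmxA. Qed.

Let det_lower A : (forall i j : 'I_4, (i < j)%N -> A i j = 0) ->
  \det A = A o0 o0 * A o1 o1 * A o2 o2 * A o3 o3.
Proof.
move=> A0; rewrite det_trig ?prod_ord4//.
by apply/is_trig_mxP => i j ij; exact: A0.
Qed.

Lemma scales_lower A : (forall i j : 'I_4, (i < j)%N -> A i j = 0) ->
  \det A != 0 -> scales (lam4 R) (lam4 R) `|\det A|^-1 (lin4 A).
Proof.
move=> A0; rewrite (det_lower A0) !mulf_eq0 !negb_or -!andbA => /and4P[a0 a1 a2 a3].
have s1 := scales_affine 0 a0.
have m2 : measurable_fun setT (fun x : R => A o1 o0 * x).
  by apply: measurable_funM => //; exact: measurable_cst.
have s2 := scales_skew s1 a1 m2.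
have m3 : measurable_fun setT (fun x : R * R => A o2 o0 * x.1 + A o2 o1 * x.2).
  by apply: measurable_funD; apply: measurable_funM => //; exact: measurable_cst.
have s3 := scales_skew s2 a2 m3.
have m4 : measurable_fun setT (fun x : R * R * R =>
    A o3 o0 * x.1.1 + A o3 o1 * x.1.2 + A o3 o2 * x.2).
  apply: measurable_funD; last first.
    by apply: measurable_funM => //; exact: measurable_cst.
  apply: measurable_funD; apply: measurable_funM; try exact: measurable_cst;
    exact: measurableT_comp.
have := scales_skew s3 a3 m4.
rewrite !normrM !invfM [X in scales _ _ _ X](_ : _ = lin4 A)//.
apply/funext=> -[[[x y] z] t]; rewrite /lin4 /unvec4 !mxE !sum_ord4 !mxE/=.
rewrite (A0 o0 o1)// (A0 o0 o2)// (A0 o0 o3)// (A0 o1 o2)// (A0 o1 o3)//.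
by rewrite (A0 o2 o3)//; congr (_, _, _, _); ring.
Qed.

Definition good_change A := scales (lam4 R) (lam4 R) `|\det A|^-1 (lin4 A).

Lemma good_changeM A B : good_change A -> good_change B -> good_change (A *m B).
Proof.
by move=> gA gB; rewrite /good_change det_mulmx lin4M normrM invfM;
   exact: scales_comp gA gB.
Qed.

Lemma good_change_swap01 : good_change (tperm_mx o0 o1).
Proof.
rewrite /good_change det_perm odd_tperm/= expr1 normrN1 invr1.
have := scales_pair (scales_pair (scales_swap (lam1 R) (lam1 R))
  (scales_id (lam1 R))) (scales_id (lam1 R)).
rewrite !mulr1; congr scales; apply/funext=> -[[[x y] z] t].
by rewrite /lin4 -row_permE /unvec4 !mxE/= tpermL tpermR !tpermD.
Qed.

Lemma good_change_swap12 : good_change (tperm_mx o1 o2).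
Proof.
rewrite /good_change det_perm odd_tperm/= expr1 normrN1 invr1.
have := scales_pair (scales_swap_last (lam1 R) (lam1 R) (lam1 R))
  (scales_id (lam1 R)).
rewrite !mulr1; congr scales; apply/funext=> -[[[x y] z] t].
by rewrite /lin4 -row_permE /unvec4 !mxE/= tpermL tpermR !tpermD.
Qed.

Lemma good_change_swap23 : good_change (tperm_mx o2 o3).
Proof.
rewrite /good_change det_perm odd_tperm/= expr1 normrN1 invr1.
have := scales_swap_last (lam2 R) (lam1 R) (lam1 R).
congr scales; apply/funext=> -[[[x y] z] t].
by rewrite /lin4 -row_permE /unvec4 !mxE/= tpermL tpermR !tpermD.
Qed.

Lemma good_change_perm (s : 'S_4) : good_change (perm_mx s).
Proof.
have step (i j k : 'I_4) : i != j -> j != k -> i != k ->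
    good_change (tperm_mx i j) -> good_change (tperm_mx j k) ->
    good_change (tperm_mx i k).
  move=> ij jk ik gij gjk.
  have -> : tperm_mx i k = tperm_mx j k *m tperm_mx i j *m tperm_mx j k :> 'M[R]_4.
    rewrite /tperm_mx -!perm_mxM; congr perm_mx.
    have := tpermJ i j (tperm j k); rewrite tpermL tpermD 1?eq_sym// => <-.
    by rewrite /conjg tpermV mulgA.
  by do 2!apply: good_changeM => //.
have sym (i j : 'I_4) : good_change (tperm_mx i j) -> good_change (tperm_mx j i).
  by rewrite /tperm_mx tpermC.
have g01 := good_change_swap01; have g12 := good_change_swap12.
have g23 := good_change_swap23.
have g02 := step o0 o1 o2 isT isT isT g01 g12.
have g13 := step o1 o2 o3 isT isT isT g12 g23.
have g03 := step o0 o2 o3 isT isT isT g02 g23.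
have gt (i j : 'I_4) : i != j -> good_change (tperm_mx i j).
  by move: i j; apply: ord4P; apply: ord4P => // _; exact: sym.
have [ts -> ] := prod_tpermP s.
elim: ts => [_|[i j] ts IH /=].
  rewrite big_nil perm_mx1 /good_change det1 normr1 invr1.
  rewrite (_ : lin4 _ = idfun); first exact: scales_id.
  by apply/funext=> x; rewrite /lin4 mul1mx vec4K.
rewrite big_cons perm_mxM => /andP[ij ts_ok].
by apply: good_changeM; [exact: gt|exact: IH].
Qed.

(** Gaussian elimination writes a matrix as a product of permutation and
    triangular matrices, for which the claim is Fubini's theorem. *)
Theorem linear_change A : \det A != 0 -> good_change A.
Proof.
move=> A0.
have [s [L [U [PA Ll detL Uu]]]] : exists (s : 'S_4) (L U : 'M[R]_4),
    [/\ perm_mx s *m A = L *m U,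
        forall i j : 'I_4, (i <= j)%N -> L i j = (i == j)%:R, \det L = 1 &
        forall i j : 'I_4, (j < i)%N -> U i j = 0].
  have [s sP] := is_perm_mxP _ (cormen_lup_perm A).
  move: sP (cormen_lup_correct A) (@cormen_lup_lower _ _ A)
    (cormen_lup_detL A) (@cormen_lup_upper _ _ A).
  case: (cormen_lup A) => [[P L] U] /= -> PA Ll detL Uu.
  by exists s, L, U.
pose r : 'S_4 := perm (@rev_ord_inj 4).
have rV : r^-1%g = r.
  apply: (mulgI r); rewrite mulgV; apply/permP => i.
  by rewrite permM !permE rev_ordK.
pose J : 'M[R]_4 := perm_mx r.
have JE (B : 'M[R]_4) i j : (J *m B *m J) i j = B (rev_ord i) (rev_ord j).
  by rewrite /J -row_permE -{2}rV -col_permE !mxE !permE.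
have JJ : J *m J = 1%:M.
  have := JE 1%:M; rewrite mulmx1 => JJE.
  by apply/matrixP => i j; rewrite JJE !mxE (inj_eq rev_ord_inj).
have U0 : \det U != 0.
  apply: contra_neq A0 => U0.
  have := congr1 determinant PA; rewrite !det_mulmx U0 mulr0 det_perm.
  by move/eqP; rewrite mulf_eq0 signr_eq0 => /eqP.
have -> : A = perm_mx s^-1 *m (L *m (J *m (J *m U *m J) *m J)).
  rewrite !mulmxA -(mulmxA _ J J) JJ mulmx1 -(mulmxA _ J J) JJ mulmx1.
  by rewrite -mulmxA -PA mulmxA -perm_mxM mulVg perm_mx1 mul1mx.
apply: good_changeM; first exact: good_change_perm.
apply: good_changeM.
  apply: scales_lower; last by rewrite detL oner_eq0.
  by move=> i j ij; rewrite Ll ?(ltnW ij)// -val_eqE/= ltn_eqF.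
apply: good_changeM; last exact: good_change_perm.
apply: good_changeM; first exact: good_change_perm.
apply: scales_lower.
  move=> i j ij; rewrite JE Uu//=.
  by rewrite ltn_sub2l// (leq_ltn_trans ij).
rewrite !det_mulmx; do !rewrite mulf_neq0//.
all: by rewrite det_perm signr_eq0.
Qed.

Lemma lam4_preimage A S : \det A != 0 -> measurable S ->
  lam4 R (lin4 A @^-1` S) = (`|\det A|^-1%:E * lam4 R S)%E.
Proof. by move=> A0 mS; have [_ _ ->] := linear_change A0. Qed.

End LinearChangeOfVariables.

(** * Slicing, and the volume of the standard simplex *)

Section IteratedIntegrals.
Variable R : realType.
Context d1 d2 (X : measurableType d1) (Y : measurableType d2).
Variables (m : {sigma_finite_measure set X -> \bar R})
  (n : {sigma_finite_measure set Y -> \bar R}).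

Lemma prodmE A : prodm m n A = (\int[m]_x n (xsection A x))%E.
Proof. by []. Qed.

Lemma prodm_ysection A : measurable A ->
  prodm m n A = (\int[n]_y m (ysection A y))%E.
Proof.
move=> mA; have [_ _ /(_ _ mA)] := scales_swap n m; rewrite mul1e => <-.
apply: eq_integral => y _; congr (m _); apply/seteqP; split=> x;
  by rewrite /xsection/ysection/= !in_setE.
Qed.

(** Cavalieri, with fibres of nearly constant volume. *)
Lemma prodm_fiber_bounds (S : set (X * Y)) (S0 : set X) (a b : R) :
  measurable S -> measurable S0 -> 0 <= a -> 0 <= b ->
  (forall x, ~ S0 x -> xsection S x = set0) ->
  (forall x, S0 x -> (a%:E <= n (xsection S x) <= b%:E)%E) ->
  (a%:E * m S0 <= prodm m n S <= b%:E * m S0)%E.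
Proof.
move=> mS mS0 a0 b0 S_out S_in.
have mn := measurable_fun_xsection n mS.
have cE (c : R) : 0 <= c ->
    (c%:E * m S0)%E = (\int[m]_x (c%:E * (\1_S0 x)%:E))%E.
  move=> c0; rewrite ge0_integralZl//.
    by rewrite integral_indic// setIT.
  by apply/measurable_EFinP; exact: measurable_indic.
have mc (c : R) : measurable_fun setT (fun x => (c%:E * (\1_S0 x)%:E)%E).
  apply: emeasurable_funM => //.
  by apply/measurable_EFinP; exact: measurable_indic.
rewrite prodmE !cE//; apply/andP; split; apply: ge0_le_integral => //.
- by move=> x _; rewrite mule_ge0 ?lee_fin.
- move=> x _; rewrite indicE; have [/set_mem/S_in/andP[+ _]|_] := boolP (x \in S0).
    by rewrite mule1.
  by rewrite mule0.
- move=> x _; rewrite indicE; have [/set_mem/S_in/andP[_]|] := boolP (x \in S0).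
    by rewrite mule1.
  by rewrite notin_setE => /S_out ->; rewrite measure0 mule0.
Qed.

End IteratedIntegrals.

Section IntegralLine.
Variable R : realType.

(* The product measures carry the Borel structure of R itself, while the
   fundamental theorem of calculus is stated for its copy measurableTypeR. *)
Lemma integral_lam1 (D : set R) (f : R -> \bar R) :
  measurable D -> measurable_fun D f -> (forall x, D x -> 0 <= f x)%E ->
  (\int[lam1 R]_(x in D) f x = \int[@lebesgue_measure R]_(x in D) f x)%E.
Proof.
move=> mD mf f0; have mid : measurable_fun setT (idfun : measurableTypeR R -> R).
  by move=> _ A mA; rewrite setTI.
have := @ge0_integral_pushforward _ _ (measurableTypeR R) R R idfun mid
  (@lebesgue_measure R) D f mD mf.
by apply => x /set_mem; exact: f0.
Qed.

Lemma integral_FTC (f F : R -> R) (a b : R) : a <= b ->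
  continuous f -> continuous F -> (forall x, a < x < b -> is_derive x 1 F (f x)) ->
  (forall x, a <= x <= b -> 0 <= f x) ->
  (\int[lam1 R]_(x in `[a, b]) (f x)%:E = (F b - F a)%:E)%E.
Proof.
move=> ab cf cF dF f0; rewrite integral_lam1//; last first.
  apply/measurable_EFinP; apply: measurable_funS (measurableT) _ _ => //.
  exact: continuous_measurable_fun.
move: ab; rewrite le_eqVlt => /predU1P[->|ab].
  by rewrite set_itv1 integral_set1 subrr.
rewrite EFinB; apply: continuous_FTC2 => //.
- exact: continuous_subspaceT.
- split.
  + by move=> x; rewrite in_itv/= => /dF[].
  + by apply: cvg_at_right_filter; exact: cF.
  + by apply: cvg_at_left_filter; exact: cF.
- by move=> x; rewrite in_itv/= => /dF xD; rewrite derive1E derive_val.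
Qed.

End IntegralLine.

Ltac conj_lra := repeat first [split | apply/andP; split]; lra.

Section StandardSimplex.
Variable R : realType.

(** A cone over a family of dilates: its slices at height y are the dilates of
    the base by t - y. *)
Lemma cone_volume d (X : measurableType d)
    (m : {sigma_finite_measure set X -> \bar R}) (S : R -> set X) (c : R)
    (n : nat) (C : set (X * R)) (t : R) :
  0 <= c -> 0 <= t -> measurable C ->
  (forall x y, C (x, y) <-> 0 <= y /\ S (t - y) x) ->
  (forall u, u < 0 -> S u = set0) ->
  (forall u, 0 <= u -> m (S u) = (c * u ^+ n)%:E) ->
  prodm m (lam1 R) C = (c * t ^+ n.+1 / n.+1%:R)%:E.
Proof.
move=> c0 t0 mC CE S0 SE; rewrite prodm_ysection//.
have yC y : 0 <= y <= t -> m (ysection C y) = (c * (t - y) ^+ n)%:E.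
  move=> /andP[y0 yt]; rewrite -SE ?subr_ge0//; congr (m _); apply/seteqP.
  by split=> x; rewrite /ysection/= in_setE CE => // -[].
have yC0 y : ~ (0 <= y <= t) -> m (ysection C y) = 0%E.
  move=> yt; rewrite (_ : ysection _ _ = set0) ?measure0//.
  apply/seteqP; split=> x //; rewrite /ysection/= in_setE CE => -[y0].
  by move: yt; rewrite y0/= => /negP; rewrite -ltNge -subr_lt0 => /S0 ->.
transitivity (\int[lam1 R]_(y in `[0%R, t]) (c * (t - y) ^+ n)%:E)%E.
  rewrite [RHS]integral_mkcond; apply: eq_integral => y _; rewrite patchE.
  case: ifPn => [/set_mem|]; first by rewrite /= in_itv/= => /yC.
  by rewrite notin_setE/= in_itv/= => /yC0.
pose F (y : R) : R := - (c / n.+1%:R) * (t - y) ^+ n.+1.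
have dF (x : R) : is_derive x 1 F (c * (t - x) ^+ n).
  have dB := is_deriveB (is_derive_cst t x 1) (is_derive_id x 1).
  have dX := is_deriveZ (- (c / n.+1%:R)) (is_deriveX n.+1 dB).
  rewrite [X in is_derive _ _ X _](_ : F = - (c / n.+1%:R) \*: (cst t - id) ^+ n.+1).
    move: dX; congr is_derive; rewrite /GRing.scale/= !fctE -natr1.
    by field; rewrite natr1 pnatr_eq0.
  by apply/funext => y; rewrite /F/= exprfctE.
have cF : continuous F.
  move=> x; apply: differentiable_continuous; apply/derivable1_diffP.
  by have [] := dF x.
rewrite (integral_FTC t0 _ cF)//.
- congr EFin; rewrite /F subrr subr0 exprS mul0r mulr0 sub0r.
  by rewrite mulNr opprK mulrAC.
- move=> x; apply: cvgM; first exact: cvg_cst.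
  apply: (continuous_comp (f := fun y => t - y) (g := fun y => y ^+ n)).
    by apply: cvgB; [exact: cvg_cst|exact: cvg_id].
  exact: exprn_continuous.
- by move=> x /andP[_ xt]; rewrite mulr_ge0// exprn_ge0// subr_ge0.
Qed.

Let mcoord_sum2 : measurable_fun setT (fun z : R * R => z.1 + z.2).
Proof. exact: measurable_funD. Qed.

Let mcoord_sum3 : measurable_fun setT (fun z : R * R * R => z.1.1 + z.1.2 + z.2).
Proof. by apply: measurable_funD => //; exact: (measurableT_comp mcoord_sum2). Qed.

Let measurable_simplex_step d (X : measurableType d) (f : X -> R)
    (S : set X) (t : R) : measurable_fun setT f -> measurable S ->
  measurable [set z : X * R | [/\ S z.1, 0 <= z.2 & f z.1 + z.2 <= t]].
Proof.
move=> mf mS.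
have mfz : measurable_fun setT (fun z : X * R => f z.1 + z.2).
  by apply: measurable_funD => //; exact: measurableT_comp.
have -> : [set z : X * R | [/\ S z.1, 0 <= z.2 & f z.1 + z.2 <= t]] =
    (fst @^-1` S) `&` (snd @^-1` `[0, +oo[) `&`
    ((fun z => f z.1 + z.2) @^-1` `]-oo, t]).
  apply/seteqP; split=> -[x y] /=; rewrite !in_itv/= andbT.
    by move=> [].
  by move=> [[]].
apply: measurableI; last exact: measurable_preimageT.
by apply: measurableI; exact: measurable_preimageT.
Qed.

Definition std_simplex4 (t : R) : set (space4 R) :=
  [set x | [/\ 0 <= x.1.1.1, 0 <= x.1.1.2, 0 <= x.1.2, 0 <= x.2 &
               x.1.1.1 + x.1.1.2 + x.1.2 + x.2 <= t]].

Lemma std_simplex4_volume :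
  measurable (std_simplex4 1) /\ lam4 R (std_simplex4 1) = (24%:R^-1)%:E.
Proof.
pose S1 (t : R) : set R := `[0, t]%classic.
pose S2 (t : R) : set (R * R) :=
  [set z | [/\ S1 t z.1, 0 <= z.2 & z.1 + z.2 <= t]].
pose S3 (t : R) : set (R * R * R) :=
  [set z | [/\ S2 t z.1, 0 <= z.2 & z.1.1 + z.1.2 + z.2 <= t]].
pose S4 (t : R) : set (R * R * R * R) :=
  [set z | [/\ S3 t z.1, 0 <= z.2 & z.1.1.1 + z.1.1.2 + z.1.2 + z.2 <= t]].
have mS1 t : measurable (S1 t) by exact: measurable_itv.
have mS2 t : measurable (S2 t).
  exact: (measurable_simplex_step _ (@measurable_id _ _ setT) (mS1 t)).
have mS3 t : measurable (S3 t).
  exact: (measurable_simplex_step _ mcoord_sum2 (mS2 t)).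
have mS4 t : measurable (S4 t).
  exact: (measurable_simplex_step _ mcoord_sum3 (mS3 t)).
have v1 (u : R) : 0 <= u -> lam1 R (S1 u) = (1 * u ^+ 1)%:E.
  move=> u0; rewrite lebesgue1_itv/= lte_fin.
  have [u_gt0|] := ltP 0 u; first by rewrite oppr0 adde0 mul1r expr1.
  by move=> u_le0; rewrite (@le_anti _ _ u 0) ?u0 ?u_le0// expr1 mulr0.
have e1 (u : R) : u < 0 -> S1 u = set0.
  move=> u0; apply/seteqP; split=> // x; rewrite /S1/= in_itv/= => /andP[x0 xu].
  by move: (le_lt_trans (le_trans x0 xu) u0); rewrite ltxx.
have v2 (u : R) : 0 <= u -> lam2 R (S2 u) = (2^-1 * u ^+ 2)%:E.
  move=> u0; rewrite [LHS](@cone_volume _ _ (lam1 R) S1 1 1 _ u)//.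
    by rewrite mul1r mulrC.
  move=> x y; rewrite /S2 /S1/= !in_itv/=; split.
    by move=> [/andP[x0 _] y0 s]; conj_lra.
  by move=> [y0 /andP[x0 xu]]; conj_lra.
have e2 (u : R) : u < 0 -> S2 u = set0.
  by move=> u0; apply/seteqP; split=> // x; rewrite /S2/= e1// => -[].
have v3 (u : R) : 0 <= u -> lam3 R (S3 u) = (6^-1 * u ^+ 3)%:E.
  move=> u0; rewrite [LHS](@cone_volume _ _ (lam2 R) S2 2^-1 2 _ u)//.
    by congr EFin; field.
  move=> [x1 x2] y; rewrite /S3 /S2 /S1/= !in_itv/=; split.
    by move=> [[/andP[x10 _] x20 _] y0 s]; conj_lra.
  by move=> [y0 [/andP[x10 _] x20 s]]; conj_lra.
have e3 (u : R) : u < 0 -> S3 u = set0.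
  by move=> u0; apply/seteqP; split=> // x; rewrite /S3/= e2// => -[].
have -> : std_simplex4 1 = S4 1.
  apply/seteqP; split=> -[[[x y] z] w]; rewrite /std_simplex4 /S4 /S3 /S2 /S1/=.
    by rewrite in_itv/= => -[x0 y0 z0 w0 s]; conj_lra.
  by rewrite in_itv/= => -[[[/andP[x0 _] y0 _] z0 _] w0 s]; conj_lra.
split=> //; rewrite [LHS](@cone_volume _ _ (lam3 R) S3 6^-1 3 _ 1)//.
  by congr EFin; field.
move=> [[x1 x2] x3] y; rewrite /S4 /S3 /S2 /S1/= !in_itv/=; split.
  by move=> [[[/andP[x10 _] x20 _] x30 _] y0 s]; conj_lra.
by move=> [y0 [[/andP[x10 _] x20 _] x30 s]]; conj_lra.
Qed.

End StandardSimplex.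

(** * Balls of dimension at most 4 *)

Section RadialDensities.
Variable R : realType.

Let integral_scale_lam1 (D : set R) (k : R) (f : R -> R) :
  measurable D -> measurable_fun D f -> (forall x, D x -> 0 <= f x) -> 0 <= k ->
  (\int[lam1 R]_(x in D) (k * f x)%:E =
   k%:E * \int[lam1 R]_(x in D) (f x)%:E)%E.
Proof.
move=> mD mf f0 k0; under eq_integral do rewrite EFinM.
by rewrite ge0_integralZl//; exact/measurable_EFinP.
Qed.

Lemma half_disc_area (r : R) : 0 <= r ->
  (\int[lam1 R]_(x in `[(- r)%R, r]) (Num.sqrt (r ^+ 2 - x ^+ 2))%:E =
   (pi / 2 * r ^+ 2)%:E)%E.
Proof.
have csqrt : continuous (fun x : R => Num.sqrt (r ^+ 2 - x ^+ 2)).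
  have c1 : continuous (fun y : R => r ^+ 2 - y ^+ 2).
    by move=> x; apply: cvgB; [exact: cvg_cst|exact: exprn_continuous].
  by move=> x; exact: (continuous_comp (c1 x) (@sqrt_continuous R _)).
have ccos2 : continuous (fun x : R => r ^+ 2 * cos x ^+ 2).
  move=> x; apply: cvgM; first exact: cvg_cst.
  exact: (continuous_comp (@continuous_cos R x) (@exprn_continuous R 2 _)).
rewrite integral_lam1//; last first.
  apply/measurable_EFinP; apply: measurable_funS (measurableT) _ _ => //.
  exact: continuous_measurable_fun.
rewrite le_eqVlt => /predU1P[<-|r0].
  by rewrite oppr0 set_itv1 integral_set1 expr0n/= mulr0.
have pi2 : - (pi / 2) <= pi / 2 :> R by have := pi_gt0 R; lra.
pose F (x : R) : R := r * sin x.
have dF (x : R) : is_derive x 1 F (r * cos x).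
  by have := is_deriveZ r (is_derive_sin x); apply.
have F'E : derive1 F = (fun x => r * cos x).
  by apply/funext => x; rewrite derive1E; have [_ ->] := dF x.
have cF' : continuous (fun x : R => r * cos x).
  by move=> x; apply: cvgM; [exact: cvg_cst|exact: continuous_cos].
have cF : continuous F.
  by move=> x; apply: cvgM; [exact: cvg_cst|exact: continuous_sin].
have -> : `[- r, r]%classic = `[F (- (pi / 2)), F (pi / 2)]%classic :> set R.
  by rewrite /F sinN sin_pihalf mulrN mulr1.
rewrite integration_by_substitution_increasing//; last 6 first.
- move=> x y xI yI xy; rewrite /F ltr_pM2l//.
  by rewrite ltr_sin.
- by move=> x _; rewrite F'E; exact: cF'.
- by rewrite F'E; apply: cvgP; apply: cvg_at_right_filter; exact: cF'.
- by rewrite F'E; apply: cvgP; apply: cvg_at_left_filter; exact: cF'.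
- split.
  + by move=> x _; have [] := dF x.
  + by apply: cvg_at_right_filter; exact: cF.
  + by apply: cvg_at_left_filter; exact: cF.
- exact: continuous_subspaceT.
transitivity (\int[@lebesgue_measure R]_(x in `[(- (pi / 2))%R, (pi / 2)%R])
    (r ^+ 2 * cos x ^+ 2)%:E)%E.
  apply: eq_integral => x; rewrite inE/= in_itv/= => xI; congr EFin.
  rewrite F'E /= /F.

  have c0 : 0 <= cos x by apply: cos_ge0_pihalf.
  change (Num.sqrt (r ^+ 2 - (r * sin x) ^+ 2) * (r * cos x) =
    r ^+ 2 * cos x ^+ 2).
  have -> : r ^+ 2 - (r * sin x) ^+ 2 = (r * cos x) ^+ 2.
    by rewrite !exprMn cos2sin2; ring.
  by rewrite sqrtr_sqr ger0_norm ?mulr_ge0// ?ltW//; ring.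
pose G (x : R) : R := r ^+ 2 / 2 * (x + sin x * cos x).
have dG (x : R) : is_derive x 1 G (r ^+ 2 * cos x ^+ 2).
  have := is_deriveZ (r ^+ 2 / 2) (is_deriveD (is_derive_id x 1)
    (is_deriveM (is_derive_sin x) (is_derive_cos x))).
  congr is_derive; rewrite /GRing.scale/=.
  by rewrite mulrN -(expr2 (sin x)) sin2cos2; field.
have cG : continuous G.
  move=> x; apply: differentiable_continuous; apply/derivable1_diffP.
  by have [] := dG x.
rewrite -integral_lam1//; last 2 first.
- apply/measurable_EFinP; apply: measurable_funS (measurableT) _ _ => //.
  exact: continuous_measurable_fun.
- by move=> x _; rewrite lee_fin mulr_ge0// sqr_ge0.
rewrite (integral_FTC pi2 _ cG)//.
- by congr EFin; rewrite /G cosN cos_pihalf !mulr0 !addr0; field.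
- by move=> x _; rewrite mulr_ge0// sqr_ge0.
Qed.

Let sq_lt_sqrt (x t : R) : 0 <= t -> (x ^+ 2 < t) = (`|x| < Num.sqrt t).
Proof.
move=> t0; rewrite -{1}(sqr_sqrtr t0) -real_normK ?num_real//.
by rewrite ltr_pXn2r// nnegrE// sqrtr_ge0.
Qed.

Lemma ball1_volume (t : R) : lam1 R [set x | x ^+ 2 < t] = (2 * Num.sqrt t)%:E.
Proof.
have [t0|t0] := leP 0 t; last first.
  rewrite (ltr0_sqrtr t0) mulr0 (_ : [set _ | _] = set0) ?measure0//.
  apply/seteqP; split=> // x /= xt.
  by have := lt_trans xt t0; rewrite ltNge sqr_ge0.
have -> : [set x | x ^+ 2 < t] = `](- Num.sqrt t), (Num.sqrt t)[%classic.
  by apply/seteqP; split=> x /=; rewrite sq_lt_sqrt// in_itv/= ltr_norml.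
rewrite lebesgue1_itv/= lte_fin; have := sqrtr_ge0 t.
rewrite le_eqVlt => /predU1P[<-|s0]; first by rewrite oppr0 ltxx mulr0.
by rewrite gt0_cp// -EFinB; congr EFin; ring.
Qed.

Let measurable_sumsq d (X : measurableType d) (f g : X -> R) (t : R) :
  measurable_fun setT f -> measurable_fun setT g ->
  measurable [set z | f z + g z < t].
Proof.
move=> mf mg; have -> : [set z | f z + g z < t] =
    (fun z => f z + g z) @^-1` `]-oo, t[%classic.
  by apply/seteqP; split=> z /=; rewrite in_itv.
by apply: measurable_preimageT; [exact: measurable_funD|exact: measurable_itv].
Qed.

Let integral_itv_support (a : R) (f : R -> R) :
  0 <= a -> (forall x, a < `|x| -> f x = 0) ->
  (\int[lam1 R]_x (f x)%:E = \int[lam1 R]_(x in `[(- a)%R, a]) (f x)%:E)%E.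
Proof.
move=> a0 f0; rewrite [RHS]integral_mkcond; apply: eq_integral => x _.
rewrite patchE; case: ifPn => //; rewrite notin_setE/= in_itv/= => /negP.
by rewrite -ler_norml -ltNge => /f0 ->.
Qed.

Let sqrt_outside (t x : R) : 0 <= t -> Num.sqrt t < `|x| -> t - x ^+ 2 <= 0.
Proof. by move=> t0 /ltW; rewrite subr_le0 (leNgt t) sq_lt_sqrt// -leNgt. Qed.

Definition sqnorm2 (z : R * R) : R := z.1 ^+ 2 + z.2 ^+ 2.
Definition sqnorm3 (z : R * (R * R)) : R := z.1 ^+ 2 + sqnorm2 z.2.
Definition sqnorm4 (z : (R * R) * (R * R)) : R := sqnorm2 z.1 + sqnorm2 z.2.

Lemma measurable_sqnorm2 : measurable_fun setT sqnorm2.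
Proof. by apply: measurable_funD; exact: measurable_funX. Qed.

Lemma measurable_sqnorm3 : measurable_fun setT sqnorm3.
Proof.
apply: measurable_funD; first exact: measurable_funX.
exact: (measurableT_comp measurable_sqnorm2).
Qed.

Lemma measurable_sqnorm4 : measurable_fun setT sqnorm4.
Proof. by apply: measurable_funD; exact: (measurableT_comp measurable_sqnorm2). Qed.

Lemma ball2_volume (t : R) : 0 <= t ->
  lam2 R [set z | sqnorm2 z < t] = (pi * t)%:E.
Proof.
move=> t0; rewrite [LHS]prodmE.
transitivity (\int[lam1 R]_x (2 * Num.sqrt (t - x ^+ 2))%:E)%E.
  apply: eq_integral => x _; rewrite -ball1_volume; congr (lam1 R _).
  by apply/seteqP; split=> y; rewrite /xsection/= in_setE/sqnorm2/= ltrBrDl.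
rewrite (@integral_itv_support (Num.sqrt t)) ?sqrtr_ge0//; last first.
  by move=> x /(sqrt_outside t0) tx; rewrite ler0_sqrtr// mulr0.
have -> : (pi * t)%:E = (2%:E * (pi / 2 * (Num.sqrt t) ^+ 2)%:E)%E.
  by rewrite sqr_sqrtr// -EFinM; congr EFin; field.
rewrite -half_disc_area ?sqrtr_ge0// sqr_sqrtr// integral_scale_lam1//.
apply: measurable_funS (measurableT) _ _ => //.
apply: continuous_measurable_fun.
have c1 : continuous (fun y : R => t - y ^+ 2).
  by move=> x; apply: cvgB; [exact: cvg_cst|exact: exprn_continuous].
by move=> x; exact: (continuous_comp (c1 x) (@sqrt_continuous R _)).
Qed.

Let disc_section (t u : R) :
  lam2 R [set z | u + sqnorm2 z < t] = (pi * Num.max 0 (t - u))%:E.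
Proof.
have [ut|ut] := leP 0 (t - u).
  by rewrite -ball2_volume//; congr (lam2 R _); apply/seteqP; split=> z /=;
     rewrite ltrBrDl.
rewrite mulr0 (_ : [set _ | _] = set0) ?measure0//.
apply/seteqP; split=> // z /= zt.
have : 0 <= sqnorm2 z by rewrite addr_ge0 ?sqr_ge0.
by lra.
Qed.

Lemma ball3_volume (t : R) : 0 <= t ->
  prodm (lam1 R) (lam2 R) [set z | sqnorm3 z < t] =
  (4 / 3 * pi * (t * Num.sqrt t))%:E.
Proof.
move=> t0; rewrite [LHS]prodmE.
transitivity (\int[lam1 R]_x (pi * Num.max 0 (t - x ^+ 2))%:E)%E.
  apply: eq_integral => x _; rewrite -disc_section; congr (lam2 R _).
  by apply/seteqP; split=> y; rewrite /xsection/= in_setE.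
rewrite (@integral_itv_support (Num.sqrt t)) ?sqrtr_ge0//; last first.
  by move=> x /(sqrt_outside t0) tx; rewrite max_l// mulr0.
set s := Num.sqrt t; have s0 : 0 <= s := sqrtr_ge0 t.
have tE : t = s ^+ 2 by rewrite sqr_sqrtr.
have inside (x : R) : - s <= x <= s -> 0 <= t - x ^+ 2.
  by move=> /andP[xs sx]; rewrite tE subr_sqr mulr_ge0//; lra.
transitivity (\int[lam1 R]_(x in `[(- s)%R, s]) (pi * (t - x ^+ 2))%:E)%E.
  apply: eq_integral => x; rewrite inE/= in_itv/= => /inside ?.
  by rewrite max_r.
pose F (x : R) : R := pi * (t * x - x ^+ 3 / 3).
have dF (x : R) : is_derive x 1 F (pi * (t - x ^+ 2)).
  have := is_deriveZ pi (is_deriveB (is_deriveZ t (is_derive_id x 1))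
    (is_deriveZ 3^-1 (is_deriveX 3 (is_derive_id x 1)))).
  have -> : pi \*: (t \*: id - 3^-1 \*: id ^+ 3) = F :> (R -> R).
    by apply/funext=> y; rewrite /F/= !fctE/= /GRing.scale/= (mulrC (y ^+ 3)).
  by congr is_derive; rewrite /GRing.scale/=; field.
have cF : continuous F.
  move=> x; apply: differentiable_continuous; apply/derivable1_diffP.
  by have [] := dF x.
rewrite (integral_FTC _ _ cF)//.
- by congr EFin; rewrite /F tE; field.
- by lra.
- move=> x; apply: cvgM; first exact: cvg_cst.
  by apply: cvgB; [exact: cvg_cst|exact: exprn_continuous].
- by move=> x /inside ?; rewrite mulr_ge0// pi_ge0.
Qed.

Lemma ball4_volume (t : R) : 0 <= t ->
  prodm (lam2 R) (lam2 R) [set z | sqnorm4 z < t] = (pi ^+ 2 / 2 * t ^+ 2)%:E.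
Proof.
move=> t0; rewrite [LHS]prodmE.
(* The area of a disc is pi times the length of the interval of squared radii. *)
pose C := [set z : (R * R) * R | sqnorm2 z.1 < z.2 /\ z.2 <= t].
have mC : measurable C.
  have -> : C = [set z | sqnorm2 z.1 + - z.2 < 0] `&`
      (snd @^-1` `]-oo, t]%classic).
    by apply/seteqP; split=> -[z s]; rewrite /C/= subr_lt0 in_itv.
  apply: measurableI; last exact: measurable_preimageT.
  apply: measurable_sumsq; first exact: (measurableT_comp measurable_sqnorm2).
  exact: measurable_funN.
transitivity (pi%:E * prodm (lam2 R) (lam1 R) C)%E.
  rewrite prodmE -ge0_integralZl//; last 2 first.
  - exact: measurable_fun_xsection.
  - by rewrite lee_fin pi_ge0.
  apply: eq_integral => x _.
  rewrite (_ : xsection _ x = [set z | sqnorm2 x + sqnorm2 z < t]); last first.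
    by apply/seteqP; split=> y; rewrite /xsection/= in_setE.
  rewrite disc_section EFinM; congr (_ * _)%E.
  rewrite (_ : xsection C x = `]sqnorm2 x, t]%classic); last first.
    apply/seteqP; split=> y; rewrite /xsection/C/= in_setE/= in_itv/=.
      by move=> [-> ->].
    by move=> /andP.
  rewrite lebesgue1_itv/= lte_fin -subr_gt0.
  by have [?|?] := ltP 0 (t - sqnorm2 x).
rewrite prodm_ysection//.
transitivity (pi%:E * \int[lam1 R]_(s in `[0%R, t]) (pi * s)%:E)%E.
  congr (_ * _)%E; rewrite [RHS]integral_mkcond; apply: eq_integral => y _.
  rewrite patchE; case: ifPn.
    rewrite inE/= in_itv/= => /andP[y0 yt]; rewrite -ball2_volume//.
    congr (lam2 R _); apply/seteqP; split=> z; rewrite /ysection/C/= in_setE/=.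
      by move=> [].
    by [].
  rewrite notin_setE/= in_itv/= => /negP y_out.
  rewrite (_ : ysection _ _ = set0) ?measure0//.
  apply/seteqP; split=> // z; rewrite /ysection/C/= in_setE/= => -[zy yt].
  case: y_out; rewrite yt andbT ltW// (le_lt_trans _ zy)//.
  by rewrite addr_ge0 ?sqr_ge0.
pose F (x : R) : R := pi / 2 * x ^+ 2.
have dF (x : R) : is_derive x 1 F (pi * x).
  have := is_deriveZ (pi / 2) (is_deriveX 2 (is_derive_id x 1)).
  have -> : (pi / 2) \*: id ^+ 2 = F :> (R -> R).
    by apply/funext=> y; rewrite /F/= !fctE.
  by congr is_derive; rewrite /GRing.scale/=; field.
have cF : continuous F.
  move=> x; apply: differentiable_continuous; apply/derivable1_diffP.
  by have [] := dF x.
rewrite (integral_FTC _ _ cF)//.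
- by rewrite -EFinM; congr EFin; rewrite /F; field.
- by move=> x; apply: cvgM; [exact: cvg_cst|exact: cvg_id].
- by move=> x /andP[x0 _]; rewrite mulr_ge0// pi_ge0.
Qed.

End RadialDensities.


(** * Distribution of the squared norm *)

Section Densities.
Variable R : realType.

(** The image of n under r has density w on the positive half-line, stated
    through the bounds it implies on intervals. *)
Definition has_density d (V : measurableType d) (n : set V -> \bar R)
    (r : V -> R) (w : R -> R) : Prop :=
  forall u v A B : R, 0 < u -> u <= v -> 0 <= A ->
    (forall t, u <= t <= v -> A <= w t <= B) ->
    ((A * (v - u))%:E <= n [set x | (u <= r x < v)%R] <= (B * (v - u))%:E)%E.

Lemma measurable_between d (V : measurableType d) (f g h : V -> R) :
  measurable_fun setT f -> measurable_fun setT g -> measurable_fun setT h ->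
  measurable [set x | f x < g x < h x].
Proof.
move=> mf mg mh.
have -> : [set x | f x < g x < h x] =
    [set x | (f x < g x)%R] `&` [set x | (g x < h x)%R].
  by apply/seteqP; split=> x /= => [/andP|[-> ->]].
by apply: measurableI; rewrite -[X in measurable X]setTI;
   [apply: (measurable_fun_ltr mf mg)|apply: (measurable_fun_ltr mg mh)].
Qed.

Lemma has_density_open d (V : measurableType d)
    (n : {measure set V -> \bar R}) (r : V -> R) (w : R -> R) (u v A B : R) :
  measurable_fun setT r -> has_density n r w ->
  0 < u -> u < v -> 0 <= A ->
  (forall t, u <= t <= v -> A <= w t <= B) ->
  ((A * (v - u))%:E <= n [set x | (u < r x < v)%R] <= (B * (v - u))%:E)%E.
Proof.
move=> mr nd u0 uv A0 wAB.
have mS : measurable [set x | u < r x < v] by exact: measurable_between.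
have mS' (u' : R) : measurable [set x | u' <= r x < v].
  have -> : [set x | u' <= r x < v] = r @^-1` `[u', v[%classic.
    by apply/seteqP; split=> x /=; rewrite in_itv.
  by apply: measurable_preimageT => //; exact: measurable_itv.
have [_ up] := andP (nd _ _ _ _ u0 (ltW uv) A0 wAB).
apply/andP; split; last first.
  apply: le_trans up; apply: le_measure; rewrite ?inE//.
  by move=> x /= /andP[/ltW -> ->].
apply/lee_addgt0Pr => d0 d0_gt0.
pose u' := Num.min ((u + v) / 2) (u + d0 / (A + 1)).
have A1 : 0 < A + 1 by rewrite ltr_wpDl.
have uu' : u < u' by rewrite lt_min; apply/andP; split; [lra|rewrite ltrDl divr_gt0].
have u'v : u' < v by rewrite gt_min; apply/orP; left; lra.
have u'd : A * (u' - u) <= d0.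
  have : u' - u <= d0 / (A + 1) by rewrite lerBlDl ge_min lexx orbT.
  rewrite ler_pdivlMr// => h; apply: le_trans h.
  by rewrite mulrC ler_wpM2l ?subr_ge0 ?(ltW uu')// lerDl.
have w' t : u' <= t <= v -> A <= w t <= B.
  by move=> /andP[u't tv]; apply: wAB; rewrite tv (le_trans (ltW uu') u't).
have [low _] := andP (nd _ _ _ _ (lt_trans u0 uu') (ltW u'v) A0 w').
apply: (@le_trans _ _ ((A * (v - u'))%:E + d0%:E)%E).
  by rewrite -EFinD lee_fin; move: u'd; rewrite !mulrBr; lra.
rewrite leeD2r// (le_trans low)//; apply: le_measure; rewrite ?inE//.
by move=> x /= /andP[/(lt_le_trans uu') -> ->].
Qed.

Lemma has_density_cdf d (V : measurableType d)
    (n : {measure set V -> \bar R}) (r : V -> R) (w phi : R -> R) :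
  measurable_fun setT r ->
  (forall t, 0 <= t -> n [set x | r x < t] = (phi t)%:E) ->
  (forall u v A B : R, 0 < u -> u <= v ->
     A <= w u <= B -> A <= w v <= B ->
     A * (v - u) <= phi v - phi u <= B * (v - u)) ->
  has_density n r w.
Proof.
move=> mr nE phiE u v A B u0 uv A0 wAB.
have mlt (t : R) : measurable [set x | r x < t].
  have -> : [set x | r x < t] = r @^-1` `]-oo, t[%classic.
    by apply/seteqP; split=> x /=; rewrite in_itv.
  by apply: measurable_preimageT => //; exact: measurable_itv.
have -> : [set x | u <= r x < v] = [set x | r x < v] `\` [set x | r x < u].
  apply/seteqP; split=> x /=; rewrite leNgt; first by move=> /andP[/negP].
  by move=> [-> /negP ->].
have v0 := lt_le_trans u0 uv.
have nv_fin : (n [set x | (r x < v)%R] < +oo)%E by rewrite nE ?ltry// ltW.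
rewrite measureD//.
rewrite (_ : [set x | r x < v] `&` _ = [set x | r x < u]); last first.
  by apply/seteqP; split=> x /= => [[]|xu] //; split=> //; exact: lt_le_trans uv.
rewrite [X in (_ <= X - _ <= _)%E]nE ?(ltW v0)//.
rewrite [X in (_ <= _ - X <= _)%E]nE ?(ltW u0)//.
rewrite -EFinB !lee_fin; apply: phiE => //; apply: wAB; rewrite ?lexx ?uv//.
Qed.

Lemma density2 : has_density (lam2 R) (@sqnorm2 R) (fun=> pi).
Proof.
apply: (has_density_cdf (phi := fun t => pi * t)).
- exact: measurable_sqnorm2.
- exact: ball2_volume.
- move=> u v A B u0 uv /andP[A1 B1] _; rewrite -mulrBr.
  by rewrite !ler_wpM2r ?subr_ge0.
Qed.

Lemma density4 :
  has_density (prodm (lam2 R) (lam2 R)) (@sqnorm4 R) (fun t => pi ^+ 2 * t).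
Proof.
apply: (has_density_cdf (phi := fun t => pi ^+ 2 / 2 * t ^+ 2)).
- exact: measurable_sqnorm4.
- exact: ball4_volume.
- move=> u v A B u0 uv /andP[Au uB] /andP[Av vB].
  have -> : pi ^+ 2 / 2 * v ^+ 2 - pi ^+ 2 / 2 * u ^+ 2 =
      (pi ^+ 2 * u + pi ^+ 2 * v) / 2 * (v - u) :> R by field.
  by apply/andP; split; apply: ler_wpM2r; rewrite ?subr_ge0//; lra.
Qed.

Lemma density3 : has_density (prodm (lam1 R) (lam2 R)) (@sqnorm3 R)
  (fun t => 2 * pi * Num.sqrt t).
Proof.
apply: (has_density_cdf (phi := fun t => 4 / 3 * pi * (t * Num.sqrt t))).
- exact: measurable_sqnorm3.
- exact: ball3_volume.
- move=> u v A B u0 uv /andP[Au _] /andP[_ vB].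
  have v0 := lt_le_trans u0 uv.
  set a := Num.sqrt u in Au *; set b := Num.sqrt v in vB *.
  have a0 : 0 <= a := sqrtr_ge0 u.
  have ab : a <= b by rewrite ler_sqrt// ltW.
  have uE : u = a ^+ 2 by rewrite sqr_sqrtr// ltW.
  have vE : v = b ^+ 2 by rewrite sqr_sqrtr// ltW.
  rewrite uE vE; have p0 := pi_ge0 R.
  apply/andP; split.
    apply: (@le_trans _ _ (2 * pi * a * (b ^+ 2 - a ^+ 2))).
      by apply: ler_wpM2r; rewrite // subr_ge0 -uE -vE.
    rewrite -subr_ge0 (_ : _ - _ = 2 / 3 * pi * ((b - a) ^+ 2 * (2 * b + a))).
      by rewrite !mulr_ge0// ?sqr_ge0//; lra.
    by field.
  apply: (@le_trans _ _ (2 * pi * b * (b ^+ 2 - a ^+ 2))); last first.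
    by apply: ler_wpM2r; rewrite // subr_ge0 -uE -vE.
  rewrite -subr_ge0 (_ : _ - _ = 2 / 3 * pi * ((b - a) ^+ 2 * (b + 2 * a))).
    by rewrite !mulr_ge0// ?sqr_ge0//; lra.
  by field.
Qed.

(* The squared distance to the origin on the positive half-line. *)
Definition half_sq (x : R) : R := if 0 < x then x ^+ 2 else -1.

Lemma measurable_half_sq : measurable_fun setT half_sq.
Proof.
by apply: measurable_fun_ifT => //; exact: measurable_fun_ltr.
Qed.

Lemma density1 : has_density (lam1 R) half_sq (fun t => (2 * Num.sqrt t)^-1).
Proof.
move=> u v A B u0 uv A0 wAB.
have v0 := lt_le_trans u0 uv.
have /andP[_ Bu] := wAB u (introT andP (conj (lexx u) uv)).
have /andP[Av _] := wAB v (introT andP (conj uv (lexx v))).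
set a := Num.sqrt u in Bu *; set b := Num.sqrt v in Av *.
have a0 : 0 < a by rewrite sqrtr_gt0.
have ab : a <= b by rewrite ler_sqrt// ltW.
have uE : u = a ^+ 2 by rewrite sqr_sqrtr// ltW.
have vE : v = b ^+ 2 by rewrite sqr_sqrtr// ltW.
have b0 := lt_le_trans a0 ab.
have -> : [set x | u <= half_sq x < v] = `[a, b[%classic.
  apply/seteqP; split=> x; rewrite /= in_itv/= /half_sq; case: ifPn => x0.
  - by rewrite uE vE ler_pXn2r ?ltr_pXn2r ?nnegrE// ltW.
  - by move=> /andP[]; rewrite leNgt (lt_trans _ u0)// oppr_lt0 ltr01.
  - by rewrite uE vE ler_pXn2r ?ltr_pXn2r ?nnegrE// ltW.
  - by move=> /andP[/(lt_le_trans a0)]; rewrite (negbTE x0).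
rewrite lebesgue1_itv/= lte_fin.
have -> : (if (a < b)%R then b%:E - a%:E else 0)%E = (b - a)%:E.
  by case: ifPn => //; rewrite -leNgt => ba; rewrite (@le_anti _ _ a b) ?ab// subrr.
have ba0 : 0 <= b ^+ 2 - a ^+ 2 by rewrite -uE -vE subr_ge0.
rewrite !lee_fin uE vE; apply/andP; split.
  apply: (@le_trans _ _ ((2 * b)^-1 * (b ^+ 2 - a ^+ 2))).
    exact: ler_wpM2r.
  rewrite ler_pdivrMl ?mulr_gt0// subr_sqr mulrC ler_wpM2r ?subr_ge0//; lra.
apply: (@le_trans _ _ ((2 * a)^-1 * (b ^+ 2 - a ^+ 2))); last exact: ler_wpM2r.
rewrite ler_pdivlMl ?mulr_gt0// subr_sqr [leRHS]mulrC.
by rewrite ler_wpM2r ?subr_ge0//; lra.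
Qed.

End Densities.

(** * Bounds for sets defined by a window of values *)

Section Slabs.
Variable R : realType.

(** If the coordinate v enters only through r v, which has density w, then
    integrating it out replaces it by one real coordinate s = Q x + r v. *)
Lemma slab_bounds d1 d2 (X : measurableType d1) (V : measurableType d2)
    (m : {sigma_finite_measure set X -> \bar R})
    (n : {sigma_finite_measure set V -> \bar R})
    (r : V -> R) (w : R -> R) (lo hi Q : X -> R) (A B : R) :
  has_density n r w -> measurable_fun setT r ->
  measurable_fun setT lo -> measurable_fun setT hi -> measurable_fun setT Q ->
  0 <= A -> 0 <= B ->
  (forall x s, lo x < hi x -> lo x <= s <= hi x ->
     0 < s - Q x /\ A <= w (s - Q x) <= B) ->
  (A%:E * prodm m (lam1 R) [set z | (lo z.1 < z.2 < hi z.1)%R] <=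
   prodm m n [set z | (lo z.1 < Q z.1 + r z.2 < hi z.1)%R] <=
   B%:E * prodm m (lam1 R) [set z | (lo z.1 < z.2 < hi z.1)%R])%E.
Proof.
move=> nw mr mlo mhi mQ A0 B0 wAB.
set C := [set z : X * R | _]; set D := [set z : X * V | _].
have mC : measurable C.
  by apply: measurable_between => //; exact: measurableT_comp.
have mD : measurable D.
  apply: measurable_between; [exact: measurableT_comp| |exact: measurableT_comp].
  by apply: measurable_funD; exact: measurableT_comp.
have mxC := measurable_fun_xsection (lam1 R) mC.
have mxD := measurable_fun_xsection n mD.
have CE x : lam1 R (xsection C x) = (Num.max 0 (hi x - lo x))%:E.
  rewrite (_ : xsection C x = `]lo x, hi x[%classic); last first.
    by apply/seteqP; split=> s; rewrite /xsection/C/= in_setE/= in_itv.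
  rewrite lebesgue1_itv/= lte_fin -(subr_gt0 (lo x)).
  by case: ltP.
have fib x : (A%:E * lam1 R (xsection C x) <= n (xsection D x) <=
    B%:E * lam1 R (xsection C x))%E.
  rewrite CE -!EFinM; have [hl|lh] := leP (hi x) (lo x).
    rewrite max_l ?subr_le0// !mulr0 (_ : xsection D x = set0).
      by rewrite measure0 lexx.
    apply/seteqP; split=> v //; rewrite /xsection/D/= in_setE/= => /andP[h1 h2].
    by have := lt_le_trans (lt_trans h1 h2) hl; rewrite ltxx.
  rewrite max_r ?subr_ge0 ?(ltW lh)//.
  rewrite (_ : xsection D x = [set v | lo x - Q x < r v < hi x - Q x]).
    have -> : hi x - lo x = (hi x - Q x) - (lo x - Q x) by ring.
    apply: (has_density_open mr nw) => //.
    - by have [] := wAB x (lo x) lh; rewrite ?lexx ?(ltW lh).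
    - by rewrite ltrD2r.
    - move=> t /andP[t1 t2]; have [] := wAB x (t + Q x) lh.
        by rewrite -lerBlDr t1 -lerBrDr t2.
      by rewrite addrK.
  apply/seteqP; split=> v; rewrite /xsection/D/= in_setE/=;
    by rewrite ltrBlDl ltrBrDl.
rewrite !(prodmE m) -!ge0_integralZl//; try by rewrite lee_fin.
apply/andP; split; apply: ge0_le_integral => //.
- by move=> x _; rewrite mule_ge0// lee_fin.
- by apply: emeasurable_funM => //; exact: measurable_cst.
- by move=> x _; have /andP[] := fib x.
- by apply: emeasurable_funM => //; exact: measurable_cst.
- by move=> x _; have /andP[] := fib x.
Qed.

(** A set of pairs (x, s) with s in an interval depending on x, of volume v. *)
Definition band d (X : measurableType d)
    (m : {sigma_finite_measure set X -> \bar R}) (lo hi : X -> R) (v : R) :=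
  [/\ measurable_fun setT lo, measurable_fun setT hi &
      prodm m (lam1 R) [set z | (lo z.1 < z.2 < hi z.1)%R] = v%:E].

Let itv_volume (c e : R) : 0 < e ->
  lam1 R `](c - e) / 2, (c + e) / 2[%classic = e%:E.
Proof.
move=> e0; rewrite lebesgue1_itv/= lte_fin ifT; last by lra.
by rewrite -EFinB; congr EFin; field.
Qed.

Let mclip (g e : R) : measurable_fun setT (fun y : R => g - 2 * y + e).
Proof.
by apply: measurable_funD => //; apply: measurable_funB => //; exact: measurable_funM.
Qed.

Lemma band1 (L g e : R) : 0 < e ->
  band (lam1 R) (fun y => Num.max (L - e) (g - 2 * y - e))
    (fun y => Num.min (L + e) (g - 2 * y + e)) (2 * e * e).
Proof.
move=> e0; have mlo : measurable_fun setT (fun y : R => Num.max (L - e) (g - 2 * y - e)).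
  by apply: measurable_maxr => //; exact: mclip.
have mhi : measurable_fun setT (fun y : R => Num.min (L + e) (g - 2 * y + e)).
  by apply: measurable_minr => //; exact: mclip.
split=> //; set C := [set z : R * R | _].
have mC : measurable C.
  by apply: measurable_between => //;
     [exact: (measurableT_comp mlo)|exact: (measurableT_comp mhi)].
have [_ _ /(_ _ mC)] := scales_swap (lam1 R) (lam1 R); rewrite mul1e => <-.
apply/le_anti; rewrite andbC.
have -> : (2 * e * e)%:E = (e%:E * lam1 R `](L - e)%R, (L + e)%R[%classic)%E.
  rewrite lebesgue1_itv/= lte_fin ifT; last by lra.
  by rewrite -EFinB -EFinM; congr EFin; ring.
have mC' : measurable ((fun z : R * R => (z.2, z.1)) @^-1` C).
  by apply: measurable_preimageT mC; exact: measurable_fun_pair.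
apply: prodm_fiber_bounds => //; [exact: ltW|exact: ltW| |].
- move=> s sL; apply/seteqP; split=> // y; rewrite /xsection/C/= in_setE/=.
  rewrite gt_max lt_min => /andP[/andP[s1 _] /andP[s2 _]].
  by apply: sL; rewrite /= in_itv/= s1.
- move=> s /=; rewrite in_itv/= => /andP[s1 s2].
  rewrite (_ : xsection _ s = `](g - s - e) / 2, (g - s + e) / 2[%classic).
    by rewrite itv_volume// lexx.
  apply/seteqP; split=> y; rewrite /xsection/C/= in_setE/= gt_max lt_min s1 s2/=.
    by rewrite in_itv/= => /andP[y1 y2]; apply/andP; split; lra.
  by rewrite in_itv/= => /andP[y1 y2]; apply/andP; split; lra.
Qed.

Lemma band_extend d (X : measurableType d)
    (m : {sigma_finite_measure set X -> \bar R}) (lo hi : X -> R) (v g e : R) :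
  0 < e -> band m lo hi v ->
  band (prodm m (lam1 R)) (fun z => Num.max (lo z.1) (g - 2 * z.2 - e))
    (fun z => Num.min (hi z.1) (g - 2 * z.2 + e)) (v * e).
Proof.
move=> e0 [mlo mhi vE].
have mlo' : measurable_fun setT
    (fun z : X * R => Num.max (lo z.1) (g - 2 * z.2 - e)).
  apply: measurable_maxr; first exact: measurableT_comp.
  exact: (measurableT_comp (mclip g (- e))).
have mhi' : measurable_fun setT
    (fun z : X * R => Num.min (hi z.1) (g - 2 * z.2 + e)).
  apply: measurable_minr; first exact: measurableT_comp.
  exact: (measurableT_comp (mclip g e)).
split=> //; set C := [set z : X * R * R | _].
have mC : measurable C.
  by apply: measurable_between => //;
     [exact: (measurableT_comp mlo')|exact: (measurableT_comp mhi')].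
have [_ msw /(_ _ mC)] := scales_swap_last m (lam1 R) (lam1 R).
rewrite mul1e => <-.
have mC' := measurable_preimageT msw mC.
pose C0 := [set z : X * R | lo z.1 < z.2 < hi z.1].
have mC0 : measurable C0.
  by apply: measurable_between => //;
     [exact: (measurableT_comp mlo)|exact: (measurableT_comp mhi)].
apply/le_anti; rewrite andbC.
have -> : (v * e)%:E = (e%:E * prodm m (lam1 R) C0)%E by rewrite vE -EFinM mulrC.
apply: prodm_fiber_bounds => //; [exact: ltW|exact: ltW| |].
- move=> [x s] sL; apply/seteqP; split=> // y; rewrite /xsection/C/= in_setE/=.
  rewrite gt_max lt_min => /andP[/andP[s1 _] /andP[s2 _]].
  by apply: sL; rewrite /C0/= s1.
- move=> [x s]; rewrite /C0/= => /andP[s1 s2].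
  rewrite (_ : xsection _ _ = `](g - s - e) / 2, (g - s + e) / 2[%classic).
    by rewrite itv_volume// lexx.
  apply/seteqP; split=> y; rewrite /xsection/C/= in_setE/= gt_max lt_min s1 s2/=.
    by rewrite in_itv/= => /andP[y1 y2]; apply/andP; split; lra.
  by rewrite in_itv/= => /andP[y1 y2]; apply/andP; split; lra.
Qed.

End Slabs.

(** * Volumes of slices in adapted coordinates *)

Section CoordinateSlices.
Variable R : realType.

Definition quad (M : 'M[R]_4) (z : space4 R) : R :=
  ((vec4 z)^T *m M *m vec4 z) ord0 ord0.

Lemma measurable_vec4 i : measurable_fun setT (fun z : space4 R => vec4 z i ord0).
Proof.
rewrite (_ : (fun z => _) = fun z : space4 R => [:: z.1.1.1; z.1.1.2; z.1.2; z.2]`_i).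
  move: i; apply: ord4P => //=; do 2?apply: measurableT_comp => //;
    exact: measurableT_comp.
by apply/funext => z; rewrite mxE.
Qed.

Lemma measurable_quad M : measurable_fun setT (quad M).
Proof.
rewrite (_ : quad M = fun z =>
    \sum_(j < 4) (\sum_(i < 4) vec4 z i ord0 * M i j) * vec4 z j ord0).
  apply: measurable_sum => j; apply: measurable_funM; last exact: measurable_vec4.
  apply: measurable_sum => i; apply: measurable_funM => //.
  exact: measurable_vec4.
apply/funext => z; rewrite /quad mxE; apply: eq_bigr => j _.
by rewrite !mxE; congr (_ * _); apply: eq_bigr => i _; rewrite !mxE.
Qed.

Lemma window_itv (s g y e : R) :
  (`|2 * y + s - g| < e) = (g - 2 * y - e < s < g - 2 * y + e).
Proof.
rewrite (_ : 2 * y + s - g = s - (g - 2 * y)); last by ring.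
by rewrite ltr_distl.
Qed.

Lemma window_itv_le (s g y e : R) :
  (`|2 * y + s - g| <= e) = (g - 2 * y - e <= s <= g - 2 * y + e).
Proof.
rewrite (_ : 2 * y + s - g = s - (g - 2 * y)); last by ring.
by rewrite ler_distl.
Qed.

Variables (M : 'M[R]_4) (L e A B : R) (g : 'I_4 -> R).
Hypotheses (e0 : 0 < e) (A0 : 0 <= A) (B0 : 0 <= B).

(** The k-th slice condition: the k first coordinates y of the new edge and its
    squared length s satisfy the length constraints up to e. *)
Definition window (k : nat) (y : space4 R) (s : R) : Prop :=
  `|s - L| < e /\
  forall i : 'I_4, (i < k)%N -> `|2 * vec4 y i ord0 + s - g i| < e.

Definition closed_window (k : nat) (y : space4 R) (s : R) : Prop :=
  `|s - L| <= e /\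
  forall i : 'I_4, (i < k)%N -> `|2 * vec4 y i ord0 + s - g i| <= e.

Definition slice3 : set (space4 R) :=
  [set z | 0 < z.2 /\ window 3 z (quad M (z.1, 0) + z.2 ^+ 2)].
Definition slice2 : set (space4 R) :=
  [set z | window 2 z (quad M (z.1.1, 0, 0) + sqnorm2 (z.1.2, z.2))].
Definition slice1 : set (space4 R) := [set z | window 1 z
  (quad M (z.1.1.1, 0, 0, 0) + sqnorm3 (z.1.1.2, (z.1.2, z.2)))].
Definition slice0 : set (space4 R) :=
  [set z | `|sqnorm2 z.1.1 + sqnorm2 (z.1.2, z.2) - L| < e].

Lemma coordinate_slice3 :
  (forall y s, y.2 = 0 -> closed_window 3 y s ->
     0 < s - quad M y /\ A <= (2 * Num.sqrt (s - quad M y))^-1 <= B) ->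
  ((A * (2 * e * e * e * e))%:E <=
   lam4 R slice3 <=
   (B * (2 * e * e * e * e))%:E)%E.
Proof.
move=> wAB.
pose lo (y : R * R * R) := Num.max (Num.max (Num.max (L - e)
  (g o0 - 2 * y.1.1 - e)) (g o1 - 2 * y.1.2 - e)) (g o2 - 2 * y.2 - e).
pose hi (y : R * R * R) := Num.min (Num.min (Num.min (L + e)
  (g o0 - 2 * y.1.1 + e)) (g o1 - 2 * y.1.2 + e)) (g o2 - 2 * y.2 + e).
have [mlo mhi vE] := band_extend (g o2) e0 (band_extend (g o1) e0
  (band1 L (g o0) e0)).
have cw y s : lo y <= s <= hi y -> closed_window 3 (y, 0) s.
  rewrite !ge_max !le_min => /andP[/andP[/andP[/andP[h1 h2] h3] h4]].
  move=> /andP[/andP[/andP[h5 h6] h7] h8].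
  split; first by rewrite ler_distl h1 h5.
  by apply: ord4P => //= _; rewrite mxE/= window_itv_le ?h2 ?h6 ?h3 ?h7 ?h4 ?h8.
have mQ : measurable_fun setT (fun y : R * R * R => quad M (y, 0)).
  apply: (measurableT_comp (measurable_quad M)).
  exact: measurable_fun_pair.
have := slab_bounds (lam3 R) (n := lam1 R) (@density1 R) (@measurable_half_sq R) mlo mhi mQ A0 B0.
rewrite vE -!EFinM => slab.
rewrite (_ : slice3 =
  [set z | (lo z.1 < quad M (z.1, 0) + half_sq z.2 < hi z.1)%R]).
  apply: slab => y s lohi /cw/wAB; exact.
apply/seteqP; split=> -[y v] /=.
  move=> [v0 [h0 h]]; rewrite /half_sq v0 !gt_max !lt_min.
  move: h0; rewrite ltr_distl => /andP[-> ->].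
  move: (h o0 isT) (h o1 isT) (h o2 isT); rewrite !mxE/= !window_itv.
  by move=> /andP[-> ->] /andP[-> ->] /andP[-> ->].
move=> /andP[l h]; have lh := lt_trans l h.
have lo0 : 0 < lo y - quad M (y, 0).
  have loI : lo y <= lo y <= hi y by rewrite lexx ltW.
  by have [] := wAB (y, 0) (lo y) erefl (cw _ _ loI).
have v0 : 0 < v.
  move: l; rewrite /half_sq; case: ifPn => // _ l.
  by move: lo0 l; lra.
split=> //; move: l h; rewrite /half_sq v0 !gt_max !lt_min.
move=> /andP[/andP[/andP[h1 h2] h3] h4] /andP[/andP[/andP[h5 h6] h7] h8].
split; first by rewrite ltr_distl h1 h5.
by apply: ord4P => //= _; rewrite mxE/= window_itv ?h2 ?h6 ?h3 ?h7 ?h4 ?h8.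
Qed.

Lemma coordinate_slice2 :
  (forall y s, y.1.2 = 0 -> y.2 = 0 -> closed_window 2 y s ->
     0 < s - quad M y /\ A <= pi <= B) ->
  ((A * (2 * e * e * e))%:E <=
   lam4 R slice2 <=
   (B * (2 * e * e * e))%:E)%E.
Proof.
move=> wAB.
pose lo (y : R * R) := Num.max (Num.max (L - e)
  (g o0 - 2 * y.1 - e)) (g o1 - 2 * y.2 - e).
pose hi (y : R * R) := Num.min (Num.min (L + e)
  (g o0 - 2 * y.1 + e)) (g o1 - 2 * y.2 + e).
have [mlo mhi vE] := band_extend (g o1) e0 (band1 L (g o0) e0).
have cw y s : lo y <= s <= hi y -> closed_window 2 (y, 0, 0) s.
  rewrite !ge_max !le_min => /andP[/andP[/andP[h1 h2] h3]].
  move=> /andP[/andP[h5 h6] h7].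
  split; first by rewrite ler_distl h1 h5.
  by apply: ord4P => //= _; rewrite mxE/= window_itv_le ?h2 ?h6 ?h3 ?h7.
have mQ : measurable_fun setT (fun y : R * R => quad M (y, 0, 0)).
  apply: (measurableT_comp (measurable_quad M)).
  by apply: measurable_fun_pair => //; exact: measurable_fun_pair.
have slab := slab_bounds (lam2 R) (n := lam2 R) (@density2 R) (@measurable_sqnorm2 R)
  mlo mhi mQ A0 B0.
have {}slab : ((A * (2 * e * e * e))%:E <= prodm (lam2 R) (lam2 R)
    [set z | (lo z.1 < quad M (z.1, 0%R, 0%R) + sqnorm2 z.2 < hi z.1)%R] <=
    (B * (2 * e * e * e))%:E)%E.
  rewrite (EFinM A) (EFinM B) -vE; apply: slab => y s lohi /cw/wAB; exact.
move: slab.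
set D := [set z : (R * R) * (R * R) | _].
have mD : measurable D.
  apply: measurable_between; [exact: (measurableT_comp mlo)| |exact: (measurableT_comp mhi)].
  apply: measurable_funD; first exact: (measurableT_comp mQ).
  exact: (measurableT_comp (@measurable_sqnorm2 R)).
have [_ _ /(_ _ mD)] := scales_assoc (lam2 R) (lam1 R) (lam1 R).
rewrite mul1e (_ : _ @^-1` D = slice2); first by move=> <-.
apply/seteqP; split=> -[[y v1] v2]; rewrite /slice1/slice2/D/= !gt_max !lt_min.
  move=> /andP[/andP[/andP[h1 h2] h3] /andP[/andP[h5 h6] h7]].
  split; first by rewrite ltr_distl h1 h5.
  by apply: ord4P => //= _; rewrite mxE/= window_itv ?h2 ?h6 ?h3 ?h7.
move=> [h0 h].
move: h0; rewrite ltr_distl => /andP[-> ->].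
move: (h o0 isT) (h o1 isT); rewrite !mxE/= !window_itv.
by move=> /andP[-> ->] /andP[-> ->].
Qed.

Lemma coordinate_slice1 :
  (forall y s, y.1.1.2 = 0 -> y.1.2 = 0 -> y.2 = 0 -> closed_window 1 y s ->
     0 < s - quad M y /\ A <= 2 * pi * Num.sqrt (s - quad M y) <= B) ->
  ((A * (2 * e * e))%:E <=
   lam4 R slice1 <=
   (B * (2 * e * e))%:E)%E.
Proof.
move=> wAB.
pose lo (y : R) := Num.max (L - e) (g o0 - 2 * y - e).
pose hi (y : R) := Num.min (L + e) (g o0 - 2 * y + e).
have [mlo mhi vE] := band1 L (g o0) e0.
have cw y s : lo y <= s <= hi y -> closed_window 1 (y, 0, 0, 0) s.
  rewrite !ge_max !le_min => /andP[/andP[h1 h2] /andP[h5 h6]].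
  split; first by rewrite ler_distl h1 h5.
  by apply: ord4P => //= _; rewrite mxE/= window_itv_le ?h2 ?h6.
have mQ : measurable_fun setT (fun y : R => quad M (y, 0, 0, 0)).
  apply: (measurableT_comp (measurable_quad M)).
  by do 2 (apply: measurable_fun_pair => //); exact: measurable_fun_pair.
have slab := slab_bounds (lam1 R) (n := prodm (lam1 R) (lam2 R)) (@density3 R) (@measurable_sqnorm3 R)
  mlo mhi mQ A0 B0.
have {}slab : ((A * (2 * e * e))%:E <=
    prodm (lam1 R) (prodm (lam1 R) (lam2 R))
    [set z | (lo z.1 < quad M (z.1, 0, 0, 0) + sqnorm3 z.2 < hi z.1)%R] <=
    (B * (2 * e * e))%:E)%E.
  rewrite (EFinM A) (EFinM B) -vE; apply: slab => y s lohi /cw/wAB; exact.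
move: slab.
set D := [set z : R * (R * (R * R)) | _].
have mD : measurable D.
  apply: measurable_between; [exact: (measurableT_comp mlo)| |exact: (measurableT_comp mhi)].
  apply: measurable_funD; first exact: (measurableT_comp mQ).
  exact: (measurableT_comp (@measurable_sqnorm3 R)).
have := scales_comp (scales_assoc (lam1 R) (lam1 R) (lam2 R))
  (scales_assoc (lam2 R) (lam1 R) (lam1 R)).
rewrite mul1r => -[_ _ /(_ _ mD)].
rewrite mul1e (_ : _ @^-1` D = slice1); first by move=> <-.
apply/seteqP; split=> -[[[y v1] v2] v3]; rewrite /slice1/slice2/D/= !gt_max !lt_min.
  move=> /andP[/andP[h1 h2] /andP[h5 h6]].
  split; first by rewrite ltr_distl h1 h5.
  by apply: ord4P => //= _; rewrite mxE/= window_itv ?h2 ?h6.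
move=> [h0 h].
move: h0; rewrite ltr_distl => /andP[-> ->].
by move: (h o0 isT); rewrite !mxE/= !window_itv => /andP[-> ->].
Qed.

Lemma coordinate_slice0 :
  (forall s, `|s - L| <= e -> 0 < s /\ A <= pi ^+ 2 * s <= B) ->
  ((A * (2 * e))%:E <=
   lam4 R slice0 <=
   (B * (2 * e))%:E)%E.
Proof.
move=> wAB.
have Le : 0 < L - e by have [] := wAB (L - e); rewrite // addrAC subrr sub0r normrN gtr0_norm.
have := has_density_open (@measurable_sqnorm4 R) (@density4 R) Le
  (_ : L - e < L + e) A0 (_ : forall t, _ -> A <= _ <= B).
have -> : L + e - (L - e) = 2 * e by ring.
set D := [set z : (R * R) * (R * R) | _].
have mD : measurable D.
  by apply: measurable_between => //; exact: measurable_sqnorm4.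
have [_ _ /(_ _ mD)] := scales_assoc (lam2 R) (lam1 R) (lam1 R).
rewrite mul1e (_ : _ @^-1` D = slice0); last first.
  by apply/seteqP; split=> -[[y v1] v2]; rewrite /slice0/D/= ltr_distl.
move=> DE h; have {h} : ((A * (2 * e))%:E <=
    prodm (lam2 R) (lam2 R) D <= (B * (2 * e))%:E)%E.
  by apply: h; [rewrite ltrD2l gt0_cp|move=> t; rewrite -ler_distl => /wAB[]].
by rewrite -DE.
Qed.

End CoordinateSlices.

(** * Frames and Gram matrices *)

Section Frames.
Variable R : realType.

Lemma dotpE n (x y : 'cV[R]_n) : dotp x y = (x^T *m y) ord0 ord0.
Proof. by rewrite mxE; apply: eq_bigr => i _; rewrite !mxE. Qed.

Lemma dotpC n (x y : 'cV[R]_n) : dotp x y = dotp y x.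
Proof. by apply: eq_bigr => i _; rewrite mulrC. Qed.

Lemma dotpDl n (x y z : 'cV[R]_n) : dotp (x + y) z = dotp x z + dotp y z.
Proof. by rewrite -big_split; apply: eq_bigr => i _; rewrite !mxE mulrDl. Qed.

Lemma dotpDr n (x y z : 'cV[R]_n) : dotp z (x + y) = dotp z x + dotp z y.
Proof. by rewrite !(dotpC z) dotpDl. Qed.

Lemma dotpZl n (c : R) (x z : 'cV[R]_n) : dotp (c *: x) z = c * dotp x z.
Proof. by rewrite mulr_sumr; apply: eq_bigr => i _; rewrite !mxE mulrA. Qed.

Lemma dotpZr n (c : R) (x z : 'cV[R]_n) : dotp z (c *: x) = c * dotp z x.
Proof. by rewrite !(dotpC z) dotpZl. Qed.

Lemma dotpNl n (x z : 'cV[R]_n) : dotp (- x) z = - dotp x z.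
Proof. by rewrite -scaleN1r dotpZl mulN1r. Qed.

Lemma dotpNr n (x z : 'cV[R]_n) : dotp z (- x) = - dotp z x.
Proof. by rewrite !(dotpC z) dotpNl. Qed.

Lemma dotpBl n (x y z : 'cV[R]_n) : dotp (x - y) z = dotp x z - dotp y z.
Proof. by rewrite dotpDl dotpNl. Qed.

Lemma dotpBr n (x y z : 'cV[R]_n) : dotp z (x - y) = dotp z x - dotp z y.
Proof. by rewrite dotpDr dotpNr. Qed.

Lemma dotp0l n (z : 'cV[R]_n) : dotp 0 z = 0.
Proof. by rewrite -(scale0r (0 : 'cV[R]_n)) dotpZl mul0r. Qed.

Lemma dotp_ge0 n (x : 'cV[R]_n) : 0 <= dotp x x.
Proof. by apply: sumr_ge0 => i _; rewrite -expr2 sqr_ge0. Qed.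

Lemma dotp_eq0 n (x : 'cV[R]_n) : (dotp x x == 0) = (x == 0).
Proof.
apply/idP/eqP => [|->]; last by rewrite dotp0l.
rewrite psumr_eq0; last by move=> i _; rewrite -expr2 sqr_ge0.
move=> /allP x0; apply/matrixP => i j; rewrite mxE (ord1 j).
by have /(_ (mem_index_enum i))/= := x0 i; rewrite mulf_eq0 orbb => /eqP.
Qed.

Lemma enorm_sqr n (x : 'cV[R]_n) : enorm x ^+ 2 = dotp x x.
Proof. by rewrite sqr_sqrtr// dotp_ge0. Qed.

Lemma orthogonal_unit n m (A : 'M[R]_(m, n)) : (m < n)%N ->
  exists u : 'cV[R]_n, A *m u = 0 /\ dotp u u = 1.
Proof.
move=> mn; have : kermx A^T != 0.
  rewrite kermx_eq0 /row_free; apply: contraTneq mn => rA.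
  by rewrite -leqNgt -rA rank_leq_col.
move=> /rowV0Pn[v /sub_kermxP vA v0].
have vv : 0 < dotp v^T v^T by rewrite lt0r dotp_eq0 trmx_eq0 v0 dotp_ge0.
exists ((enorm v^T)^-1 *: v^T); split.
  by rewrite -scalemxAr -(trmxK (A *m _)) trmx_mul trmxK vA trmx0 scaler0.
rewrite dotpZl dotpZr mulrA -expr2 exprVn enorm_sqr mulVf// gt_eqF//.
Qed.

(** The Gram matrix of the k first vectors, completed by the identity. *)
Definition gram (k : nat) (a : 'I_4 -> 'cV[R]_4) : 'M[R]_4 :=
  \matrix_(i, j) if (i < k)%N && (j < k)%N then dotp (a i) (a j) else (i == j)%:R.

Let complete_frame (n m : nat) (a : 'I_4 -> 'cV[R]_4) : (m + n = 4)%N ->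
  exists b : 'I_4 -> 'cV[R]_4, (forall i : 'I_4, (i < m)%N -> b i = a i) /\
    forall i j : 'I_4, (m <= i)%N -> dotp (b i) (b j) = (i == j)%:R.
Proof.
elim: n m a => [|n IH] m a mn4.
  by exists a; split=> // i j; rewrite -{1}(addn0 m) mn4 leqNgt ltn_ord.
have m4 : (m < 4)%N by rewrite -mn4 addnS ltnS leq_addr.
pose A : 'M[R]_(m, 4) := \matrix_(i < m) (a (widen_ord (ltnW m4) i))^T.
have [u [Au uu]] := orthogonal_unit A m4.
have au (i : 'I_4) : (i < m)%N -> dotp (a i) u = 0.
  move=> im; rewrite dotpE; have /matrixP/(_ (Ordinal im) ord0) := Au.
  rewrite !mxE => E; rewrite -[RHS]E; apply: eq_bigr => j _; rewrite !mxE.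
  by congr (a _ _ _ * _); apply: val_inj.
have [b [ba bo]] := IH m.+1 (fun i => if i == m :> nat then u else a i)
  (etrans (addSnnS m n) mn4).
have bm (i : 'I_4) : i = m :> nat -> b i = u by move=> im; rewrite ba im ?eqxx.
have blt (i : 'I_4) : (i < m)%N -> b i = a i.
  by move=> im; rewrite ba ?(ltn_eqF im)// ltnS ltnW.
exists b; split=> // i j; rewrite leq_eqVlt => /predU1P[mi|mi]; last exact: bo.
have [jm|jm|jm] := ltngtP j m.
- rewrite (bm i)// (blt j)// dotpC au//.
  by case: eqP => // ij; move: jm; rewrite mi ij ltnn.
- rewrite dotpC bo// eq_sym//.
- by rewrite (bm i)// (bm j)// uu; case: eqP => // /eqP; rewrite -val_eqE/= -mi jm eqxx.
Qed.

Lemma frame_exists (k : nat) (a : 'I_4 -> 'cV[R]_4) : (k <= 4)%N ->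
  exists B : 'M[R]_4, (forall i : 'I_4, (i < k)%N -> row i B = (a i)^T) /\
    B *m B^T = gram k a.
Proof.
move=> k4; have [b [ba bo]] := @complete_frame (4 - k) k a (subnKC k4).
exists (\matrix_i (b i)^T); split=> [i ik|]; first by rewrite rowK ba.
apply/matrixP => i j; rewrite !mxE.
transitivity (dotp (b i) (b j)).
  by apply: eq_bigr => l _; rewrite !mxE.
have [ik|ki] := ltnP i k; last by rewrite bo.
by have [jk|kj] := ltnP j k; [rewrite !ba|rewrite dotpC bo// eq_sym].
Qed.

Lemma det_gram_frame k a (B : 'M[R]_4) : B *m B^T = gram k a ->
  \det (gram k a) = \det B ^+ 2.
Proof. by move=> <-; rewrite det_mulmx det_tr expr2. Qed.

Definition trunc (k : nat) (z : space4 R) : space4 R :=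
  unvec4 (\col_i if (i < k)%N then vec4 z i ord0 else 0).

(** Pythagoras: the component of w in the span of the frame is measured by the
    inverse Gram matrix, the orthogonal one by the remaining coordinates. *)
Lemma frame_pythagoras k a (B : 'M[R]_4) (w : space4 R) :
  B *m B^T = gram k a -> \det (gram k a) != 0 ->
  dotp (vec4 w) (vec4 w) = quad (invmx (gram k a)) (trunc k (lin4 B w)) +
    \sum_(i < 4) if (i < k)%N then 0 else vec4 (lin4 B w) i ord0 ^+ 2.
Proof.
move=> BE G0; set G := gram k a in BE G0 *; set M := invmx G.
have GU : G \in unitmx by rewrite unitmxE unitfE.
have BU : B \in unitmx.
  by rewrite unitmxE unitfE; move: G0; rewrite (det_gram_frame BE) expf_eq0.
have BMB : B^T *m M *m B = 1%:M.
  by apply: mulmx1C; rewrite mulmxA BE mulmxV.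
set z := lin4 B w; pose y := vec4 (trunc k z); pose v := vec4 z - y.
have yE i : y i ord0 = if (i < k)%N then vec4 z i ord0 else 0.
  by rewrite /y unvec4K mxE.
have vE i : v i ord0 = if (i < k)%N then 0 else vec4 z i ord0.
  by rewrite mxE [X in _ + X]mxE yE; case: ifP => _; rewrite ?subrr ?subr0.
have Gv : G *m v = v.
  apply/matrixP => i j; rewrite (ord1 j) mxE (bigD1 i)//= big1 ?addr0.
    by rewrite vE /G mxE eqxx; have [ik|ik] := ltnP i k; rewrite /= ?mulr0 ?mul1r.
  move=> l li; rewrite vE /G mxE [i == l]eq_sym (negbTE li).
  by have [lk|lk] := ltnP l k; rewrite ?mulr0// andbF mul0r.
have GT : G^T = G.
  apply/matrixP => i j; rewrite !mxE andbC eq_sym.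
  by case: ifP => // _; rewrite dotpC.
have MT : M^T = M by rewrite /M trmx_inv GT.
have Mv : M *m v = v by rewrite -{1}Gv mulmxA mulVmx// mul1mx.
have vM : v^T *m M = v^T by rewrite -{1}MT -trmx_mul Mv.
have yv : dotp y v = 0.
  by apply: big1 => i _; rewrite yE vE; case: ifP; rewrite ?mulr0 ?mul0r.
have zE : vec4 z = y + v by rewrite addrC subrK.
have zB : vec4 z = B *m vec4 w by rewrite /z/lin4 unvec4K.
have -> : dotp (vec4 w) (vec4 w) = ((vec4 z)^T *m M *m vec4 z) ord0 ord0.
  rewrite dotpE zB trmx_mul -!mulmxA (mulmxA M) (mulmxA B^T) (mulmxA B^T).
  by rewrite BMB mul1mx.
have -> : quad M (trunc k z) = (y^T *m M *m y) ord0 ord0 by [].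
clearbody y v.
transitivity (((y^T + v^T) *m M *m (y + v)) ord0 ord0).
  by rewrite -linearD/= -zE.
rewrite !mulmxDl !mulmxDr vM -(mulmxA y^T M v) Mv.
rewrite [LHS]mxE [X in X + _ = _]mxE [X in _ + X = _]mxE -!dotpE.
rewrite (dotpC v y) yv addr0 add0r; congr (_ + _).
by apply: eq_bigr => i _; rewrite vE; case: ifP; rewrite ?mulr0 ?expr2.
Qed.

End Frames.

(** * The volume available to one edge of a pentagon *)

Section EdgeSlices.
Variable R : realType.

Definition radial_density (k : nat) (t : R) : R :=
  match k with
  | 0 => pi ^+ 2 * t
  | 1 => 2 * pi * Num.sqrt t
  | 2 => pi
  | _ => (2 * Num.sqrt t)^-1
  end.

Definition frame_mx (a : 'I_4 -> 'cV[R]_4) (w : 'cV[R]_4) : 'M[R]_4 :=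
  \matrix_i (if i == o3 then w else a i)^T.

(** The new edge w of squared length near L, placing its endpoint at squared
    distance near l i from the origin of a i, on a prescribed side of the
    hyperplane when there are three vectors a i. *)
Definition edge_slice (k : nat) (sg : R) (a : 'I_4 -> 'cV[R]_4) (L : R)
    (l : 'I_4 -> R) (e : R) : set (space4 R) :=
  [set w | [/\ `|dotp (vec4 w) (vec4 w) - L| < e,
     forall i : 'I_4, (i < k)%N ->
       `|dotp (a i + vec4 w) (a i + vec4 w) - l i| < e &
     k = 3%N -> 0 < sg * \det (frame_mx a (vec4 w))]].

Let measurable_dist_lt d (X : measurableType d) (f : X -> R) (L e : R) :
  measurable_fun setT f -> measurable [set x | `|f x - L| < e].
Proof.
move=> mf; rewrite (_ : [set x | _] = [set x | L - e < f x < L + e]).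
  exact: measurable_between.
by apply/seteqP; split=> x /=; rewrite ltr_distl.
Qed.

Lemma measurable_window (L e : R) (g : 'I_4 -> R) k (f : space4 R -> R) :
  measurable_fun setT f -> measurable [set z | window L e g k z (f z)].
Proof.
move=> mf; rewrite (_ : [set z | _] = [set z | `|f z - L| < e] `&`
    \bigcap_(i in [set: 'I_4])
      (if (i < k)%N then [set z | `|2 * vec4 z i ord0 + f z - g i| < e] else setT)).
  apply: measurableI; first exact: measurable_dist_lt.
  apply: fin_bigcap_measurable => //.
  move=> i _; case: ifP => // _; apply: measurable_dist_lt.
  apply: measurable_funD => //; apply: measurable_funM => //.
  exact: measurable_vec4.
apply/seteqP; split=> z [/= h0 h]; split=> // i.
  by move=> _; case: ifP => // /h.
by move=> ik; have := h i I; rewrite ik.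
Qed.

Let measurable_slices (M : 'M[R]_4) (L e : R) (g : 'I_4 -> R) :
  [/\ measurable (slice3 M L e g), measurable (slice2 M L e g),
      measurable (slice1 M L e g) & measurable (slice0 (R := R) L e)].
Proof.
have mq (f : space4 R -> space4 R) (r : space4 R -> R) :
    measurable_fun setT f -> measurable_fun setT r ->
    measurable_fun setT (fun z => quad M (f z) + r z).
  move=> mf mr; apply: measurable_funD => //.
  exact: (measurableT_comp (measurable_quad M)).
have m1 := @measurable_vec4 R.
have mv (i : 'I_4) (f : space4 R -> R) : f = (fun z => vec4 z i ord0) ->
    measurable_fun setT f by move=> ->; exact: m1.
have c0 : measurable_fun setT (fun z : space4 R => z.1.1.1).
  by apply: (mv o0); apply/funext => z; rewrite mxE.
have c1 : measurable_fun setT (fun z : space4 R => z.1.1.2).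
  by apply: (mv o1); apply/funext => z; rewrite mxE.
have c2 : measurable_fun setT (fun z : space4 R => z.1.2).
  by apply: (mv o2); apply/funext => z; rewrite mxE.
have c3 : measurable_fun setT (fun z : space4 R => z.2).
  by apply: (mv o3); apply/funext => z; rewrite mxE.
split.
- rewrite (_ : slice3 _ _ _ _ = (snd @^-1` `]0, +oo[%classic) `&`
    [set z | window L e g 3 z (quad M (z.1, 0) + z.2 ^+ 2)]).
    apply: measurableI; first exact: measurable_preimageT.
    apply: measurable_window; apply: (mq (fun z => (z.1, 0))).
      exact: measurable_fun_pair.
    exact: measurable_funX.
  by apply/seteqP; split=> z [/=]; rewrite in_itv/= andbT.
- apply: measurable_window; apply: (mq (fun z => (z.1.1, 0, 0))).
    do 2 (apply: measurable_fun_pair => //).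
    exact: measurableT_comp.
  apply: (measurableT_comp (@measurable_sqnorm2 R)).
  exact: measurable_fun_pair.
- apply: measurable_window; apply: (mq (fun z => (z.1.1.1, 0, 0, 0))).
    by do 3 (apply: measurable_fun_pair => //).
  apply: (measurableT_comp (@measurable_sqnorm3 R)).
  by apply: measurable_fun_pair => //; exact: measurable_fun_pair.
- apply: measurable_dist_lt; apply: measurable_funD.
    apply: (measurableT_comp (@measurable_sqnorm2 R)).
    exact: measurableT_comp.
  apply: (measurableT_comp (@measurable_sqnorm2 R)).
  exact: measurable_fun_pair.
Qed.

Lemma det_frame (a : 'I_4 -> 'cV[R]_4) (B : 'M[R]_4) (w : 'cV[R]_4) :
  (forall i : 'I_4, (i < 3)%N -> row i B = (a i)^T) -> B *m B^T = gram 3 a ->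
  \det (frame_mx a w) * \det B = \det (gram 3 a) * (B *m w) o3 ord0.
Proof.
move=> Ba BE.
have aE (i : 'I_4) (j : 'I_4) : (i < 3)%N -> a i j ord0 = B i j.
  by move=> i3; have /matrixP/(_ ord0 j) := Ba _ i3; rewrite !mxE.
have FE : frame_mx a w *m B^T = \matrix_(i, j)
    if i == o3 then (B *m w) j ord0 else gram 3 a i j.
  apply/matrixP => i j; rewrite -BE !mxE; case: eqP => [->|/eqP i3].
    by apply: eq_bigr => l _; rewrite !mxE mulrC.
  apply: eq_bigr => l _; rewrite !mxE (negbTE i3) aE//.
  by move: i3; rewrite -val_eqE/= ltn_neqAle => ->; rewrite -ltnS ltn_ord.
rewrite -[X in _ * X]det_tr -det_mulmx FE (expand_det_col _ o3).
rewrite [in RHS](expand_det_col _ o3) (bigD1 o3)//= big1 ?addr0; last first.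
  by move=> i i3; rewrite !mxE (negbTE i3)/= andbF mul0r.
rewrite [in RHS](bigD1 o3)//= [in RHS]big1 ?addr0; last first.
  by move=> i i3; rewrite !mxE/= andbF (negbTE i3) mul0r.
rewrite [X in X * _ = _]mxE eqxx [X in _ = X * _ * _]mxE/= mul1r mulrC.
congr (_ * _); rewrite /cofactor; congr (_ * \det _).
by apply/matrixP => i j; rewrite !mxE eq_sym (negbTE (neq_lift _ _)).
Qed.

Let oriented_frame (k : nat) (sg : R) (a : 'I_4 -> 'cV[R]_4) : (k <= 3)%N ->
  sg != 0 -> \det (gram k a) != 0 ->
  exists B : 'M[R]_4, [/\ forall i : 'I_4, (i < k)%N -> row i B = (a i)^T,
    B *m B^T = gram k a & 0 < sg * \det B].
Proof.
move=> k3 sg0 G0; have [B [Ba BE]] := frame_exists a (leq_trans k3 (leqnSn 3)).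
have : sg * \det B != 0.
  by rewrite mulf_neq0//; move: G0; rewrite (det_gram_frame BE) expf_eq0.
rewrite neq_lt => /orP[B_neg|B_pos]; last by exists B.
pose D : 'M[R]_4 := diag_mx (\row_i if i == o3 then -1 else 1).
have DB i j : (D *m B) i j = (if i == o3 then -1 else 1) * B i j.
  by rewrite /D mul_diag_mx !mxE.
exists (D *m B); split.
- move=> i ik; rewrite -Ba//; apply/rowP => j; rewrite mxE DB mxE ifF ?mul1r//.
  by apply/negbTE; rewrite -val_eqE/= ltn_eqF// (leq_trans ik).
- apply/matrixP => i j; rewrite trmx_mul -mulmxA (mulmxA B) BE.
  rewrite /D tr_diag_mx mul_mx_diag mul_diag_mx !mxE.
  case: (i =P j) => [->|/eqP ij].
    by case: ifP => _; rewrite ?mul1r ?mulr1// mulrN1 mulN1r opprK.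
  have [/andP[ik jk]|_] := boolP ((i < k)%N && (j < k)%N); last first.
    by rewrite mul0r mulr0.
  rewrite !ifF ?mul1r ?mulr1//; apply/negbTE; rewrite -val_eqE/= ltn_eqF//.
    exact: leq_trans jk k3.
  exact: leq_trans ik k3.
- rewrite det_mulmx /D det_diag prod_ord4 !mxE/= !mul1r mulN1r mulrN.
  by rewrite oppr_gt0.
Qed.

(** In the coordinates of an orthonormalized frame, the slice constrains the
    scalar products with the vectors a i and, by Pythagoras, the norm of the
    remaining part, whose squared norm has density radial_density. *)
Lemma edge_slice_bounds (k : nat) (sg : R) (a : 'I_4 -> 'cV[R]_4) (L : R)
    (l : 'I_4 -> R) (e A B : R) : (k <= 3)%N -> sg != 0 ->
  0 < e -> 0 <= A -> 0 <= B -> \det (gram k a) != 0 ->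
  (forall y s, (forall i : 'I_4, (k <= i)%N -> vec4 y i ord0 = 0) ->
     closed_window L e (fun i => l i - dotp (a i) (a i)) k y s ->
     0 < s - quad (invmx (gram k a)) y /\
     A <= radial_density k (s - quad (invmx (gram k a)) y) <= B) ->
  (((Num.sqrt (\det (gram k a)))^-1 * (A * (2 * e * e ^+ k)))%:E <=
   lam4 R (edge_slice k sg a L l e) <=
   ((Num.sqrt (\det (gram k a)))^-1 * (B * (2 * e * e ^+ k)))%:E)%E.
Proof.
move=> k3 sg0 e0 A0 B0 G0 wAB.
have [F [Fa FE Fsg]] := oriented_frame k3 sg0 G0.
have F0 : \det F != 0 by apply: contraTneq Fsg => ->; rewrite mulr0 ltxx.
have sE : Num.sqrt (\det (gram k a)) = `|\det F|.
  by rewrite (det_gram_frame FE) sqrtr_sqr.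
set M := invmx (gram k a) in wAB *.
pose g i := l i - dotp (a i) (a i).
pose rest w : R := \sum_(i < 4) if (i < k)%N then 0 else vec4 (lin4 F w) i ord0 ^+ 2.
have FwE (w : space4 R) (i : 'I_4) : (i < k)%N ->
    vec4 (lin4 F w) i ord0 = dotp (a i) (vec4 w).
  move=> ik; rewrite /lin4 unvec4K mxE; apply: eq_bigr => j _.
  by have /matrixP/(_ ord0 j) := Fa _ ik; rewrite !mxE => ->.
have windowE w : window L e g k (lin4 F w)
      (quad M (trunc k (lin4 F w)) + rest w) <->
    `|dotp (vec4 w) (vec4 w) - L| < e /\ (forall i : 'I_4, (i < k)%N ->
       `|dotp (a i + vec4 w) (a i + vec4 w) - l i| < e).
  rewrite /window -(frame_pythagoras _ FE G0).
  have gE (i : 'I_4) : (i < k)%N ->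
      2 * vec4 (lin4 F w) i ord0 + dotp (vec4 w) (vec4 w) - g i =
      dotp (a i + vec4 w) (a i + vec4 w) - l i.
    move=> ik; rewrite FwE// /g !dotpDl !dotpDr (dotpC (vec4 w) (a i)); ring.
  by split=> -[-> h]; split=> // i ik; have := h i ik; rewrite gE.
suff reduce (S : set (space4 R)) : measurable S ->
    (forall w, edge_slice k sg a L l e w <-> S (lin4 F w)) ->
    ((A * (2 * e * e ^+ k))%:E <= lam4 R S <= (B * (2 * e * e ^+ k))%:E)%E ->
    (((Num.sqrt (\det (gram k a)))^-1 * (A * (2 * e * e ^+ k)))%:E <=
     lam4 R (edge_slice k sg a L l e) <=
     ((Num.sqrt (\det (gram k a)))^-1 * (B * (2 * e * e ^+ k)))%:E)%E.
  have [m3 m2 m1 m0] := measurable_slices M L e g.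
  have vE (z : space4 R) : [/\ vec4 z o0 ord0 = z.1.1.1,
      vec4 z o1 ord0 = z.1.1.2, vec4 z o2 ord0 = z.1.2 & vec4 z o3 ord0 = z.2].
    by rewrite !mxE.
  have restE w : rest w = \sum_(i < 4) if (i < k)%N then 0
    else vec4 (lin4 F w) i ord0 ^+ 2 by [].
  clearbody M rest.
  have truncE (z : space4 R) : [/\ trunc 3 z = (z.1, 0), trunc 2 z = (z.1.1, 0, 0),
      trunc 1 z = (z.1.1.1, 0, 0, 0) & trunc 0 z = 0].
    by move: z => [[[x y] u] v]; rewrite /trunc/unvec4 !mxE.
  have [kE|[kE|[kE|kE]]] : k = 3%N \/ k = 2%N \/ k = 1%N \/ k = 0%N.
    by move: k3; case: (k) => [|[|[|[|//]]]] _; do ?[by left|right].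
  - rewrite kE in windowE wAB restE; rewrite kE in Fa FE.
    apply: (reduce (slice3 M L e g)) => [//|w|].
      have [v0 v1 v2 v3] := vE (lin4 F w); have [t3 _ _ _] := truncE (lin4 F w).
      have := windowE w; rewrite restE sum_ord4/= !add0r t3 v3.
      rewrite /edge_slice /slice3/= kE => wE.
      have detE : \det (frame_mx a (vec4 w)) = \det F * (lin4 F w).2.
        apply: (mulIf F0); rewrite (det_frame _ Fa FE) (det_gram_frame FE) -v3.
        by rewrite /lin4 unvec4K expr2 mulrAC.
      have signE : (0 < sg * \det (frame_mx a (vec4 w))) = (0 < (lin4 F w).2).
        by rewrite detE mulrA pmulr_rgt0.
      rewrite signE; split=> [[h1 h2 h3]|[h3 /wE[h1 h2]]].
        by split; [exact: h3|exact/wE].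
      by [].
    have := @coordinate_slice3 R M L e A B g e0 A0 B0.
    rewrite kE !exprS expr0 mulr1 !mulrA; apply => y s y0.
    by apply: wAB; apply: ord4P => // _; have [_ _ _ ->] := vE y.
  - rewrite kE in windowE wAB restE.
    apply: (reduce (slice2 M L e g)) => [//|w|].
      have [v0 v1 v2 v3] := vE (lin4 F w); have [_ t2 _ _] := truncE (lin4 F w).
      have := windowE w; rewrite restE sum_ord4/= !add0r t2 v2 v3.
      rewrite /edge_slice /slice2/= kE => wE.
      by split=> [[h1 h2 _]|/wE[]]; [exact/wE|].
    have := @coordinate_slice2 R M L e A B g e0 A0 B0.
    rewrite kE !exprS expr0 mulr1 !mulrA; apply => y s y2 y3.
    by have [_ _ v2 v3] := vE y; apply: wAB; apply: ord4P => // _; rewrite ?v2 ?v3.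
  - rewrite kE in windowE wAB restE.
    apply: (reduce (slice1 M L e g)) => [//|w|].
      have [v0 v1 v2 v3] := vE (lin4 F w); have [_ _ t1 _] := truncE (lin4 F w).
      have := windowE w; rewrite restE sum_ord4/= !add0r t1 v1 v2 v3 -addrA.
      rewrite /edge_slice /slice1/= kE => wE.
      by split=> [[h1 h2 _]|/wE[]]; [exact/wE|].
    have := @coordinate_slice1 R M L e A B g e0 A0 B0.
    rewrite kE !exprS expr0 mulr1 !mulrA; apply => y s y1 y2 y3.
    have [_ v1 v2 v3] := vE y.
    by apply: wAB; apply: ord4P => // _; rewrite ?v1 ?v2 ?v3.
  have quad0 : quad M 0 = 0.
    rewrite /quad (_ : vec4 0 = 0) ?mulmx0 ?mxE//.
    by apply/matrixP; apply: ord4P => j; rewrite !mxE.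
  rewrite kE in windowE wAB restE.
  apply: (reduce (slice0 (R := R) L e)) => [//|w|].
    have [v0 v1 v2 v3] := vE (lin4 F w); have [_ _ _ t0] := truncE (lin4 F w).
    have := windowE w; rewrite restE sum_ord4/= t0 quad0 add0r v0 v1 v2 v3 -addrA.
    rewrite /edge_slice /slice0/= kE => -[w1 w2].
    split=> [[h1 h2 _]|h]; first by have [] := w2 (conj h1 h2).
    by case: w1 => [|h1 h2]; split.
  have := @coordinate_slice0 R L e A B e0 A0.
  rewrite kE !expr0 mulr1; apply => s sL.
  have := wAB 0 s; rewrite quad0 subr0; apply; last by split.
  by apply: ord4P => _; rewrite mxE.
move=> mS SE.
rewrite (_ : edge_slice k sg a L l e = lin4 F @^-1` S); last first.
  by apply/seteqP; split=> w /SE.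
rewrite (lam4_preimage F0 mS) sE !(EFinM `|_|^-1).
by move=> /andP[lo hi]; rewrite !lee_pmul2l ?lte_fin ?invr_gt0 ?normr_gt0// lo hi.
Qed.

End EdgeSlices.

(** * Densities as functions of the edge lengths *)

Section ContinuityOfDeterminants.
Variable R : realType.
Context (T : topologicalType) (x : T).
Local Notation cont f := (f @ x --> (f x : R)).

Let ext (f g : T -> R) : f =1 g -> cont g -> cont f.
Proof. by move=> /funext ->. Qed.

Lemma cvg_big_sum I (r : seq I) (P : pred I) (f : I -> T -> R) :
  (forall i, cont (f i)) -> cont (fun t => \sum_(i <- r | P i) f i t).
Proof.
move=> cf; elim: r => [|i r IH].
  by under eq_fun do rewrite big_nil; rewrite big_nil; exact: cvg_cst.
under eq_fun do rewrite big_cons; rewrite big_cons.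
by case: ifP => // _; apply: cvgD => //; exact: cf.
Qed.

Lemma cvg_big_prod I (r : seq I) (P : pred I) (f : I -> T -> R) :
  (forall i, cont (f i)) -> cont (fun t => \prod_(i <- r | P i) f i t).
Proof.
move=> cf; elim: r => [|i r IH].
  by under eq_fun do rewrite big_nil; rewrite big_nil; exact: cvg_cst.
under eq_fun do rewrite big_cons; rewrite big_cons.
by case: ifP => // _; apply: cvgM => //; exact: cf.
Qed.

Lemma cvg_det n (A : T -> 'M[R]_n) :
  (forall i j, cont (fun t => A t i j)) -> cont (fun t => \det (A t)).
Proof.
move=> cA; rewrite /determinant; apply: (@cvg_big_sum _ _ _
  (fun (s : 'S_n) t => (-1) ^+ s * \prod_i A t i (s i))) => s.
apply: cvgM; first exact: cvg_cst.
by apply: (@cvg_big_prod _ _ _ (fun i t => A t i (s i))) => i; exact: cA.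
Qed.

Lemma cvg_adj n (A : T -> 'M[R]_n) (i j : 'I_n) :
  (forall i j, cont (fun t => A t i j)) -> cont (fun t => \adj (A t) i j).
Proof.
move=> cA; apply: (@ext _ (fun t => cofactor (A t) j i)) => [t|].
  by rewrite mxE.
apply: cvgM; first exact: cvg_cst.
apply: cvg_det => k l; apply: (ext (g := fun t => A t (lift j k) (lift i l))) => [t|].
  by rewrite !mxE.
exact: cA.
Qed.

End ContinuityOfDeterminants.

Section CayleyMenger.
Variable R : realType.
Implicit Types (q : 'M[R]_5) (k : nat).

Definition sq q (i j : nat) : R :=
  if (i < j)%N then q (inord i) (inord j)
  else if (j < i)%N then q (inord j) (inord i) else 0.

(** The Gram matrix of the vectors from the vertices i < k to the vertex k, as
    a function of the squared edge lengths. *)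
Definition length_gram k q : 'M[R]_4 := \matrix_(i, j)
  if (i < k)%N && (j < k)%N then (sq q i k + sq q j k - sq q i j) / 2
  else (i == j)%:R.

Definition length_dot k q (i : 'I_4) : R :=
  if (i < k)%N then (sq q i k.+1 - sq q i k - sq q k k.+1) / 2 else 0.

(** The squared distance of the vertex k + 1 to the span of the vertices up to
    k, as a function of the squared edge lengths. *)
Definition length_height k q : R := sq q k k.+1 -
  (\det (length_gram k q))^-1 * \sum_(j < 4) (\sum_(i < 4)
     length_dot k q i * \adj (length_gram k q) i j) * length_dot k q j.

Definition length_density k q : R :=
  (Num.sqrt (\det (length_gram k q)))^-1 * radial_density k (length_height k q).

Lemma length_heightE k q (y : space4 R) :
  \det (length_gram k q) != 0 ->
  (forall i : 'I_4, vec4 y i ord0 = length_dot k q i) ->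
  length_height k q = sq q k k.+1 - quad (invmx (length_gram k q)) y.
Proof.
move=> G0 yE; rewrite /length_height; congr (_ - _).
rewrite /quad /invmx unitmxE unitfE G0 mxE mulr_sumr; apply: eq_bigr => j _.
rewrite mulrA -yE !mxE; congr (_ * _); rewrite mulr_sumr; apply: eq_bigr => i _.
by rewrite !mxE -yE mxE mulrCA.
Qed.

Section AtPoint.
Context (T : topologicalType) (t0 : T) (k : nat) (Q : T -> 'M[R]_5).
Local Notation cont f := (f @ t0 --> (f t0 : R)).
Hypothesis cQ : forall i j, cont (fun t => Q t i j).
Hypotheses (G0 : 0 < \det (length_gram k (Q t0))).
Hypothesis h0 : 0 < length_height k (Q t0).

Let c_sq i j : cont (fun t => sq (Q t) i j).
Proof.
rewrite /sq; case: (i < j)%N; first exact: cQ.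
by case: (j < i)%N; [exact: cQ|exact: cvg_cst].
Qed.

Let c_gram i j : cont (fun t => length_gram k (Q t) i j).
Proof.
rewrite (_ : (fun t => _) = fun t => if (i < k)%N && (j < k)%N
    then (sq (Q t) i k + sq (Q t) j k - sq (Q t) i j) / 2 else (i == j)%:R).
  case: ((i < k)%N && (j < k)%N); last exact: cvg_cst.
  apply: cvgM; last exact: cvg_cst.
  by apply: cvgB; [apply: cvgD|]; exact: c_sq.
by apply/funext => t; rewrite mxE.
Qed.

Let c_dot i : cont (fun t => length_dot k (Q t) i).
Proof.
rewrite /length_dot; case: (i < k)%N; last exact: cvg_cst.
apply: cvgM; last exact: cvg_cst.
by apply: cvgB; [apply: cvgB|]; exact: c_sq.
Qed.

Let c_det : cont (fun t => \det (length_gram k (Q t))).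
Proof. exact: cvg_det. Qed.

Let c_height : cont (fun t => length_height k (Q t)).
Proof.
apply: cvgB; first exact: c_sq.
apply: cvgM; first by apply: cvgV c_det; rewrite gt_eqF.
apply: (@cvg_big_sum R T t0 _ _ _ (fun j t => (\sum_(i < 4)
     length_dot k (Q t) i * \adj (length_gram k (Q t)) i j) *
     length_dot k (Q t) j)) => j.
apply: cvgM; last exact: c_dot.
apply: (@cvg_big_sum R T t0 _ _ _ (fun i t =>
  length_dot k (Q t) i * \adj (length_gram k (Q t)) i j)) => i.
by apply: cvgM; [exact: c_dot|exact: cvg_adj].
Qed.

Let c_density : cont (fun t => length_density k (Q t)).
Proof.
have csqrt (f : T -> R) : cont f -> cont (fun t => Num.sqrt (f t)).
  by move=> cf; apply: (continuous_cvg _ (@sqrt_continuous R (f t0)) cf).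
apply: cvgM.
  apply: cvgV; first by rewrite gt_eqF// sqrtr_gt0.
  exact: csqrt c_det.
rewrite /radial_density; case: (k) (c_height) (h0) => [|[|[|k']]] ch hp.
- by apply: cvgM => //; exact: cvg_cst.
- by apply: cvgM; [exact: cvg_cst|exact: csqrt].
- exact: cvg_cst.
- apply: cvgV; first by rewrite gt_eqF// mulr_gt0// sqrtr_gt0.
  by apply: cvgM; [exact: cvg_cst|exact: csqrt].
Qed.

Lemma near_length_density (dlt : R) : 0 < dlt -> \forall t \near t0,
  [/\ 0 < \det (length_gram k (Q t)), 0 < length_height k (Q t) &
      `|length_density k (Q t) - length_density k (Q t0)| < dlt].
Proof.
move=> d0; near=> t; split; near: t.
- exact: (cvgr_gt _ c_det).
- exact: (cvgr_gt _ c_height).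
- have /cvgrPdist_lt/(_ _ d0) := c_density.
  by apply: filterS => t; rewrite distrC.
Unshelve. all: by end_near. Qed.

End AtPoint.

Lemma near_density k (q0 : 'M[R]_5) (dlt : R) : 0 < \det (length_gram k q0) ->
  0 < length_height k q0 -> 0 < dlt -> exists2 e : R, 0 < e &
  forall q, (forall i j : 'I_5, `|q i j - q0 i j| < e) ->
  [/\ 0 < \det (length_gram k q), 0 < length_height k q &
      `|length_density k q - length_density k q0| < dlt].
Proof.
move=> G0 h0 d0.
have c i j : (fun q : 'M[R]_5 => q i j) @ q0 --> q0 i j.
  exact: (@coord_continuous R 5 5 i j q0).
have /nbhs_ballP[e e0 qe] := near_length_density c G0 h0 d0.
exists e => // q qq0; apply: qe.
by split=> // i j; rewrite /ball/= distrC; exact: qq0.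
Qed.

End CayleyMenger.
(** * Adding one edge to a partial pentagon *)

Section Tubes.
Variable R : realType.
Implicit Types (L : 'M[R]_5) (E : nat -> 'cV[R]_4) (e : R).

Definition path_edge E (i j : nat) : 'cV[R]_4 := \sum_(i <= t < j) E t.

Definition frame E (k : nat) (i : 'I_4) : 'cV[R]_4 := path_edge E i k.

Definition near_lengths L e (m : nat) E : Prop :=
  forall i j, (i < j <= m)%N ->
    `|dotp (path_edge E i j) (path_edge E i j) - sq L i j| < e.

Lemma path_edgeD E i j k : (i <= j <= k)%N ->
  path_edge E i k = path_edge E i j + path_edge E j k.
Proof. by move=> /andP[ij jk]; rewrite /path_edge (big_cat_nat ij jk). Qed.

Lemma path_edgeS E i : path_edge E i i.+1 = E i.
Proof. by rewrite /path_edge big_nat1. Qed.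

Lemma path_edge0 E i : path_edge E i i = 0.
Proof. by rewrite /path_edge big_geq. Qed.

Lemma eq_path_edge E E' i j : (forall t, (t < j)%N -> E t = E' t) ->
  path_edge E i j = path_edge E' i j.
Proof.
by move=> EE; apply: eq_big_nat => t /andP[_ tj]; exact: EE.
Qed.

Lemma near_lengthsS L e m E (sg : R) : (m < 4)%N ->
  (near_lengths L e m.+1 E /\
    (m = 3%N -> 0 < sg * \det (frame_mx (frame E m) (E m)))) <->
  near_lengths L e m E /\
  [/\ `|dotp (E m) (E m) - sq L m m.+1| < e,
     forall i : 'I_4, (i < m)%N ->
       `|dotp (frame E m i + E m) (frame E m i + E m) - sq L i m.+1| < e &
     m = 3%N -> 0 < sg * \det (frame_mx (frame E m) (E m))].
Proof.
move=> m4; have xS (i : nat) : (i <= m)%N ->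
    path_edge E i m.+1 = path_edge E i m + E m.
  by move=> im; rewrite (@path_edgeD _ _ m) ?im ?leqnSn// path_edgeS.
split=> [[nE dE]|[nE [n1 n2 dE]]].
  split=> [i j /andP[ij jm]|]; first by apply: nE; rewrite ij ltnW.
  split=> // [|i im].
    by have := nE m m.+1; rewrite path_edgeS; apply; rewrite ltnSn.
  by have := nE i m.+1; rewrite xS ?(ltnW im)//; apply; rewrite ltnS (ltnW im) leqnn.
split=> // i j /andP[ij]; rewrite leq_eqVlt => /predU1P[jm|]; last first.
  by rewrite ltnS => jm; apply: nE; rewrite ij.
rewrite jm in ij *; move: ij; rewrite ltnS leq_eqVlt => /predU1P[->|im].
  by rewrite path_edgeS.
rewrite xS ?(ltnW im)//.
by have := n2 (Ordinal (ltn_trans im m4)) im.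
Qed.

Lemma radial_densityE k (q : 'M[R]_5) : 0 < \det (length_gram k q) ->
  radial_density k (length_height k q) =
  Num.sqrt (\det (length_gram k q)) * length_density k q.
Proof.
move=> G0; rewrite /length_density mulrA divff ?mul1r//.
by rewrite gt_eqF// sqrtr_gt0.
Qed.

(** All lengths which occur in the slice are nearly the prescribed ones, so the
    density of the new edge is controlled by continuity at L. *)
Lemma step_bounds k L E e e0 dlt (sg : R) : (k <= 3)%N -> sg != 0 ->
  0 < e < e0 -> 0 < dlt < length_density k L ->
  (forall q : 'M[R]_5, (forall i j, `|q i j - L i j| < e0) ->
  [/\ 0 < \det (length_gram k q), 0 < length_height k q &
      `|length_density k q - length_density k L| < dlt]) ->
  near_lengths L e k E ->
  (((length_density k L - dlt) * (2 * e * e ^+ k))%:E <=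
   lam4 R (edge_slice k sg (frame E k) (sq L k k.+1) (fun i => sq L i k.+1) e) <=
   ((length_density k L + dlt) * (2 * e * e ^+ k))%:E)%E.
Proof.
move=> k3 sg0 /andP[e_gt0 ee0] /andP[d0 dlt_c] near_q nE.
set a := frame E k; set c := length_density k L.
pose x i j := path_edge E i j.
have aE i : a i = x i k by [].
pose q (y : space4 R) s : 'M[R]_5 := \matrix_(i < 5, j < 5)
  if (i < j)%N then
    if (j <= k)%N then dotp (x i j) (x i j)
    else if j == k.+1 :> nat then
      if i == k :> nat then s else if (i < k)%N then
        dotp (x i k) (x i k) + 2 * vec4 y (inord i) ord0 + s else L i j
    else L i j
  else L i j.
have sqE y s (i j : nat) : (i < j < 5)%N -> sq (q y s) i j =
    if (j <= k)%N then dotp (x i j) (x i j)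
    else if j == k.+1 :> nat then
      if i == k :> nat then s else if (i < k)%N then
        dotp (x i k) (x i k) + 2 * vec4 y (inord i) ord0 + s else sq L i j
    else sq L i j.
  move=> /andP[ij j5]; rewrite /sq ij mxE !inordK ?ij//.
  exact: ltn_trans ij j5.
have sqC (p : 'M[R]_5) i j : sq p i j = sq p j i.
  by rewrite /sq; case: (ltngtP i j) => // ->; rewrite ltnn.
have sq_x y s (i j : nat) : (i <= j <= k)%N -> sq (q y s) i j = dotp (x i j) (x i j).
  move=> /andP[]; rewrite leq_eqVlt => /predU1P[->|ij] jk.
    by rewrite /sq ltnn /x path_edge0 dotp0l.
  by rewrite sqE ?jk// ij (leq_ltn_trans jk)// (leq_ltn_trans k3).
have gramE y s : length_gram k (q y s) = gram k a.
  apply/matrixP => i j; rewrite !mxE; case: andP => // -[ik jk].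
  wlog ij : i j ik jk / (i <= j)%N.
    move=> W; have [/W->//|/ltnW/W WW] := leqP i j.
    by rewrite dotpC -WW// (sqC _ j i) [sq _ i k + _]addrC.
  rewrite !sq_x ?ij ?(ltnW ik) ?(ltnW jk) ?leqnn// !aE.
  rewrite /x (@path_edgeD E i j k) ?ij ?(ltnW jk)//.
  rewrite !dotpDl !dotpDr (dotpC (path_edge E j k)); by field.
have sq_s y s : sq (q y s) k k.+1 = s.
  by rewrite sqE ?ltnSn ?ltnS// ltnn !eqxx.
have dotE y s (i : 'I_4) : (forall i : 'I_4, (k <= i)%N -> vec4 y i ord0 = 0) ->
    vec4 y i ord0 = length_dot k (q y s) i.
  move=> y0; rewrite /length_dot; case: ifP => ik; last first.
    by rewrite y0// leqNgt ik.
  rewrite sq_s (@sq_x y s i k) ?(ltnW ik) ?leqnn//.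
  rewrite (@sqE y s i k.+1); last first.
    by rewrite ltnS (ltnW ik)/= !ltnS.
  rewrite ltnn eqxx (ltn_eqF ik) ik (_ : inord i = i); last exact: inord_val.
  by field.
have q_near y s : closed_window (sq L k k.+1) e
    (fun i => sq L i k.+1 - dotp (a i) (a i)) k y s ->
    forall i j, `|q y s i j - L i j| < e0.
  move=> [w1 w2] i j; have e00 : 0 < e0 by exact: lt_trans ee0.
  have L0 : `|L i j - L i j| < e0 by rewrite subrr normr0.
  rewrite mxE; case: ifP => // ij.
  have sqL : sq L i j = L i j by rewrite /sq ij !inord_val.
  case: ifP => [jk|_].
    by rewrite -sqL; apply: lt_trans ee0; apply: nE; rewrite ij.
  case: eqP => // jk; case: eqP => [ik|/eqP ik].
    by rewrite -sqL ik jk; exact: le_lt_trans ee0.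
  have ik' : (i < k)%N by rewrite ltn_neqAle ik -ltnS -jk.
  rewrite ik'; have i4 : (i < 4)%N by exact: (leq_trans (leq_trans ik' k3)).
  have := w2 (Ordinal i4) ik'; rewrite /= -jk sqL => /le_lt_trans/(_ ee0).
  rewrite (_ : inord i = Ordinal i4); last first.
    by apply: val_inj; rewrite /= inordK.
  rewrite aE/= /x; congr (`|_| < _); ring.
have [G0 c0] : 0 < \det (gram k a) /\ 0 < c.
  split; last exact: lt_trans dlt_c.
  pose y : space4 R := unvec4 (\col_i (if (i < k)%N then
    (sq L i k.+1 - dotp (a i) (a i) - sq L k k.+1) / 2 else 0)).
  rewrite -(gramE y (sq L k k.+1)).
  suff w : closed_window (sq L k k.+1) e
      (fun i => sq L i k.+1 - dotp (a i) (a i)) k y (sq L k k.+1).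
    by have [] := near_q _ (q_near _ _ w).
  split=> [|i ik]; first by rewrite subrr normr0 ltW.
  rewrite unvec4K mxE ik (_ : _ - _ = 0) ?normr0 ?ltW//; by field.
have S0 : 0 < Num.sqrt (\det (gram k a)) by rewrite sqrtr_gt0.
have := @edge_slice_bounds R k sg a (sq L k k.+1) (fun i => sq L i k.+1) e
  (Num.sqrt (\det (gram k a)) * (c - dlt)) (Num.sqrt (\det (gram k a)) * (c + dlt))
  k3 sg0 e_gt0.
rewrite -!mulrA ![_^-1 * _]mulKf ?gt_eqF//; apply.
- by rewrite mulr_ge0 ?sqrtr_ge0// subr_ge0 ltW.
- by rewrite mulr_ge0 ?sqrtr_ge0// addr_ge0 ?ltW.
- by [].
- move=> y s yk w; have [Gq hq dq] := near_q _ (q_near _ _ w).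
  have hE : length_height k (q y s) = s - quad (invmx (gram k a)) y.
    rewrite (@length_heightE _ _ _ y) ?gramE ?sq_s ?gt_eqF//.
    by move=> i; exact: dotE.
  rewrite -hE hq radial_densityE// gramE; split=> //.
  rewrite !ler_pM2l//; move: dq; rewrite ltr_distl -/c => /andP[/ltW-> /ltW->].
  by [].
Qed.

End Tubes.

(** * Volume of the regularized simplices *)

Section TubeVolume.
Variable R : realType.
Implicit Types (L : 'M[R]_5) (e sg : R) (p : pentagon R).

(** The regularized set of 4-simplices of orientation sg: the supports of the
    approximate delta functions. *)
Definition tube L e sg : set (pentagon R) :=
  [set p | near_lengths L e 4 (pentagon_edge p) /\
    0 < sg * \det (frame_mx (frame (pentagon_edge p) 3) (pentagon_edge p 3))].

Lemma measurable_pentagon_edge k i :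
  measurable_fun setT (fun p => pentagon_edge p k i ord0).
Proof.
have m4 (f : pentagon R -> space4 R) : measurable_fun setT f ->
    measurable_fun setT (fun p => vec4 (f p) i ord0).
  by move=> mf; apply: (measurableT_comp (@measurable_vec4 R i) mf).
rewrite /pentagon_edge; case: k => [|[|[|[|k]]]] /=; apply: m4 => //.
- by do 2 apply: measurableT_comp => //.
- by do 2 apply: measurableT_comp => //.
- exact: measurableT_comp.
- by case: k => [|k] /=; exact: measurable_snd.
Qed.

Section Measurability.
Context d (T : measurableType d) (E : T -> nat -> 'cV[R]_4).
Hypothesis mE : forall k i, measurable_fun setT (fun t => E t k i ord0).

Let m_path i j a : measurable_fun setT (fun t => path_edge (E t) i j a ord0).
Proof.
rewrite (_ : (fun t => _) = fun t => \sum_(i <= k < j) E t k a ord0).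
  exact: measurable_sum.
by apply/funext => t; rewrite summxE.
Qed.

Lemma measurable_sqlength i j : measurable_fun setT
  (fun t => dotp (path_edge (E t) i j) (path_edge (E t) i j)).
Proof. by apply: measurable_sum => a; apply: measurable_funM; exact: m_path. Qed.

Lemma measurable_near_lengths L e m :
  measurable [set t | near_lengths L e m (E t)].
Proof.
rewrite (_ : [set t | _] = \bigcap_i \bigcap_j (if (i < j <= m)%N then
   [set t | sq L i j - e < dotp (path_edge (E t) i j) (path_edge (E t) i j)
     < sq L i j + e] else setT)).
  apply: bigcapT_measurable => i; apply: bigcapT_measurable => j.
  case: (i < j <= m)%N => //; apply: measurable_between => //.
  exact: measurable_sqlength.
apply/seteqP; split=> t /= H i.
  by move=> _ j _; case: ifP => // /H; rewrite ltr_distl.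
by move=> j ijm; have := H i I j I; rewrite ijm/= ltr_distl.
Qed.

Lemma measurable_orientation k j : measurable_fun setT
  (fun t => \det (frame_mx (frame (E t) k) (E t j))).
Proof.
apply: measurable_sum => s; apply: measurable_funM => //.
apply: measurable_prod => a _.
rewrite (_ : (fun t => _) = fun t => if a == o3 then E t j (s a) ord0
  else path_edge (E t) a k (s a) ord0).
  by case: (a == o3) => //; exact: m_path.
by apply/funext => t; rewrite !mxE; case: (a == o3).
Qed.

End Measurability.

Lemma measurable_tube L e sg : measurable (tube L e sg).
Proof.
rewrite (_ : tube L e sg = [set p | near_lengths L e 4 (pentagon_edge p)] `&`
   (fun p => sg * \det (frame_mx (frame (pentagon_edge p) 3)
     (pentagon_edge p 3))) @^-1` `]0, +oo[%classic).
  apply: measurableI.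
    apply: measurable_near_lengths => k i.
    exact: measurable_pentagon_edge.
  apply: measurable_preimageT => //; apply: measurable_funM => //.
  apply: measurable_orientation => k i; exact: measurable_pentagon_edge.
by apply/seteqP; split=> p [nE]/=; rewrite in_itv/= andbT.
Qed.

Let fibre L e sg m (E E' : nat -> 'cV[R]_4) (w : space4 R) : (m < 4)%N ->
  (forall t, (t < m)%N -> E' t = E t) -> E' m = vec4 w ->
  near_lengths L e m.+1 E' /\
    (m = 3%N -> 0 < sg * \det (frame_mx (frame E' m) (E' m))) <->
  near_lengths L e m E /\ edge_slice m sg (frame E m) (sq L m m.+1)
    (fun i => sq L i m.+1) e w.
Proof.
move=> m4 EE' Ew; have fE : frame E' m = frame E m.
  by apply/funext => i; exact: eq_path_edge.
rewrite near_lengthsS// fE Ew; suff -> : near_lengths L e m E' = near_lengths L e m E.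
  by [].
apply/propext; split=> H i j /andP[ij jm]; have := H i j; rewrite ij jm.
  by rewrite (@eq_path_edge _ E' E)// => [|t tj]; [exact|exact: EE' (leq_trans tj jm)].
by rewrite (@eq_path_edge _ E' E)// => [|t tj]; [exact|exact: EE' (leq_trans tj jm)].
Qed.

(** The fibres over the tube of the first edges are edge slices, of nearly
    constant volume by continuity of the densities. *)
Lemma tube_bounds L dlt sg : sg != 0 ->
  (forall k, (k < 4)%N -> [/\ 0 < \det (length_gram k L), 0 < length_height k L &
    0 < dlt < length_density k L]) ->
  \forall e \near 0^'+,
    ((\prod_(k < 4) (length_density k L - dlt) * (16 * e ^+ 10))%:E <=
     @pentagon_lebesgue R (tube L e sg) <=
     (\prod_(k < 4) (length_density k L + dlt) * (16 * e ^+ 10))%:E)%E.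
Proof.
move=> sg0 HL.
have HN k : (k < 4)%N -> exists2 e0 : R, 0 < e0 &
  forall q : 'M[R]_5, (forall i j, `|q i j - L i j| < e0) ->
  [/\ 0 < \det (length_gram k q), 0 < length_height k q &
      `|length_density k q - length_density k L| < dlt].
  by move=> k4; have [G0 h0 /andP[d0 _]] := HL k k4; exact: near_density.
have [[r0 r00 n0] [r1 r10 n1]] := (HN 0%N isT, HN 1%N isT).
have [[r2 r20 n2] [r3 r30 n3]] := (HN 2%N isT, HN 3%N isT).
near=> e.
have e0 : 0 < e by [].
have e_r0 : 0 < e < r0 by rewrite e0; near: e; exact: nbhs_right_lt.
have e_r1 : 0 < e < r1 by rewrite e0; near: e; exact: nbhs_right_lt.
have e_r2 : 0 < e < r2 by rewrite e0; near: e; exact: nbhs_right_lt.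
have e_r3 : 0 < e < r3 by rewrite e0; near: e; exact: nbhs_right_lt.
pose lo k := (length_density k L - dlt) * (2 * e * e ^+ k).
pose hi k := (length_density k L + dlt) * (2 * e * e ^+ k).
have box0 k : 0 <= 2 * e * e ^+ k by rewrite !mulr_ge0// ?exprn_ge0// ltW.
have lo0 k : (k < 4)%N -> 0 <= lo k.
  by move=> /HL[_ _ /andP[_ ?]]; rewrite mulr_ge0// subr_ge0 ltW.
have hi0 k : (k < 4)%N -> 0 <= hi k.
  move=> /HL[_ _ /andP[d0 dc]]; rewrite mulr_ge0// addr_ge0 ?ltW//.
  exact: lt_trans dc.
have step k rk E : (k < 4)%N -> 0 < e < rk ->
  (forall q : 'M[R]_5, (forall i j, `|q i j - L i j| < rk) ->
  [/\ 0 < \det (length_gram k q), 0 < length_height k q &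
      `|length_density k q - length_density k L| < dlt]) ->
  near_lengths L e k E ->
  ((lo k)%:E <= lam4 R (edge_slice k sg (frame E k) (sq L k k.+1)
     (fun i => sq L i k.+1) e) <= (hi k)%:E)%E.
  move=> k4 e_rk nk nE; have [_ _ dc] := HL k k4.
  exact: (step_bounds k4 sg0 e_rk dc nk nE).
pose z : space4 R := 0.
pose T1 := [set x : space4 R | near_lengths L e 1 (pentagon_edge (x, z, z, z))].
pose T2 := [set x : space4 R * space4 R | near_lengths L e 2 (pentagon_edge (x, z, z))].
pose T3 := [set x : space4 R * space4 R * space4 R |
  near_lengths L e 3 (pentagon_edge (x, z))].
have mT3 : measurable T3.
  apply: measurable_near_lengths => k i.
  exact: (measurableT_comp (measurable_pentagon_edge k i)
    (measurable_fun_pair (@measurable_id _ _ _) (measurable_cst z))).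
have mT2 : measurable T2.
  apply: measurable_near_lengths => k i.
  apply: (measurableT_comp (measurable_pentagon_edge k i)).
  by do 2 (apply: measurable_fun_pair => //).
have mT1 : measurable T1.
  apply: measurable_near_lengths => k i.
  apply: (measurableT_comp (measurable_pentagon_edge k i)).
  by do 3 (apply: measurable_fun_pair => //).
have B1 : ((lo 0)%:E <= lam4 R T1 <= (hi 0)%:E)%E.
  have E0 : near_lengths L e 0 (pentagon_edge (z, z, z, z)).
    by move=> i j /andP[ij j0]; move: (leq_trans ij j0).
  rewrite (_ : T1 = edge_slice 0 sg (frame (pentagon_edge (z, z, z, z)) 0)
    (sq L 0 1) (fun i => sq L i 1) e); first exact: (step _ r0).
  apply/seteqP; split=> w; rewrite /T1/=.
    by move=> nw; have [] := (@fibre L e sg 0 (pentagon_edge (z, z, z, z))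
      (pentagon_edge (w, z, z, z)) w isT _ erefl).1 (conj nw _).
  move=> sw; have [] // := (@fibre L e sg 0 (pentagon_edge (z, z, z, z))
      (pentagon_edge (w, z, z, z)) w isT _ erefl).2.
have B2 : ((lo 1)%:E * lam4 R T1 <= prodm (lam4 R) (lam4 R) T2 <=
           (hi 1)%:E * lam4 R T1)%E.
  have fT x : forall w, T2 (x, w) <-> T1 x /\ edge_slice 1 sg
      (frame (pentagon_edge (x, z, z, z)) 1) (sq L 1 2) (fun i => sq L i 2) e w.
    move=> w; rewrite -(@fibre L e sg 1 _ (pentagon_edge (x, w, z, z)))//.
      by split=> [|[]//]; split.
    by case.
  apply: prodm_fiber_bounds; rewrite ?lo0 ?hi0//.
    move=> x nT; apply/seteqP; split=> // w; rewrite /xsection/= inE.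
    by move=> /fT[].
  move=> x Tx; rewrite (_ : xsection _ _ = edge_slice 1 sg
      (frame (pentagon_edge (x, z, z, z)) 1) (sq L 1 2) (fun i => sq L i 2) e).
    exact: (step _ r1).
  apply/seteqP; split=> w; rewrite /xsection/= inE; first by move=> /fT[].
  by move=> ?; apply/fT.
have B3 : ((lo 2)%:E * prodm (lam4 R) (lam4 R) T2 <=
   prodm (prodm (lam4 R) (lam4 R)) (lam4 R) T3 <=
   (hi 2)%:E * prodm (lam4 R) (lam4 R) T2)%E.
  have fT x : forall w, T3 (x, w) <-> T2 x /\ edge_slice 2 sg
      (frame (pentagon_edge (x, z, z)) 2) (sq L 2 3) (fun i => sq L i 3) e w.
    move=> w; rewrite -(@fibre L e sg 2 _ (pentagon_edge (x, w, z)))//.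
      by split=> [|[]//]; split.
    by case=> [|[|]].
  apply: prodm_fiber_bounds; rewrite ?lo0 ?hi0//.
    move=> x nT; apply/seteqP; split=> // w; rewrite /xsection/= inE.
    by move=> /fT[].
  move=> x Tx; rewrite (_ : xsection _ _ = edge_slice 2 sg
      (frame (pentagon_edge (x, z, z)) 2) (sq L 2 3) (fun i => sq L i 3) e).
    exact: (step _ r2).
  apply/seteqP; split=> w; rewrite /xsection/= inE; first by move=> /fT[].
  by move=> ?; apply/fT.
have B4 : ((lo 3)%:E * prodm (prodm (lam4 R) (lam4 R)) (lam4 R) T3 <=
   @pentagon_lebesgue R (tube L e sg) <=
   (hi 3)%:E * prodm (prodm (lam4 R) (lam4 R)) (lam4 R) T3)%E.
  have fT x : forall w, tube L e sg (x, w) <-> T3 x /\ edge_slice 3 sg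
      (frame (pentagon_edge (x, z)) 3) (sq L 3 4) (fun i => sq L i 4) e w.
    move=> w; rewrite -(@fibre L e sg 3 _ (pentagon_edge (x, w)))//.
      by split=> [[? ?]|[? /(_ erefl)?]]; split.
    by case=> [|[|[|]]].
  rewrite pentagon_lebesgueE; apply: prodm_fiber_bounds; rewrite ?lo0 ?hi0//.
    exact: measurable_tube.
    move=> x nT; apply/seteqP; split=> // w; rewrite /xsection/= inE.
    by move=> /fT[].
  move=> x Tx; rewrite (_ : xsection _ _ = edge_slice 3 sg
      (frame (pentagon_edge (x, z)) 3) (sq L 3 4) (fun i => sq L i 4) e).
    exact: (step _ r3).
  apply/seteqP; split=> w; rewrite /xsection/= inE; first by move=> /fT[].
  by move=> ?; apply/fT.
have prodE (f : nat -> R) : \prod_(k < 4) f k * (16 * e ^+ 10) =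
    (f 3 * (2 * e * e ^+ 3)) * ((f 2 * (2 * e * e ^+ 2)) *
    ((f 1 * (2 * e * e ^+ 1)) * (f 0 * (2 * e * e ^+ 0)))).
  by rewrite prod_ord4/=; ring.
rewrite (prodE (fun k => length_density k L - dlt)).
rewrite (prodE (fun k => length_density k L + dlt)).
rewrite -![(length_density _ L - dlt) * _]/(lo _).
rewrite -![(length_density _ L + dlt) * _]/(hi _).
have E4 x y u v : (x * (y * (u * v)))%:E = (x%:E * (y%:E * (u%:E * v%:E)) :> \bar R)%E.
  by rewrite !EFinM.
rewrite !E4.
move: B1 B2 B3 B4 => /andP[l1 h1] /andP[l2 h2] /andP[l3 h3] /andP[l4 h4].
have lo0E k : (k < 4)%N -> (0 <= (lo k)%:E)%E by move=> k4; rewrite lee_fin lo0.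
have hi0E k : (k < 4)%N -> (0 <= (hi k)%:E)%E by move=> k4; rewrite lee_fin hi0.
apply/andP; split.
  apply: le_trans l4; apply: lee_wpmul2l; first exact: lo0E.
  apply: le_trans l3; apply: lee_wpmul2l; first exact: lo0E.
  by apply: le_trans l2; apply: lee_wpmul2l; first exact: lo0E.
apply: (le_trans h4); apply: lee_wpmul2l; first exact: hi0E.
apply: (le_trans h3); apply: lee_wpmul2l; first exact: hi0E.
by apply: (le_trans h2); apply: lee_wpmul2l; first exact: hi0E.
Unshelve. all: by end_near. Qed.

End TubeVolume.

(** * Positivity of Gram determinants and heights *)

Section DensityProduct.
Variable R : realType.
Implicit Types (E : nat -> 'cV[R]_4) (L : 'M[R]_5).

Definition edge_mx E : 'M[R]_4 := \matrix_(i < 4) (E i)^T.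

Definition partial_frame E k : 'M[R]_4 :=
  \matrix_(i < 4) (if (i < k)%N then frame E k i else E i)^T.

Lemma det_upper (U : 'M[R]_4) : (forall i j : 'I_4, (j < i)%N -> U i j = 0) ->
  (forall i, U i i = 1) -> \det U = 1.
Proof.
move=> U0 U1; rewrite -det_tr det_trig; last first.
  by apply/is_trig_mxP => i j ij; rewrite mxE U0.
by rewrite big1// => i _; rewrite mxE U1.
Qed.

Lemma path_edge_row E i j : (j <= 4)%N ->
  (path_edge E i j)^T =
  \sum_(t < 4) ((i <= t < j)%N)%:R *: row t (edge_mx E).
Proof.
move=> j4; rewrite /path_edge linear_sum/=.
rewrite (big_nat_widen _ _ 4)//= (big_nat_widenl _ 0)//= big_mkord big_mkcond/=.
by apply: eq_bigr => t _; rewrite rowK andbC; case: ifP => _; rewrite ?scale1r ?scale0r.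
Qed.

Lemma det_partial_frame E k : (k <= 4)%N ->
  \det (partial_frame E k) = \det (edge_mx E).
Proof.
move=> k4; pose U : 'M[R]_4 := \matrix_(i, j)
  (if (i < k)%N then (i <= j < k)%N else i == j)%:R.
have -> : partial_frame E k = U *m edge_mx E.
  apply/row_matrixP => i; rewrite rowK row_mul mulmx_sum_row.
  case: ifP => ik.
    by rewrite path_edge_row//; apply: eq_bigr => j _; rewrite !mxE ik.
  rewrite (bigD1 i)//= big1 ?addr0 ?mxE ?ik ?eqxx ?scale1r ?rowK//.
  by move=> j ji; rewrite !mxE ik eq_sym (negbTE ji) scale0r.
suff U1 : \det U = 1 by rewrite det_mulmx U1 mul1r.
apply: det_upper => [i j ji|i]; rewrite mxE.
  case: ifP => _; first by rewrite leqNgt ji.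
  by rewrite -val_eqE/= gtn_eqF.
by case: ifP => ik; rewrite ?leqnn ?ik ?eqxx.
Qed.

Lemma frame_mxE E : frame_mx (frame E 3) (E 3) = partial_frame E 3.
Proof.
apply/matrixP => i j; rewrite !mxE; case: eqP => [->//|/eqP i3].
by rewrite ifT//; move: i3; rewrite -val_eqE ltn_neqAle -ltnS ltn_ord andbT.
Qed.

Let gram_out k (a : 'I_4 -> 'cV[R]_4) (v : 'rV[R]_4) (j : 'I_4) : (k <= j)%N ->
  (v *m gram k a) ord0 j = v ord0 j.
Proof.
move=> kj; rewrite mxE (bigD1 j)//= big1 ?addr0.
  by rewrite mxE ltnNge kj/= eqxx mulr1.
by move=> i ij; rewrite mxE (ltnNge j) kj andbF (negbTE ij) mulr0.
Qed.

Lemma det_gram_gt0 k (a : 'I_4 -> 'cV[R]_4) (N : 'M[R]_4) : (k <= 4)%N ->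
  (forall i : 'I_4, (i < k)%N -> row i N = (a i)^T) -> \det N != 0 ->
  0 < \det (gram k a).
Proof.
move=> k4 Na N0; have [B [Ba BE]] := frame_exists a k4.
rewrite (det_gram_frame BE) exprn_even_gt0//; apply: contraNN N0.
move=> /det0P[v v0 vB]; apply/det0P; exists v => //.
have v_out (j : 'I_4) : (k <= j)%N -> v ord0 j = 0.
  by move=> kj; rewrite -(@gram_out k a)// -BE mulmxA vB mul0mx mxE.
rewrite -[RHS]vB !mulmx_sum_row; apply: eq_bigr => i _.
by case: (ltnP i k) => ik; [rewrite Na ?Ba|rewrite v_out ?scale0r].
Qed.

(** If the height vanished, the vector would be a combination of the frame,
    giving a left kernel vector of N. *)
Lemma height_gt0 k (a : 'I_4 -> 'cV[R]_4) (N : 'M[R]_4) (w : space4 R)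
    (y : space4 R) (m : 'I_4) : m = k :> nat ->
  (forall i : 'I_4, (i < k)%N -> row i N = (a i)^T) ->
  row m N = (vec4 w)^T -> \det N != 0 ->
  (forall i : 'I_4, vec4 y i ord0 = if (i < k)%N then dotp (a i) (vec4 w) else 0) ->
  0 < dotp (vec4 w) (vec4 w) - quad (invmx (gram k a)) y.
Proof.
move=> mk Na Nw N0 yE; have k4 : (k <= 4)%N by rewrite -mk ltnW.
have G0 := det_gram_gt0 k4 Na N0; have [B [Ba BE]] := frame_exists a k4.
have -> : y = trunc k (lin4 B w).
  apply: (can_inj (@vec4K R)); apply/matrixP => i j; rewrite (ord1 j) yE.
  rewrite /trunc unvec4K [RHS]mxE; case: ifP => // ik.
  rewrite /lin4 unvec4K mxE; apply: eq_bigr => t _.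
  by have /matrixP/(_ ord0 t) := Ba _ ik; rewrite !mxE => ->.
rewrite (frame_pythagoras _ BE) ?gt_eqF// addrAC subrr add0r lt_neqAle eq_sym.
rewrite sumr_ge0 ?andbT; last by move=> i _; case: ifP; rewrite ?sqr_ge0.
apply: contraNN N0; rewrite psumr_eq0; last first.
  by move=> i _; case: ifP; rewrite ?sqr_ge0.
move=> /allP z0; have {}z0 (i : 'I_4) : (k <= i)%N -> (B *m vec4 w) i ord0 = 0.
  move=> ki; have := z0 i (mem_index_enum i).
  by rewrite ltnNge ki/= /lin4 unvec4K sqrf_eq0 => /eqP.
set G := gram k a in G0 BE; have GU : G \in unitmx by rewrite unitmxE unitfE gt_eqF.
have BMB : B^T *m invmx G *m B = 1%:M by apply: mulmx1C; rewrite mulmxA BE mulmxV.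
pose u : 'rV[R]_4 := (B *m vec4 w)^T *m invmx G.
have uG : u *m G = (B *m vec4 w)^T by rewrite -mulmxA mulVmx ?mulmx1.
have u_out (j : 'I_4) : (k <= j)%N -> u ord0 j = 0.
  by move=> kj; rewrite -(@gram_out k a)// -/G uG mxE z0.
have uB : u *m B = (vec4 w)^T.
  by rewrite /u trmx_mul -!mulmxA (mulmxA B^T) BMB mulmx1.
apply/det0P; exists (u - delta_mx ord0 m).
  apply/eqP => /matrixP/(_ ord0 m)/eqP; clearbody u.
  by rewrite !mxE !eqxx u_out ?mk// sub0r oppr_eq0 oner_eq0.
rewrite mulmxBl -rowE Nw -uB; apply/eqP; rewrite subr_eq0; apply/eqP.
rewrite !mulmx_sum_row; apply: eq_bigr => i _.
by case: (ltnP i k) => ik; [rewrite Na ?Ba|rewrite u_out ?scale0r].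
Qed.

Lemma sq_frame L E k : (k <= 4)%N ->
  (forall i j, (i < j <= k)%N ->
     dotp (path_edge E i j) (path_edge E i j) = sq L i j) ->
  length_gram k L = gram k (frame E k).
Proof.
move=> k4 EL; have sqC i j : sq L i j = sq L j i.
  by rewrite /sq; case: (ltngtP i j) => // ->; rewrite ltnn.
have sqE i j : (i <= j <= k)%N -> sq L i j = dotp (path_edge E i j) (path_edge E i j).
  move=> /andP[]; rewrite leq_eqVlt => /predU1P[->|ij jk].
    by rewrite /sq ltnn path_edge0 dotp0l.
  by rewrite EL// ij.
apply/matrixP => i j; rewrite !mxE; case: andP => // -[ik jk].
wlog ij : i j ik jk / (i <= j)%N.
  move=> W; have [/W->//|/ltnW/W WW] := leqP i j.
  by rewrite dotpC -WW// (sqC j i) [sq _ i k + _]addrC.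
rewrite !sqE ?ij ?(ltnW ik) ?(ltnW jk) ?leqnn// /frame.
rewrite (@path_edgeD _ E i j k) ?ij ?(ltnW jk)//.
rewrite !dotpDl !dotpDr (dotpC (path_edge E j k)); by field.
Qed.

End DensityProduct.
(** * Determinants of size 4 *)

Section DetFour.
Variable F : comPzRingType.

Definition det4 (a : nat -> nat -> F) : F :=
  let minor i j k l := a 0%N i * (a 1%N j * (a 2%N k * a 3%N l - a 2%N l * a 3%N k)
    - a 1%N k * (a 2%N j * a 3%N l - a 2%N l * a 3%N j)
    + a 1%N l * (a 2%N j * a 3%N k - a 2%N k * a 3%N j)) in
  minor 0 1 2 3 - minor 1 0 2 3 + minor 2 0 1 3 - minor 3 0 1 2.

Lemma det4E (A : 'M[F]_4) (a : nat -> nat -> F) :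
  (forall i j : 'I_4, A i j = a i j) -> \det A = det4 a.
Proof.
move=> Aa; have -> : A = \matrix_(i, j) a i j by apply/matrixP => i j; rewrite mxE.
rewrite (expand_det_row _ ord0) !big_ord_recl big_ord0 /cofactor.
rewrite !(expand_det_row _ ord0) !big_ord_recl !big_ord0 /cofactor.
rewrite !(expand_det_row _ ord0) !big_ord_recl !big_ord0 /cofactor.
rewrite !det_mx11 !mxE /= /bump /= /det4; ring.
Qed.

End DetFour.
(** * The product of the densities *)

Section LengthsAtPoint.
Variable R : realType.
Variables (L : 'M[R]_5) (E : nat -> 'cV[R]_4).
Hypothesis EL : forall i j, (i < j <= 4)%N ->
  dotp (path_edge E i j) (path_edge E i j) = sq L i j.
Hypothesis E0 : \det (edge_mx E) != 0.

Let gramE k : (k <= 4)%N -> length_gram k L = gram k (frame E k).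
Proof.
move=> k4; apply: sq_frame => // i j /andP[ij jk]; apply: EL.
by rewrite ij (leq_trans jk).
Qed.

Let frame_row k (i : 'I_4) : (i < k)%N -> row i (partial_frame E k) = (frame E k i)^T.
Proof. by move=> ik; rewrite rowK ik. Qed.

Lemma det_length_gram_gt0 k : (k <= 4)%N -> 0 < \det (length_gram k L).
Proof.
move=> k4; rewrite gramE//; apply: (det_gram_gt0 k4 (@frame_row k)).
by rewrite det_partial_frame.
Qed.

Let y k : space4 R :=
  unvec4 (\col_i if (i < k)%N then dotp (frame E k i) (E k) else 0).

Let heightE k : (k < 4)%N -> length_height k L =
  dotp (E k) (E k) - quad (invmx (gram k (frame E k))) (y k).
Proof.
move=> k4; have k4' := ltnW k4; rewrite (@length_heightE _ _ _ (y k)).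
- by rewrite gramE// -EL ?ltnSn// path_edgeS.
- by rewrite gt_eqF// det_length_gram_gt0.
- move=> i; rewrite unvec4K mxE /length_dot; case: ifP => // ik.
  have i_k := ltnW ik; rewrite -!EL ?ik ?ltnSn ?ltnS ?i_k//.
  rewrite (@path_edgeD _ E i k k.+1) ?i_k ?leqnSn// path_edgeS.
  by rewrite !dotpDl !dotpDr (dotpC (E k)) /frame; field.
Qed.

Lemma length_height_gt0 k : (k < 4)%N -> 0 < length_height k L.
Proof.
move=> k4; rewrite heightE// -[E k]unvec4K.
apply: (@height_gt0 _ k _ (partial_frame E k) _ _ (Ordinal k4)) => //.
- exact: frame_row.
- by rewrite rowK ltnn unvec4K.
- by rewrite det_partial_frame// ltnW.
- by move=> i; rewrite !unvec4K mxE.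
Qed.

Let height0 : length_height 0 L = sq L 0 1.
Proof.
rewrite /length_height [X in _ - _ * X]big1 ?mulr0 ?subr0// => j _.
by rewrite big1 ?mul0r// => i _; rewrite /length_dot mul0r.
Qed.

Let det_gram01 : \det (length_gram 0 L) = 1 /\ \det (length_gram 1 L) = sq L 0 1.
Proof.
have g0 : length_gram 0 L = 1%:M by apply/matrixP => i j; rewrite !mxE.
split; first by rewrite g0 det1.
rewrite (@det4E _ _ (fun i j => if (i < 1)%N && (j < 1)%N
  then (sq L i 1 + sq L j 1 - sq L i j) / 2 else (i == j)%:R)).
  by rewrite /det4/= {3}/sq/=; field.
by move=> i j; rewrite mxE.
Qed.

Let det_gram2 :
  \det (length_gram 2 L) = \det (length_gram 1 L) * length_height 1 L.
Proof.
have G1 := det_length_gram_gt0 (isT : (1 <= 4)%N).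
rewrite /length_height mulrBr mulrA divff ?gt_eqF// mul1r.
rewrite !sum_ord4 /length_dot/= !mul0r !mulr0 !addr0.
have -> : \adj (length_gram 1 L) o0 o0 = 1.
  rewrite mxE /cofactor expr0 mul1r (_ : row' _ _ = 1%:M) ?det1//.
  by apply/matrixP => i j; rewrite !mxE.
rewrite det_gram01.2 (@det4E _ _ (fun i j => if (i < 2)%N && (j < 2)%N
  then (sq L i 2 + sq L j 2 - sq L i j) / 2 else (i == j)%:R)).
  by rewrite /det4/= /sq/=; field.
by move=> i j; rewrite mxE.
Qed.

Let det_gram4 : \det (edge_mx E) ^+ 2 = \det (length_gram 3 L) * length_height 3 L.
Proof.
have [B [Ba BE]] := frame_exists (frame E 3) (isT : (3 <= 4)%N).
have G3 := det_length_gram_gt0 (isT : (3 <= 4)%N).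
have := det_frame (E 3) Ba BE; rewrite frame_mxE det_partial_frame// => D.
rewrite heightE// -[in dotp _ _](unvec4K (E 3)).
rewrite (frame_pythagoras (unvec4 (E 3)) BE); last by rewrite -gramE// gt_eqF.
have -> : trunc 3 (lin4 B (unvec4 (E 3))) = y 3.
  rewrite /trunc /y; congr unvec4; apply/matrixP => i j; rewrite [LHS]mxE [RHS]mxE.
  case: ifP => // i3; rewrite /lin4 !unvec4K [LHS]mxE; apply: eq_bigr => t _.
  by have /matrixP/(_ ord0 t) := Ba _ i3; rewrite !mxE => ->.
rewrite addrAC subrr add0r sum_ord4/= !add0r /lin4 !unvec4K gramE//.
apply: (mulfI (lt0r_neq0 G3)); rewrite gramE// {1}(det_gram_frame BE) -exprMn.
by rewrite [\det B * _]mulrC D; ring.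
Qed.

(** The Gram determinants telescope, and only the total volume survives. *)
Lemma prod_length_density :
  \prod_(k < 4) length_density k L = pi ^+ 4 / `|\det (edge_mx E)|.
Proof.
have h k := length_height_gt0 (k := k).
rewrite prod_ord4 /length_density/=.
rewrite -[`|_|]sqrtr_sqr det_gram4 det_gram2 det_gram01.2 det_gram01.1 -height0.
rewrite !sqrtrM ?mulr_ge0 ?ltW ?h ?det_length_gram_gt0// sqrtr1.
have s k : (k < 4)%N -> Num.sqrt (length_height k L) != 0.
  by move=> k4; rewrite gt_eqF// sqrtr_gt0 h.
have s3 : Num.sqrt (\det (length_gram 3 L)) != 0.
  by rewrite gt_eqF// sqrtr_gt0 det_length_gram_gt0.
rewrite -{1}(sqr_sqrtr (ltW (h 0%N isT))).
by field; rewrite s3 !s.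
Qed.

End LengthsAtPoint.
(** * The volume as a function of the edge lengths *)

Section EdgeGram.
Variable R : realType.
Implicit Types (L : 'M[R]_5) (E : nat -> 'cV[R]_4) (p : pentagon R).

Lemma edge_pentagon p (i j : 'I_5) : (i <= j)%N ->
  edge (pentagon_simplex p) i j = path_edge (pentagon_edge p) i j.
Proof.
move=> ij; have simplexE (k : 'I_5) :
    pentagon_simplex p k = path_edge (pentagon_edge p) 0 k.
  by rewrite /path_edge big_mkord.
by rewrite /edge !simplexE (@path_edgeD _ _ 0 i j)// addrAC subrr add0r.
Qed.

(** The Gram matrix of consecutive edges, by polarization. *)
Definition edge_gram L : 'M[R]_4 := \matrix_(i, j)
  ((sq L i j.+1 - sq L i j - sq L i.+1 j.+1 + sq L i.+1 j) / 2).

Lemma sqC L i j : sq L i j = sq L j i.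
Proof. by rewrite /sq; case: (ltngtP i j) => // ->; rewrite ltnn. Qed.

Lemma edge_gramE L E :
  (forall i j, (i < j <= 4)%N ->
    dotp (path_edge E i j) (path_edge E i j) = sq L i j) ->
  edge_gram L = edge_mx E *m (edge_mx E)^T.
Proof.
move=> EL.
have sqE i j : (i <= j <= 4)%N -> sq L i j = dotp (path_edge E i j) (path_edge E i j).
  move=> /andP[]; rewrite leq_eqVlt => /predU1P[->|ij j4].
    by rewrite /sq ltnn path_edge0 dotp0l.
  by rewrite EL// ij.
have gE (i j : nat) : (i <= j < 4)%N ->
  (sq L i j.+1 - sq L i j - sq L i.+1 j.+1 + sq L i.+1 j) / 2 = dotp (E i) (E j).
  move=> /andP[]; rewrite leq_eqVlt => /predU1P[<-|ij] j4.
    rewrite (sqC _ i.+1 i) !sqE ?leqnn ?leqnSn ?(ltnW j4)//.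
    by rewrite !path_edge0 path_edgeS !dotp0l; field.
  rewrite !sqE ?ij ?ltnS ?(ltnW ij) ?(ltnW j4) ?(leqW (ltnW ij))//.
  rewrite (@path_edgeD _ E i i.+1 j.+1) ?leqnSn ?ltnS ?(ltnW ij)//.
  rewrite (@path_edgeD _ E i i.+1 j) ?leqnSn ?ltnS ?ij//.
  rewrite (@path_edgeD _ E i.+1 j j.+1) ?ij ?leqnSn// !path_edgeS.
  by rewrite !dotpDl !dotpDr (dotpC (path_edge E _ _) (E i)) (dotpC (E j)); field.
apply/matrixP => i j; rewrite !mxE.
transitivity (dotp (E i) (E j)); last first.
  by apply: eq_bigr => t _; rewrite !mxE.
have [ij|/ltnW ji] := leqP i j; first by rewrite gE// ij ltn_ord.
rewrite dotpC -gE ?ji ?ltn_ord// (sqC _ j.+1 i) (sqC _ j i) (sqC _ j.+1 i.+1).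
by rewrite (sqC _ j i.+1); congr (_ / _); ring.
Qed.

Lemma det_edge_gram L E :
  (forall i j, (i < j <= 4)%N ->
    dotp (path_edge E i j) (path_edge E i j) = sq L i j) ->
  \det (edge_gram L) = \det (edge_mx E) ^+ 2.
Proof. by move=> /edge_gramE->; rewrite det_mulmx det_tr expr2. Qed.

Lemma near_det_edge_gram L (dlt : R) : 0 < dlt -> exists2 e : R, 0 < e &
  forall q : 'M[R]_5, (forall i j : 'I_5, `|q i j - L i j| < e) ->
    `|\det (edge_gram q) - \det (edge_gram L)| < dlt.
Proof.
move=> d0; have gen (T : topologicalType) (t0 : T) (Q : T -> 'M[R]_5) :
    (forall i j, (fun t => Q t i j) @ t0 --> Q t0 i j) ->
    (fun t => \det (edge_gram (Q t))) @ t0 --> \det (edge_gram (Q t0)).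
  move=> cQ; apply: cvg_det => i j.
  have c_sq k l : (fun t => sq (Q t) k l) @ t0 --> sq (Q t0) k l.
    rewrite /sq; case: (k < l)%N; first exact: cQ.
    by case: (l < k)%N; [exact: cQ|exact: cvg_cst].
  rewrite (_ : (fun t => _) = fun t => (sq (Q t) i j.+1 - sq (Q t) i j -
    sq (Q t) i.+1 j.+1 + sq (Q t) i.+1 j) / 2); last first.
    by apply/funext => t; rewrite mxE.
  rewrite mxE; apply: cvgM; last exact: cvg_cst.
  by apply: cvgD => //; do 2 (apply: cvgB => //).
have /cvgrPdist_lt/(_ _ d0)/nbhs_ballP[e e0 qe] := gen _ L idfun
  (fun i j => @coord_continuous R 5 5 i j L).
exists e => // q qL; rewrite distrC; apply: qe.
by split=> // i j; rewrite /ball/= distrC; exact: qL.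
Qed.

(** Regularized 4-simplices are as far from being degenerate as the given one. *)
Lemma near_det_edges L (v : R) : v < \det (edge_gram L) -> exists2 e : R, 0 < e &
  forall E, near_lengths L e 4 E -> v < \det (edge_mx E) ^+ 2.
Proof.
rewrite -subr_gt0 => v0; have [e e0 He] := near_det_edge_gram L v0; exists e => // E nE.
pose q : 'M[R]_5 := \matrix_(i, j)
  if (i < j)%N then dotp (path_edge E i j) (path_edge E i j) else L i j.
rewrite -(@det_edge_gram q) => [|i j /andP[ij j4]].
  have := He q; rewrite ltr_distl => /(_ _)/andP[|//].
    move=> i j; rewrite mxE; case: ifP => ij; last by rewrite subrr normr0.
    by have := nE i j; rewrite ij -ltnS ltn_ord /sq ij !inord_val; exact.
  by rewrite opprB addrC subrK.
by rewrite /sq ij mxE !inordK ?ij// (ltn_trans ij).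
Qed.

End EdgeGram.
(** * Test functions *)

Section TestFunction.
Variable R : realType.
Implicit Types (L : 'M[R]_5) (p : pentagon R) (dlt sg v : R).

Definition clamp (x : R) : R := Num.max 0 (Num.min 1 x).

Lemma clamp_bounds x : 0 <= clamp x <= 1.
Proof. by rewrite /clamp le_max lexx/= ge_max ler01 ge_min lexx. Qed.

Lemma clamp_ge1 x : 1 <= x -> clamp x = 1.
Proof. by move=> x1; rewrite /clamp min_l// max_r ?ler01. Qed.

Lemma clamp_le0 x : x <= 0 -> clamp x = 0.
Proof. by move=> x0; rewrite /clamp max_l// ge_min x0 orbT. Qed.

Lemma continuous_clamp : continuous clamp.
Proof.
move=> x; apply: (@continuous_max R R (cst 0) (fun x => Num.min 1 x)).
  exact: cvg_cst.
by apply: (@continuous_min R R (cst 1) idfun); [exact: cvg_cst|exact: cvg_id].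
Qed.

Definition sqlen p (i j : nat) : R :=
  dotp (path_edge (pentagon_edge p) i j) (path_edge (pentagon_edge p) i j).

Definition deviation L p : R :=
  \sum_(i < 5) \sum_(j < 5 | (i < j)%N) `|sqlen p i j - sq L i j|.

Definition orientation p : R := \det (edge_mx (pentagon_edge p)).

Definition test_fun L sg v dlt p : R :=
  clamp (2 - deviation L p / dlt) * clamp (2 * (sg * orientation p) / v).

Lemma deviation_ge L p (i j : nat) : (i < j <= 4)%N ->
  `|sqlen p i j - sq L i j| <= deviation L p.
Proof.
move=> /andP[ij j4]; have i4 : (i < 5)%N by exact: ltn_trans ij _.
rewrite /deviation (bigD1 (Ordinal i4))//= (bigD1 (@Ordinal 5 j j4))//= -addrA.
by rewrite lerDl addr_ge0// ?sumr_ge0// => k _; rewrite sumr_ge0.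
Qed.

Lemma deviation_le L p e : 0 <= e ->
  (forall i j, (i < j <= 4)%N -> `|sqlen p i j - sq L i j| <= e) ->
  deviation L p <= 25 * e.
Proof.
move=> e0 pe; rewrite /deviation.
apply: (@le_trans _ _ (\sum_(i < 5) \sum_(j < 5) e)); last first.
  by rewrite !sumr_const !card_ord -!mulrnA mulr_natl.
apply: ler_sum => i _; rewrite [leRHS](bigID (fun j : 'I_5 => (i < j)%N))/=.
apply: (@le_trans _ _ (\sum_(j < 5 | (i < j)%N) e)).
  by apply: ler_sum => j ij; apply: pe; rewrite ij -ltnS ltn_ord.
by rewrite lerDl sumr_ge0.
Qed.

Lemma continuous_coord k i (p : pentagon R) :
  (fun p => pentagon_edge p k i ord0) @ p --> pentagon_edge p k i ord0.
Proof.
have c4 (f : pentagon R -> space4 R) : continuous f ->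
    (fun p => vec4 (f p) i ord0) @ p --> vec4 (f p) i ord0.
  move=> cf; rewrite (_ : (fun p => _) = (fun z : space4 R =>
     [:: z.1.1.1; z.1.1.2; z.1.2; z.2]`_i) \o f); last first.
    by apply/funext => q /=; rewrite mxE.
  rewrite [X in _ --> X](mxE _ (fun i j => [:: (f p).1.1.1; (f p).1.1.2; (f p).1.2; (f p).2]`_i)).
  apply: (@cvg_comp _ _ _ f _ _ (nbhs (f p)) _ (cf p)).
  move: i; apply: ord4P => /=; last exact: cvg_snd.
  - apply: (@cvg_comp _ _ _ (fun z : space4 R => z.1.1) fst _ (nbhs (f p).1.1));
      last exact: cvg_fst.
    by apply: (@cvg_comp _ _ _ (fun z : space4 R => z.1) fst _ (nbhs (f p).1)); exact: cvg_fst.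
  - apply: (@cvg_comp _ _ _ (fun z : space4 R => z.1.1) snd _ (nbhs (f p).1.1));
      last exact: cvg_snd.
    by apply: (@cvg_comp _ _ _ (fun z : space4 R => z.1) fst _ (nbhs (f p).1)); exact: cvg_fst.
  - by apply: (@cvg_comp _ _ _ (fun z : space4 R => z.1) snd _ (nbhs (f p).1));
      [exact: cvg_fst|exact: cvg_snd].
rewrite /pentagon_edge; case: k => [|[|[|k]]] /=; apply: c4 => {}p.
- apply: (@cvg_comp _ _ _ (fun z : pentagon R => z.1.1) fst _ (nbhs p.1.1));
      last exact: cvg_fst.
  by apply: (@cvg_comp _ _ _ (fun z : pentagon R => z.1) fst _ (nbhs p.1)); exact: cvg_fst.
- apply: (@cvg_comp _ _ _ (fun z : pentagon R => z.1.1) snd _ (nbhs p.1.1));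
      last exact: cvg_snd.
  by apply: (@cvg_comp _ _ _ (fun z : pentagon R => z.1) fst _ (nbhs p.1)); exact: cvg_fst.
- by apply: (@cvg_comp _ _ _ (fun z : pentagon R => z.1) snd _ (nbhs p.1));
      [exact: cvg_fst|exact: cvg_snd].
- by case: k => [|[|k]] /=; exact: cvg_snd.
Qed.

Let cont_path i j a (p : pentagon R) :
  (fun p => path_edge (pentagon_edge p) i j a ord0) @ p -->
  path_edge (pentagon_edge p) i j a ord0.
Proof.
rewrite (_ : (fun p => _) = fun p => \sum_(i <= k < j) pentagon_edge p k a ord0).
  rewrite summxE; apply: (@cvg_big_sum R _ p _ _ _
    (fun k p => pentagon_edge p k a ord0)) => k; exact: continuous_coord.
by apply/funext => q; rewrite summxE.
Qed.

Lemma continuous_sqlen i j (p : pentagon R) :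
  (fun p => sqlen p i j) @ p --> sqlen p i j.
Proof.
apply: (@cvg_big_sum R _ p _ _ _ (fun a p =>
  path_edge (pentagon_edge p) i j a ord0 *
  path_edge (pentagon_edge p) i j a ord0)) => a.
by apply: cvgM; exact: cont_path.
Qed.

Lemma continuous_orientation (p : pentagon R) : orientation @ p --> orientation p.
Proof.
apply: cvg_det => i j.
have entryE (q : pentagon R) : edge_mx (pentagon_edge q) i j = pentagon_edge q i j ord0.
  by rewrite mxE [LHS]mxE.
by rewrite entryE (funext entryE); exact: continuous_coord.
Qed.

Lemma continuous_test_fun L sg v dlt : continuous (test_fun L sg v dlt).
Proof.
have c_clamp (f : pentagon R -> R) p : f @ p --> f p ->
    (fun p => clamp (f p)) @ p --> clamp (f p).
  by move=> cf; apply: (continuous_cvg _ (@continuous_clamp (f p)) cf).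
move=> p; apply: cvgM; apply: c_clamp.
  apply: cvgB; first exact: cvg_cst.
  apply: cvgM; last exact: cvg_cst.
  apply: (@cvg_big_sum R _ p _ _ _ (fun (i : 'I_5) p =>
    \sum_(j < 5 | (i < j)%N) `|sqlen p i j - sq L i j|)) => i.
  apply: (@cvg_big_sum R _ p _ _ _ (fun (j : 'I_5) p => `|sqlen p i j - sq L i j|)) => j.
  apply: cvg_norm; apply: cvgB; [exact: continuous_sqlen|exact: cvg_cst].
apply: cvgM; last exact: cvg_cst.
apply: cvgM; first exact: cvg_cst.
by apply: cvgM; [exact: cvg_cst|exact: continuous_orientation].
Qed.

Lemma test_fun_neq0 L sg v dlt p : 0 < dlt -> test_fun L sg v dlt p != 0 ->
  deviation L p < 2 * dlt.
Proof.
move=> d0; apply: contraNT; rewrite -leNgt => Sd.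
by rewrite /test_fun clamp_le0 ?mul0r// subr_le0 ler_pdivlMr.
Qed.

Definition box (M : R) : set (space4 R) :=
  `[- M, M]%classic `*` `[- M, M]%classic `*` `[- M, M]%classic `*` `[- M, M]%classic.

Lemma compact_support L sg v dlt : 0 < dlt ->
  exists2 C : set (pentagon R), compact C &
  forall p, ~ C p -> test_fun L sg v dlt p = 0.
Proof.
move=> d0; pose M : R := 1 + \sum_(k < 4) (`|sq L k k.+1| + 2 * dlt).
exists (box M `*` box M `*` box M `*` box M).
  by do !apply: compact_setX; exact: segment_compact.
move=> p; apply: contra_notP => /eqP/(test_fun_neq0 d0) Sd.
suff coord (k i : 'I_4) : `|pentagon_edge p k i ord0| <= M.
  have bx k (x : space4 R) : pentagon_edge p (k : 'I_4) = vec4 x -> box M x.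
    move=> xE; have c := coord k; rewrite xE in c.
    have [] := (c o0, c o1, c o2, c o3); rewrite !mxE/= => -[[c0 c1] c2] c3.
    by rewrite /box/= !in_itv/= -!ler_norml.
  by split; [split; [split|]|]; [apply: (bx o0)|apply: (bx o1)|apply: (bx o2)|apply: (bx o3)].
have : `|sqlen p k k.+1 - sq L k k.+1| < 2 * dlt.
  by apply: le_lt_trans Sd; apply: deviation_ge; rewrite ltnSn ltn_ord.
rewrite /sqlen path_edgeS ltr_distl => /andP[_ hi].
have x2 : (pentagon_edge p k i ord0) ^+ 2 <= M.
  apply: (@le_trans _ _ (dotp (pentagon_edge p k) (pentagon_edge p k))).
    rewrite /dotp (bigD1 i)//= -expr2 lerDl sumr_ge0// => t _.
    by rewrite -expr2 sqr_ge0.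
  apply: (le_trans (ltW hi)); rewrite /M (bigD1 k)//= addrCA -[leLHS]addr0; apply: lerD.
    by rewrite lerD2r ler_norm.
  by rewrite addr_ge0// sumr_ge0// => t _; rewrite addr_ge0// mulr_ge0// ltW.
have M1 : 1 <= M.
  by rewrite /M lerDl sumr_ge0// => t _; rewrite addr_ge0// mulr_ge0// ltW.
rewrite -real_normK ?num_real// in x2.
have [|x1] := leP `|pentagon_edge p k i ord0| 1; first by move=> /le_trans; exact.
by apply: le_trans x2; rewrite expr2 ler_peMl// ltW.
Qed.

End TestFunction.
(** * The mass of each orientation *)

Section VertexEdges.
Variable R : realType.
Implicit Types (p : 'I_5 -> 'cV[R]_4) (l : 'I_5 -> 'I_5 -> R).

Definition vertex_edges p (k : nat) : 'cV[R]_4 := p (inord k.+1) - p (inord k).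

Definition sqlen_mx l : 'M[R]_5 := \matrix_(i, j) l i j ^+ 2.

Lemma path_vertex_edges p i j : (i <= j <= 4)%N ->
  path_edge (vertex_edges p) i j = p (inord j) - p (inord i).
Proof.
move=> /andP[ij j4]; rewrite /path_edge; elim: j ij j4 => [|j IH].
  by rewrite leqn0 => /eqP->; rewrite big_geq// subrr.
rewrite leq_eqVlt => /predU1P[->|ij] j4; first by rewrite big_geq// subrr.
by rewrite big_nat_recr//= IH// ?(ltnW j4)// /vertex_edges addrC addrA subrK.
Qed.

Lemma sq_sqlen_mx l (i j : 'I_5) : (i < j)%N -> sq (sqlen_mx l) i j = l i j ^+ 2.
Proof. by move=> ij; rewrite /sq ij !inord_val mxE. Qed.

Lemma realizes_sqlen l p : realizes l p -> forall i j, (i < j <= 4)%N ->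
  dotp (path_edge (vertex_edges p) i j) (path_edge (vertex_edges p) i j) =
  sq (sqlen_mx l) i j.
Proof.
move=> pl i j /andP[ij j4]; have i4 : (i < 5)%N by exact: ltn_trans ij _.
rewrite path_vertex_edges ?(ltnW ij)// -enorm_sqr -(inordK i4).
have j5 : j = (inord j : 'I_5) :> nat by rewrite inordK.
rewrite [in sq _ _ j]j5 sq_sqlen_mx ?inordK//; congr (_ ^+ 2).
by rewrite -pl// !inordK.
Qed.

(** The edges from the first vertex are obtained from the consecutive edges by
    a unimodular matrix. *)
Lemma first_vertex_edges p : exists2 U : 'M[R]_4, \det U = 1 &
  \matrix_(i < 4) (edge p ord0 (lift ord0 i))^T = U *m edge_mx (vertex_edges p).
Proof.
exists (\matrix_(i, j) (j <= i)%N%:R).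
  rewrite -det_tr; apply: det_upper => [i j ji|i]; rewrite !mxE ?leqnn//.
  by rewrite leqNgt ji.
apply/row_matrixP => i; rewrite rowK row_mul mulmx_sum_row.
have -> : edge p ord0 (lift ord0 i) = path_edge (vertex_edges p) 0 i.+1.
  rewrite path_vertex_edges ?ltn_ord// /edge; congr (p _ - p _); apply: val_inj.
    by rewrite /= inordK// ltnS.
  by rewrite /= inordK.
by rewrite path_edge_row ?ltn_ord//; apply: eq_bigr => j _; rewrite !mxE ltnS.
Qed.

Lemma nondegenerate_det p : Defs.nondegenerate p -> \det (edge_mx (vertex_edges p)) != 0.
Proof.
rewrite /Defs.nondegenerate; have [U U1 UE] := first_vertex_edges p => p_free.
have : row_free (U *m edge_mx (vertex_edges p)) by rewrite -UE; exact: p_free.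
by rewrite row_free_unit unitmx_mul => /andP[_]; rewrite unitmxE unitfE.
Qed.

End VertexEdges.

Section MassOfSimplices.
Variable R : realType.
Variables (l : 'I_5 -> 'I_5 -> R) (mu : {measure set (pentagon R) -> \bar R}).
Hypothesis Hmu : is_P_l_measure l mu.
Hypothesis Hl : simplex_lengths l.

Let L := sqlen_mx l.

Lemma sqlen_enorm (p : pentagon R) (i j : 'I_5) : (i < j)%N ->
  enorm (edge (pentagon_simplex p) i j) ^+ 2 = sqlen p i j.
Proof. by move=> ij; rewrite enorm_sqr edge_pentagon// ltnW. Qed.

Let l_ge0 (i j : 'I_5) : (i < j)%N -> 0 <= l i j.
Proof. by move=> ij; have [p [_ pl]] := Hl; rewrite -pl// sqrtr_ge0. Qed.

Let sqLE := @sq_sqlen_mx R l.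

Lemma P_lE (p : pentagon R) : P_l l p <-> deviation L p = 0.
Proof.
split=> [pl|d0].
  rewrite /deviation big1// => i _; rewrite big1// => j ij.
  by rewrite sqLE// -pl// sqlen_enorm// subrr normr0.
move=> i j ij; apply/eqP; rewrite -(@eqrXn2 _ 2)// ?sqrtr_ge0 ?l_ge0//.
rewrite sqlen_enorm// -sqLE// -subr_eq0 -normr_le0 -d0.
by apply: deviation_ge; rewrite ij -ltnS ltn_ord.
Qed.

Let measurable_dev : measurable_fun setT (deviation L).
Proof.
apply: measurable_sum => i; rewrite /index_enum; under eq_fun do rewrite big_mkcond.
apply: measurable_sum => j; case: (i < j)%N => //.
apply: measurableT_comp => //; apply: measurable_funB => //.
by apply: measurable_sqlength => k a; exact: measurable_pentagon_edge.
Qed.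

Let measurable_or : measurable_fun setT (@orientation R).
Proof.
rewrite (_ : @orientation R = fun p =>
  \det (frame_mx (frame (pentagon_edge p) 3) (pentagon_edge p 3))).
  by apply: measurable_orientation => k i; exact: measurable_pentagon_edge.
by apply/funext => p; rewrite frame_mxE det_partial_frame.
Qed.

Lemma measurable_deviation d : measurable [set p | deviation L p <= d].
Proof.
rewrite (_ : [set p | _] = deviation L @^-1` `]-oo, d]%classic).
  exact: measurable_preimageT.
by apply/seteqP; split=> p /=; rewrite in_itv.
Qed.

Lemma measurable_P_l : measurable (P_l l).
Proof.
rewrite (_ : P_l l = [set p | deviation L p <= 0]); first exact: measurable_deviation.
apply/seteqP; split=> p /=; first by move=> /P_lE ->.
move=> d0; apply/P_lE/eqP; rewrite eq_le d0.
by apply: sumr_ge0 => i _; apply: sumr_ge0.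
Qed.

Lemma measurable_oriented sg : measurable [set p : pentagon R | 0 < sg * orientation p].
Proof.
rewrite (_ : [set p | _] = (fun p => sg * orientation p) @^-1` `]0, +oo[%classic).
  by apply: measurable_preimageT => //; exact: measurable_funM.
by apply/seteqP; split=> p /=; rewrite in_itv/= andbT.
Qed.

(** The common value of the absolute determinant of all realizations. *)
Definition length_volume : R := Num.sqrt (\det (edge_gram L)).

Lemma realized : exists E : nat -> 'cV[R]_4, \det (edge_mx E) != 0 /\
  forall i j, (i < j <= 4)%N -> dotp (path_edge E i j) (path_edge E i j) = sq L i j.
Proof.
have [p [p_free pl]] := Hl; exists (vertex_edges p); split.
  exact: nondegenerate_det.
exact: realizes_sqlen.
Qed.

Lemma length_volume_gt0 : 0 < length_volume.
Proof.
have [E [E0 EL]] := realized.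
by rewrite /length_volume (det_edge_gram EL) sqrtr_sqr normr_gt0.
Qed.

Lemma sqr_orientation E :
  (forall i j, (i < j <= 4)%N -> dotp (path_edge E i j) (path_edge E i j) = sq L i j) ->
  `|\det (edge_mx E)| = length_volume.
Proof. by move=> EL; rewrite /length_volume (det_edge_gram EL) sqrtr_sqr. Qed.

Let V := length_volume.

Let deltaE (eps : R) (p : pentagon R) : 0 < eps ->
  \prod_(i < 5) \prod_(j < 5 | (i < j)%N)
    delta_approx eps (enorm (edge (pentagon_simplex p) i j) ^+ 2 - l i j ^+ 2) =
  (2 * eps)^-1 ^+ 10 * \1_[set p | near_lengths L eps 4 (pentagon_edge p)] p.
Proof.
move=> e0; rewrite indicE; case: (boolP (p \in _)) => [|np].
  rewrite inE/= => nE; rewrite mulr1.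
  transitivity (\prod_(i < 5) \prod_(j < 5 | (i < j)%N) (2 * eps)^-1).
    apply: eq_bigr => i _; apply: eq_bigr => j ij.
    rewrite sqlen_enorm// -sqLE// /delta_approx ifT//; apply: nE.
    by rewrite ij -ltnS ltn_ord.
  under eq_bigr do rewrite big_mkcond !big_ord_recl big_ord0/=.
  by rewrite !big_ord_recl big_ord0/= !mulr1 !mul1r !exprS expr0 mulr1 !mulrA.
rewrite mulr0; apply/eqP; apply: contraNT np => prod0; rewrite inE => i j /andP[ij j4].
have i4 : (i < 5)%N by exact: ltn_trans ij _.
move: prod0; rewrite (bigD1 (Ordinal i4))//= (bigD1 (@Ordinal 5 j j4))//=.
rewrite !mulf_eq0 !negb_or => /andP[/andP[+ _] _].
rewrite sqlen_enorm// -sqLE// /delta_approx; case: ifP => [//|_].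
by rewrite eqxx.
Qed.

Let clamp_orientation (sg : R) (p : pentagon R) : `|sg| = 1 ->
  V < 2 * `|orientation p| ->
  clamp (2 * (sg * orientation p) / V) = \1_[set p | 0 < sg * orientation p] p.
Proof.
move=> sg1 Vp; have V0 : 0 < V := length_volume_gt0; rewrite indicE.
have [sp|sp] := ltP 0 (sg * orientation p).
  rewrite mem_set//; apply: clamp_ge1; rewrite ler_pdivlMr// mul1r ltW//.
  by rewrite -(ger0_norm (ltW sp)) normrM sg1 mul1r.
rewrite memNset/=; last by apply/negP; rewrite -leNgt.
apply: clamp_le0; rewrite pmulr_lle0 ?invr_gt0//.
by rewrite pmulr_rle0.
Qed.

(** Where the lengths are nearly right, the second factor of test_fun only sees
    the sign of the orientation, and the first one is 1 on the support of the
    approximate delta functions. *)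
Let regularizedE (sg dlt eps : R) (p : pentagon R) : `|sg| = 1 ->
  0 < eps -> 25 * eps <= dlt ->
  (forall p, deviation L p <= 2 * dlt -> V < 2 * `|orientation p|) ->
  test_fun L sg V dlt p * \prod_(i < 5) \prod_(j < 5 | (i < j)%N)
    delta_approx eps (enorm (edge (pentagon_simplex p) i j) ^+ 2 - l i j ^+ 2) =
  (2 * eps)^-1 ^+ 10 * \1_(tube L eps sg) p.
Proof.
move=> sg1 e0 ed far; rewrite deltaE// mulrCA; congr (_ * _).
have d0 : 0 < dlt by apply: lt_le_trans ed; rewrite mulr_gt0.
have -> : tube L eps sg = [set p | near_lengths L eps 4 (pentagon_edge p)] `&`
    [set p | 0 < sg * orientation p].
  by apply/seteqP; split=> q; rewrite /tube/= frame_mxE det_partial_frame.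
rewrite indicI/= [\1_[set p | near_lengths _ _ _ _] p]indicE mulrC.
case: (boolP (p \in _)) => [|_]; last by rewrite !mul0r.
rewrite inE !mul1r => nE; have dev_p : deviation L p <= dlt.
  by apply: le_trans ed; apply: deviation_le; [exact: ltW|move=> i j /nE/ltW].
rewrite /test_fun clamp_orientation//; last first.
  by apply: far; apply: le_trans dev_p _; rewrite ler_peMl ?ltW// ltr1n.
rewrite clamp_ge1 ?mul1r// lerBrDr -lerBrDl.
by rewrite (_ : 2 - 1 = 1)  ?ler_pdivrMr ?mul1r//; ring.
Qed.

Let density_bounds : forall k, (k < 4)%N ->
  0 < \det (length_gram k L) /\ 0 < length_height k L.
Proof.
have [E [E0 EL]] := realized => k k4; split.
  exact: (det_length_gram_gt0 EL E0 (ltnW k4)).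
exact: (length_height_gt0 EL E0 k4).
Qed.

Let density_prod : \prod_(k < 4) length_density k L = pi ^+ 4 / V.
Proof.
have [E [E0 EL]] := realized.
by rewrite (prod_length_density EL E0) (sqr_orientation EL).
Qed.

(** The approximating integrals are normalized volumes of tubes, so the limit
    is squeezed between products of perturbed densities. *)
Let test_integral (sg dlt : R) : `|sg| = 1 -> 0 < dlt ->
  (forall p, deviation L p <= 2 * dlt -> V < 2 * `|orientation p|) ->
  (\int[mu]_p (test_fun L sg V dlt p)%:E)%E = ((2 * V)^-1)%:E.
Proof.
move=> sg1 d0 far; have V0 : 0 < V := length_volume_gt0.
have pi0 := pi_gt0 R.
have := Hmu (@continuous_test_fun R L sg V dlt) (@compact_support R L sg V dlt d0).
set G := (fun eps : R => _); set I := (\int[mu]_p _)%E => GI.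
pose K : R := (kappa R * pi ^+ 5)^-1.
have K0 : 0 < K by rewrite invr_gt0 mulr_gt0 ?exprn_gt0// invr_gt0 mulr_gt0.
have C0 eps : 0 < eps -> 0 <= K * (2 * eps)^-1 ^+ 10.
  by move=> e0; rewrite ltW// mulr_gt0// exprn_gt0// invr_gt0 mulr_gt0.
pose bound (c : R) := K * (\prod_(k < 4) (length_density k L + c)) / 64.
have GE : \forall eps \near 0^'+, G eps =
    (K%:E * ((2 * eps)^-1 ^+ 10)%:E * @pentagon_lebesgue R (tube L eps sg))%E.
  near=> eps; have e0 : 0 < eps by [].
  have ed : 25 * eps <= dlt.
    rewrite mulrC -ler_pdivlMr//; near: eps; apply: nbhs_right_le.
    by rewrite divr_gt0.
  rewrite /G [X in integral _ _ X](_ : _ = fun p => ((K * (2 * eps)^-1 ^+ 10)%:E *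
      (\1_(tube L eps sg) p)%:E)%E); last first.
    apply/funext => p.
    by rewrite -mulrA (regularizedE p sg1 e0 ed far) mulrA EFinM.
  rewrite pentagon_lebesgueE ge0_integralZl//=; last 2 first.
  - by apply/measurable_EFinP; apply: measurable_indic; exact: measurable_tube.
  - by rewrite lee_fin C0.
  by rewrite integral_indic ?setIT ?EFinM//; exact: measurable_tube.
have density_gt0 k : (k < 4)%N -> 0 < length_density k L.
  move=> k4; have [G0 h0] := density_bounds k4.
  rewrite /length_density mulr_gt0 ?invr_gt0 ?sqrtr_gt0//.
  rewrite /radial_density; case: k {k4 G0} h0 => [|[|[|k]]] h0.
  - by rewrite mulr_gt0 ?exprn_gt0.
  - by rewrite !mulr_gt0 ?sqrtr_gt0.
  - by [].
  - by rewrite invr_gt0 mulr_gt0 ?sqrtr_gt0.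
have bounds : \forall c \near 0^'+, ((bound (- c))%:E <= I <= (bound c)%:E)%E.
  near=> c; have c0 : 0 < c by [].
  have small : forall k, (k < 4)%N -> 0 < c < length_density k L.
    have [s0 s1] : 0 < c < length_density 0 L /\ 0 < c < length_density 1 L.
      by split; rewrite c0/=; near: c; apply: nbhs_right_lt; exact: density_gt0.
    have [s2 s3] : 0 < c < length_density 2 L /\ 0 < c < length_density 3 L.
      by split; rewrite c0/=; near: c; apply: nbhs_right_lt; exact: density_gt0.
    by move=> [|[|[|[|]]]].
  have sg0 : sg != 0 by rewrite -normr_gt0 sg1.
  have H k : (k < 4)%N -> [/\ 0 < \det (length_gram k L),
      0 < length_height k L & 0 < c < length_density k L].
    by move=> k4; have [? ?] := density_bounds k4; split=> //; exact: small.
  have tb := tube_bounds sg0 H.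
  have GB : \forall eps \near 0^'+, ((bound (- c))%:E <= G eps <= (bound c)%:E)%E.
    near=> eps; have e0 : 0 < eps by [].
    have -> : G eps = (K%:E * ((2 * eps)^-1 ^+ 10)%:E *
      @pentagon_lebesgue R (tube L eps sg))%E by near: eps; exact: GE.
    have /andP[lo hi] : ((\prod_(k < 4) (length_density k L - c) * (16 * eps ^+ 10))%:E <=
     @pentagon_lebesgue R (tube L eps sg) <=
     (\prod_(k < 4) (length_density k L + c) * (16 * eps ^+ 10))%:E)%E.
      by near: eps; exact: tb.
    have bE x : bound x = K * (2 * eps)^-1 ^+ 10 *
        (\prod_(k < 4) (length_density k L + x) * (16 * eps ^+ 10)).
      by rewrite /bound; field; rewrite gt_eqF.
    rewrite !bE !(EFinM (K * _)) -(EFinM K).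
    by rewrite !lee_wpmul2l// lee_fin C0.
  apply/andP; split.
    by apply: cvge_to_ge GI _; apply: filterS GB => eps /andP[].
  by apply: cvge_to_le GI _; apply: filterS GB => eps /andP[].
have b0 : bound 0 = (2 * V)^-1.
  rewrite /bound; under eq_bigr do rewrite addr0.
  rewrite density_prod /K /kappa; move: (pi : R) V pi0 V0 => P W P0 W0.
  by field; rewrite !gt_eqF.
have cb (s : R) : (fun c => (bound (s * c))%:E) @ 0^'+ --> (bound 0)%:E.
  apply: cvg_EFin; first by near=> c.
  apply: cvg_at_right_filter; rewrite -{2}(mulr0 s).
  apply: cvgM; last exact: cvg_cst.
  apply: cvgM; first exact: cvg_cst.
  apply: (@cvg_big_prod R R 0 _ _ _
    (fun (k : 'I_4) c => length_density k L + s * c)) => k.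
  by apply: cvgD; [exact: cvg_cst|apply: cvgM; [exact: cvg_cst|exact: cvg_id]].
rewrite -b0; apply/eqP; rewrite eq_le; apply/andP; split.
  apply: (cvge_to_ge (cb 1)); apply: filterS bounds => c /andP[_].
  by rewrite mul1r.
apply: (cvge_to_le (cb (- 1))); apply: filterS bounds => c /andP[+ _].
by rewrite mulN1r.
Unshelve. all: by end_near. Qed.

Let slab d sg : set (pentagon R) :=
  [set p | deviation L p <= d] `&` [set p | 0 < sg * orientation p].

Let measurable_slab d sg : measurable (slab d sg).
Proof.
by apply: measurableI; [exact: measurable_deviation|exact: measurable_oriented].
Qed.

Let orientation_far : exists2 d : R, 0 < d &
  forall p, deviation L p <= 2 * d -> V < 2 * `|orientation p|.
Proof.
have V0 : 0 < V := length_volume_gt0.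
have V2 : \det (edge_gram L) = V ^+ 2.
  by rewrite sqr_sqrtr// ltW// -sqrtr_gt0.
have [|e e0 He] := @near_det_edges R L (V ^+ 2 / 4).
  by rewrite V2 ltr_pdivrMr// ltr_pMr ?exprn_gt0// ltr1n.
exists (e / 4) => [|p dp]; first by rewrite divr_gt0.
have de : deviation L p < e.
  apply: le_lt_trans dp _; rewrite mulrCA gtr_pMr//.
  by rewrite ltr_pdivrMr// mul1r ltr_nat.
have := He _ (fun i j ij => le_lt_trans (deviation_ge L p ij) de).
rewrite ltr_pdivrMr// -[_ ^+ 2 * 4](_ : (2 * `|orientation p|) ^+ 2 = _).
  by rewrite ltr_pXn2r// ?nnegrE ?mulr_ge0// ltW.
by rewrite exprMn real_normK ?num_real// mulrC /orientation; ring.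
Qed.

(** Each of the two orientations carries half of the mass 1 / V of P_l. *)
Lemma oriented_mass sg : `|sg| = 1 ->
  mu (P_l l `&` [set p | 0 < sg * orientation p]) = ((2 * V)^-1)%:E.
Proof.
move=> sg1; have V0 : 0 < V := length_volume_gt0.
have [d0 d00 far] := orientation_far.
have far' d p : d <= d0 -> deviation L p <= 2 * d -> V < 2 * `|orientation p|.
  by move=> dd dp; apply: far; apply: le_trans dp _; rewrite ler_pM2l.
have mtest d : measurable_fun setT (fun p => (test_fun L sg V d p)%:E).
  have mclamp (f : pentagon R -> R) : measurable_fun setT f ->
      measurable_fun setT (fun p => clamp (f p)).
    move=> mf; apply: (@measurable_maxr _ _ _ setT (cst 0) (fun p => Num.min 1 (f p))) => //.
    exact: (@measurable_minr _ _ _ setT (cst 1) f).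
  apply/measurable_EFinP; apply: measurable_funM; apply: mclamp.
    by apply: measurable_funB => //; exact: measurable_funM.
  by apply: measurable_funM => //; apply: measurable_funM => //; exact: measurable_funM.
have test_ge0 d p : 0 <= test_fun L sg V d p <= 1.
  have [/andP[a0 a1] /andP[b0 b1]] := (clamp_bounds (2 - deviation L p / d),
    clamp_bounds (2 * (sg * orientation p) / V)).
  by rewrite mulr_ge0// mulr_ile1.
have lower d : 0 < d -> d <= d0 -> (mu (slab d sg) <= ((2 * V)^-1)%:E)%E.
  move=> d_gt0 dd; rewrite -(@test_integral sg d)//; last by move=> p; exact: far'.
  rewrite -[slab d sg]setIT -integral_indic//.
  apply: ge0_le_integral => //.
  - by apply/measurable_EFinP; apply: measurable_indic; exact: measurable_slab.
  move=> p _; rewrite lee_fin indicE; case: (boolP (p \in _)) => [|_]; last first.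
    by have /andP[] := test_ge0 d p.
  rewrite inE => -[/= dp sp].
  rewrite /test_fun clamp_orientation//; last first.
    by apply: (far' d) => //; apply: le_trans dp _; rewrite ler_peMl ?ler1n// ltW.
  rewrite indicE mem_set// mulr1 clamp_ge1// lerBrDr -lerBrDl.
  by rewrite (_ : 2 - 1 = 1) ?ler_pdivrMr ?mul1r//; ring.
have upper d : 0 < d -> d <= d0 -> (((2 * V)^-1)%:E <= mu (slab d sg))%E.
  move=> d_gt0 dd; have d2 : 0 < d / 2 by rewrite divr_gt0.
  rewrite -(@test_integral sg (d / 2))//; last first.
    by move=> p; apply: far'; apply: le_trans dd; rewrite ler_pdivrMr// ler_pMr// ler1n.
  rewrite -[slab d sg]setIT -integral_indic//.
  apply: ge0_le_integral => //.
  - by move=> p _; rewrite lee_fin; have /andP[] := test_ge0 (d / 2) p.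
  - by apply/measurable_EFinP; apply: measurable_indic; exact: measurable_slab.
  move=> p _; rewrite lee_fin; have /andP[_ t1] := test_ge0 (d / 2) p.
  have [->//|t0] := eqVneq (test_fun L sg V (d / 2) p) 0.
  rewrite indicE mem_set//; split=> /=.
    by rewrite ltW// (lt_le_trans (test_fun_neq0 d2 t0))// mulrC divfK.
  rewrite ltNge; apply: contra t0 => sp; apply/eqP.
  by rewrite /test_fun [X in _ * X]clamp_le0 ?mulr0// pmulr_lle0 ?invr_gt0// pmulr_rle0.
have slabE d : 0 < d -> d <= d0 -> mu (slab d sg) = ((2 * V)^-1)%:E.
  by move=> d_gt0 dd; apply/eqP; rewrite eq_le lower// upper.
pose F n := slab (d0 / n.+1%:R) sg.
have FE n : mu (F n) = ((2 * V)^-1)%:E.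
  by apply: slabE; rewrite ?divr_gt0// ler_pdivrMr// ler_pMr// ler1n.
have capF : \bigcap_n F n = P_l l `&` [set p | 0 < sg * orientation p].
  apply/seteqP; split=> p; last first.
    move=> [/P_lE dp sp] n _; split=> //=.
    by rewrite dp divr_ge0// ltW.
  move=> Fp; split; last by have [] := Fp 0%N I.
  apply/P_lE/eqP; rewrite eq_le sumr_ge0 ?andbT; last first.
    by move=> i _; apply: sumr_ge0.
  rewrite leNgt; apply/negP => dp; have [n _ /(_ n (leqnn _))] := near_infty_natSinv_lt (PosNum (divr_gt0 dp d00)).
  rewrite /= ltr_pdivlMr// mulrC; have [/= + _] := Fp n I.
  by move=> /le_lt_trans/[apply]; rewrite ltxx.
rewrite -capF; have mF n : measurable (F n) by exact: measurable_slab.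
have : (mu \o F) @ \oo --> mu (\bigcap_n F n).
  apply: nonincreasing_cvg_mu => //.
  - by rewrite FE ltry.
  - exact: bigcapT_measurable.
  - move=> n m nm; apply/subsetPset => p [/= dp sp]; split=> //=.
    by apply: le_trans dp _; rewrite ler_pM2l// lef_pV2 ?posrE// ler_nat.
rewrite (_ : mu \o F = cst ((2 * V)^-1)%:E); last first.
  by apply/funext => n /=; rewrite FE.
by move=> /cvg_lim <-//; rewrite lim_cst.
Qed.

End MassOfSimplices.
(** * The volume of a simplex *)

Section SimplexVolume.
Variable R : realType.

Lemma lam4_translate (c : space4 R) (S : set (space4 R)) : measurable S ->
  lam4 R ((fun x => (x.1.1.1 + c.1.1.1, x.1.1.2 + c.1.1.2, x.1.2 + c.1.2,
    x.2 + c.2)) @^-1` S) = lam4 R S.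
Proof.
have shift (b : R) : scales (lam1 R) (lam1 R) 1 (fun y => y + b).
  rewrite (_ : (fun y => _) = fun y => 1 * y + b).
    by have := scales_affine b (oner_neq0 R); rewrite normr1 invr1.
  by apply/funext => y; rewrite mul1r.
have := scales_pair (scales_pair (scales_pair (shift c.1.1.1) (shift c.1.1.2))
  (shift c.1.2)) (shift c.2).
by rewrite !mulr1 => -[_ _ E] mS; rewrite -[RHS]mul1e -(E _ mS).
Qed.

(** The hull is the affine image of the standard simplex of volume 1 / 4!. *)
Lemma conv_hull_volume (p : 'I_5 -> 'cV[R]_4) :
  \det (edge_mx (vertex_edges p)) != 0 ->
  @lebesgue4 R (@vec4 R @^-1` conv_hull p) =
  (`|\det (edge_mx (vertex_edges p))| / 24)%:E.
Proof.
have [U U1 UE] := first_vertex_edges p; set E := edge_mx _ in UE * => E0.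
pose M := (U *m E)^T; have detM : \det M = \det E.
  by rewrite /M det_tr det_mulmx U1 mul1r.
have MU : M \in unitmx by rewrite unitmxE unitfE detM.
have [q qE] : {q : space4 R | vec4 q = - p ord0}.
  by exists (unvec4 (- p ord0)); rewrite unvec4K.
have [mS S24] := std_simplex4_volume R.
have hullE : @vec4 R @^-1` conv_hull p = (fun x => (x.1.1.1 + q.1.1.1,
    x.1.1.2 + q.1.1.2, x.1.2 + q.1.2, x.2 + q.2)) @^-1`
    (lin4 (invmx M) @^-1` std_simplex4 1).
  have shiftE (x : space4 R) : vec4 (x.1.1.1 + q.1.1.1, x.1.1.2 + q.1.1.2,
      x.1.2 + q.1.2, x.2 + q.2) = vec4 x - p ord0.
    apply/matrixP => i j; rewrite (ord1 j) [RHS]mxE -qE !mxE.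
    by move: i; apply: ord4P.
  have stdE (z : space4 R) : std_simplex4 1 z <->
      (forall i, 0 <= vec4 z i ord0) /\ \sum_i vec4 z i ord0 <= 1.
    rewrite sum_ord4 /std_simplex4/= !mxE/=; split=> [[? ? ? ? ?]|[z0 ?]].
      by split=> //; apply: ord4P; rewrite mxE.
    by have := (z0 o0, z0 o1, z0 o2, z0 o3); rewrite !mxE => -[[[]]].
  have colM (i : 'I_4) : col i M = p (lift ord0 i) - p ord0.
    by rewrite /M -tr_row -UE rowK trmxK.
  have Mz (z : 'cV[R]_4) : M *m z = \sum_i z i ord0 *: (p (lift ord0 i) - p ord0).
    apply: trmx_inj; rewrite trmx_mul mulmx_sum_row linear_sum; apply: eq_bigr => i _.
    by rewrite linearZ/= -colM tr_col mxE.
  apply/seteqP; split=> x /=.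
    move=> [w [w0 w1 xE]]; apply/stdE; rewrite /lin4 unvec4K shiftE.
    pose t : 'cV[R]_4 := \col_i w (lift ord0 i).
    have -> : invmx M *m (vec4 x - p ord0) = t.
      rewrite -[RHS](mulKmx MU) Mz; congr (_ *m _); rewrite xE big_ord_recl.
      rewrite (_ : w ord0 = 1 - \sum_i w (lift ord0 i)); last first.
        by rewrite -w1 big_ord_recl addrK.
      rewrite scalerBl scale1r addrAC [_ - _ - _]addrAC subrr add0r addrC.
      rewrite scaler_suml -sumrB; apply: eq_bigr => i _.
      by rewrite mxE scalerBr.
    split=> [i|]; first by rewrite mxE.
    rewrite -w1 [leRHS]big_ord_recl -[leLHS]add0r; apply: lerD => //.
    by apply: ler_sum => i _; rewrite mxE.
  move=> /stdE; rewrite /lin4 unvec4K shiftE; set t := invmx M *m _ => -[t0 t1].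
  exists (fun i => if unlift ord0 i is Some j then t j ord0 else 1 - \sum_j t j ord0).
  split.
  - by move=> i; case: unliftP => [j _|_] //; rewrite subr_ge0.
  - rewrite big_ord_recl unlift_none [X in _ + X](_ : _ = \sum_i t i ord0) ?subrK//.
    by apply: eq_bigr => i _; rewrite liftK.
  - rewrite big_ord_recl unlift_none.
    rewrite [X in _ + X](_ : _ = \sum_i t i ord0 *: p (lift ord0 i)); last first.
      by apply: eq_bigr => i _; rewrite liftK.
    have := mulKVmx MU (vec4 x - p ord0); rewrite -/t Mz => xE.
    rewrite scalerBl scale1r scaler_suml addrAC -addrA -sumrB.
    by under [in RHS]eq_bigr do rewrite -scalerBr; rewrite xE addrC subrK.
have iM : \det (invmx M) != 0 by rewrite det_inv detM invr_eq0.
have mT : measurable (lin4 (invmx M) @^-1` std_simplex4 1).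
  by have [_ mlin _] := linear_change iM; exact: measurable_preimageT.
rewrite lebesgue4E hullE lam4_translate// lam4_preimage// S24 det_inv detM.
by rewrite normrV ?unitfE// invrK -EFinM.
Qed.

(** The absolute determinant of a realization only depends on the lengths, so
    the choice of the Euclidean simplex does not matter. *)
Lemma V4E (l : 'I_5 -> 'I_5 -> R) : simplex_lengths l -> V4 l = length_volume l.
Proof.
move=> Hl; have [p0 [p0_free p0l]] := Hl.
have pl : realizes l (euclidean_simplex l).
  by rewrite /euclidean_simplex; case: xgetP => [//|/(_ p0)].
have E := sqr_orientation (realizes_sqlen pl).
have V0 := length_volume_gt0 Hl.
rewrite /V4 /simplex4_volume conv_hull_volume; last by rewrite -normr_gt0 E.
by rewrite /= E mulrC divfK// pnatr_eq0.
Qed.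

End SimplexVolume.
(** * Gradients of barycentric coordinates and outward normals *)

Section DualVectors.
Variables (R : realType) (p : 'I_5 -> 'cV[R]_4).

Let E := edge_mx (vertex_edges p).

(** The gradient of the barycentric coordinate of the vertex a. *)
Definition dual (a : 'I_5) : 'cV[R]_4 :=
  invmx E *m \col_(t < 4) ((t.+1 == a :> nat)%:R - (t == a :> nat)%:R).

(** Determinants of edge vectors from a common vertex are integer multiples of
    that of the consecutive edges. *)
Lemma det_from_vertex (e0 : 'I_5) (s : seq 'I_5) :
  \det (\matrix_(r < 4) (p (nth e0 s r) - p e0)^T) =
  det4 (fun r t => (t < nth e0 s r)%:R - (t < e0)%:R) * \det E.
Proof.
have pE (j : 'I_5) : p j - p ord0 = \sum_(t < 4) (t < j)%N%:R *: (row t E)^T.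
  have j4 : (j <= 4)%N by rewrite -ltnS.
  have := path_edge_row (vertex_edges p) 0 j4.
  rewrite path_vertex_edges ?j4// (inord_val j).
  rewrite (_ : inord 0 = ord0); last by apply: val_inj; rewrite /= inordK.
  move=> jE; rewrite -[LHS]trmxK jE linear_sum; apply: eq_bigr => t _.
  by rewrite linearZ.
pose C : 'M[R]_4 := \matrix_(r, t) ((t < nth e0 s r)%N%:R - (t < e0)%N%:R).
rewrite -(@det4E _ C) => [|i j]; last by rewrite mxE.
rewrite -det_mulmx; congr (\det _); apply/row_matrixP => r.
rewrite rowK row_mul mulmx_sum_row -[p _](subrK (p ord0)) -addrA.
rewrite -[p ord0 - _]opprB !pE -sumrB linear_sum; apply: eq_bigr => t _.
by rewrite -scalerBl linearZ/= trmxK !mxE.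
Qed.

Hypothesis E0 : \det E != 0.

Let EU : E \in unitmx. Proof. by rewrite unitmxE unitfE. Qed.

Let E_dot (v : 'cV[R]_4) (t : 'I_4) :
  (E *m v) t ord0 = dotp v (p (inord t.+1) - p (inord t)).
Proof. by rewrite mxE dotpC; apply: eq_bigr => i _; rewrite !mxE. Qed.

Lemma dual_edge a i j : dotp (dual a) (edge p i j) = (j == a)%:R - (i == a)%:R.
Proof.
have step (t : 'I_4) : dotp (dual a) (p (inord t.+1) - p (inord t)) =
    (t.+1 == a :> nat)%:R - (t == a :> nat)%:R.
  by rewrite -E_dot mulKVmx// mxE.
pose f (k : nat) := dotp (dual a) (p (inord k)) - (k == a :> nat)%:R.
have fE k : (k <= 4)%N -> f k = f 0%N.
  elim: k => // k IH k4; rewrite -IH ?(ltnW k4)// /f.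
  have := step (Ordinal k4); rewrite dotpBr/= => /(canRL (subrK _)) ->.
  by rewrite addrAC addrC; congr (_ + _); rewrite addrAC subrr add0r.
have ij : f i = f j by rewrite !fE// -ltnS ltn_ord.
rewrite /edge dotpBr; move: ij; rewrite /f !inord_val -!val_eqE => /eqP.
rewrite subr_eq => /eqP ->; ring.
Qed.

Lemma edges_separate (v : 'cV[R]_4) : (forall i j, dotp v (edge p i j) = 0) -> v = 0.
Proof.
move=> v0; apply: (can_inj (mulKmx EU)); rewrite mulmx0.
by apply/matrixP => t z; rewrite (ord1 z) E_dot [RHS]mxE; exact: v0.
Qed.

(** Both sides have the same scalar products with all edges, which span. *)
Lemma facet_normal (v : 'cV[R]_4) a i : i != a ->
  (forall i j, i != a -> j != a -> dotp v (edge p i j) = 0) ->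
  v = dotp v (edge p i a) *: dual a.
Proof.
move=> ia v0; apply/eqP; rewrite -subr_eq0; apply/eqP; apply: edges_separate => j k.
have eD : edge p j k = edge p i k - edge p i j.
  by rewrite /edge opprB addrA subrK.
have vi m : dotp v (edge p i m) = dotp v (edge p i a) * (m == a)%:R.
  by have [->|ma] := eqVneq m a; rewrite ?mulr1// v0// mulr0.
rewrite dotpBl dotpZl dual_edge eD dotpBr vi (vi j); ring.
Qed.

Lemma dual_neq0 a : 0 < dotp (dual a) (dual a).
Proof.
rewrite lt_neqAle dotp_ge0 andbT eq_sym dotp_eq0; apply/eqP => d0.
have [i ia] : exists i : 'I_5, i != a.
  by case: (eqVneq a ord0) => [->|]; [exists ord_max|exists ord0; rewrite eq_sym].
have := dual_edge a i a; rewrite d0 dotp0l eqxx (negbTE ia) subr0 => /eqP.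
by rewrite eq_sym oner_eq0.
Qed.

Lemma outward_normalE a : exists2 t, t < 0 &
  outward_normal p a = t *: dual a /\ t ^+ 2 * dotp (dual a) (dual a) = 1.
Proof.
have d0 := dual_neq0 a.
have norm1 t : enorm (t *: dual a) = 1 -> t ^+ 2 * dotp (dual a) (dual a) = 1.
  by move=> t1; rewrite expr2 -mulrA -dotpZr -dotpZl -enorm_sqr t1 expr1n.
have [i ia] : exists i : 'I_5, i != a.
  by case: (eqVneq a ord0) => [->|]; [exists ord_max|exists ord0; rewrite eq_sym].
rewrite /outward_normal; case: xgetP => [u _ [u1 uf ua]|].
  have uE := facet_normal ia uf; exists (dotp u (edge p i a)); first exact: ua.
  by split=> //; apply: norm1; rewrite -uE.
pose c := Num.sqrt (dotp (dual a) (dual a)); have c0 : 0 < c by rewrite sqrtr_gt0.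
move=> /(_ (- c^-1 *: dual a)) []; split.
- rewrite /enorm dotpZl dotpZr mulrA mulrNN -expr2 exprVn sqr_sqrtr ?ltW//.
  by rewrite mulVf ?sqrtr1// gt_eqF.
- by move=> j k ja ka; rewrite dotpZl dual_edge (negbTE ja) (negbTE ka) subrr mulr0.
- move=> j ja; rewrite dotpZl dual_edge eqxx (negbTE ja) subr0 mulr1.
  by rewrite oppr_lt0 invr_gt0.
Qed.

(** Both normals are negative multiples of gradients, so the signs cancel. *)
Lemma dot_outward_normal a b : dotp (outward_normal p a) (outward_normal p b) =
  dotp (dual a) (dual b) /
  (Num.sqrt (dotp (dual a) (dual a)) * Num.sqrt (dotp (dual b) (dual b))).
Proof.
have [s s0 [-> s1]] := outward_normalE a; have [t t0 [-> t1]] := outward_normalE b.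
have inv (u c : R) : u < 0 -> u ^+ 2 * c = 1 -> u = - (Num.sqrt c)^-1.
  move=> u0 uc; have c0 : c = (u ^+ 2)^-1 by rewrite -[LHS](mulKf (_ : u ^+ 2 != 0)) ?uc ?mulr1// expf_neq0 ?lt_eqF.
  by rewrite c0 sqrtrV ?sqr_ge0// sqrtr_sqr invrK ltr0_norm// opprK.
by rewrite dotpZl dotpZr (inv s _ s0 s1) (inv t _ t0 t1) invfM; ring.
Qed.

(** The gradients depend on the embedding, but their scalar products only
    through the Gram matrix of the edges. *)
Lemma dot_dual a b : dotp (dual a) (dual b) =
  ((\col_(t < 4) ((t.+1 == a :> nat)%:R - (t == a :> nat)%:R))^T *m
   invmx (E *m E^T) *m
   \col_(t < 4) ((t.+1 == b :> nat)%:R - (t == b :> nat)%:R)) ord0 ord0.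
Proof.
rewrite dotpE /dual trmx_mul trmx_inv.
have -> : invmx (E *m E^T) = invmx E^T *m invmx E.
  have EEU : E *m E^T \in unitmx by rewrite unitmx_mul unitmx_tr EU.
  apply: (can_inj (mulKmx EEU)); rewrite mulmxV// mulmxA -(mulmxA E) mulmxV ?unitmx_tr//.
  by rewrite mulmx1 mulmxV.
by rewrite !mulmxA.
Qed.

End DualVectors.
(** * Orthonormal frames adapted to vectors *)

Section AdaptedFrames.
Variable R : realType.
Implicit Types (a b c u v : 'cV[R]_4) (F : 'M[R]_4).

Notation cv x y z t := (vec4 (x, y, z, t) : 'cV[R]_4).

Lemma dotp_cv x y z t x' y' z' t' : dotp (cv x y z t) (cv x' y' z' t') =
  x * x' + y * y' + z * z' + t * t'.
Proof. by rewrite /dotp sum_ord4 !mxE. Qed.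

Lemma cvE v : v = cv (v o0 ord0) (v o1 ord0) (v o2 ord0) (v o3 ord0).
Proof. by rewrite -[LHS]unvec4K. Qed.

Lemma basis4E (k : 'I_4) i : basis4 R k i ord0 = (i == k)%:R.
Proof. by rewrite mxE inord_val eqxx andbT. Qed.

Lemma dotp_orthogonal F u v : F^T *m F = 1%:M -> dotp (F *m u) (F *m v) = dotp u v.
Proof. by move=> FF; rewrite !dotpE trmx_mul -mulmxA (mulmxA F^T) FF mul1mx. Qed.

Lemma orthogonalC F : F *m F^T = 1%:M -> F^T *m F = 1%:M.
Proof. exact: mulmx1C. Qed.

Let orthogonal3 a b c v : exists u,
  [/\ dotp a u = 0, dotp b u = 0, dotp c u = 0, dotp u u = 1 & 0 <= dotp v u].
Proof.
pose A : 'M[R]_(3, 4) := \matrix_(i < 3) (nth 0 [:: a; b; c] i)^T.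
have [u [Au uu]] := orthogonal_unit A isT.
have Ai (i : 'I_3) : dotp (nth 0 [:: a; b; c] i) u = 0.
  by rewrite dotpE; have /matrixP/(_ i ord0) := Au; rewrite !mxE => {2}<-;
    apply: eq_bigr => j _; rewrite !mxE.
have [a0 b0 c0] : [/\ dotp a u = 0, dotp b u = 0 & dotp c u = 0].
  by split; [exact: (Ai ord0)|exact: (Ai (@Ordinal 3 1 isT))|exact: (Ai ord_max)].
have [v0|v0] := leP 0 (dotp v u); first by exists u.
by exists (- u); rewrite !dotpNr dotpNl a0 b0 c0 !oppr0 opprK oppr_ge0 ltW.
Qed.

(** Gram-Schmidt from the last vector down: each basis vector is chosen
    orthogonal to the later ones and to the given vectors of smaller index,
    which makes the given vectors triangular even when they are dependent. *)
Lemma adapted_frame a1 a2 a3 u : dotp u u = 1 ->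
  dotp a1 u = 0 -> dotp a2 u = 0 -> dotp a3 u = 0 ->
  exists F x (y y' z z' z'' : R), [/\ F *m F^T = 1%:M, F *m cv 0 0 0 1 = u,
    [/\ 0 <= x, 0 <= y' & 0 <= z''] &
    [/\ a1 = F *m cv x 0 0 0, a2 = F *m cv y y' 0 0 & a3 = F *m cv z z' z'' 0]].
Proof.
move=> uu a1u a2u a3u.
have [u3 [h31 h32 h3u h33 a33]] := orthogonal3 a1 a2 u a3.
have [u2 [h21 h23 h2u h22 a22]] := orthogonal3 a1 u3 u a2.
have [u1 [h12 h13 h1u h11 a11]] := orthogonal3 u2 u3 u a1.
pose B : 'M[R]_4 := \matrix_(i < 4) (nth 0 [:: u1; u2; u3; u] i)^T.
have Bv v : B *m v = cv (dotp u1 v) (dotp u2 v) (dotp u3 v) (dotp u v).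
  rewrite [LHS]cvE; congr (vec4 (_, _, _, _)); rewrite mxE;
    by apply: eq_bigr => j _; rewrite !mxE.
have BB : B *m B^T = 1%:M.
  apply/matrixP => i j; rewrite mxE.
  transitivity (dotp (nth 0 [:: u1; u2; u3; u] i) (nth 0 [:: u1; u2; u3; u] j)).
    by apply: eq_bigr => k _; rewrite !mxE.
  rewrite mxE; move: i j; apply: ord4P; apply: ord4P; rewrite /= ?h11 ?h22 ?h33 ?uu//.
  - by rewrite dotpC.
  - by rewrite dotpC.
  - by rewrite dotpC.
  - by rewrite dotpC.
  - by rewrite dotpC.
  - by rewrite dotpC.
have FB : B^T *m B = 1%:M by exact: mulmx1C.
have aE v w : B *m v = w -> v = B^T *m w by move=> <-; rewrite mulmxA FB mul1mx.
exists B^T, (dotp u1 a1), (dotp u1 a2), (dotp u2 a2), (dotp u1 a3), (dotp u2 a3).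
exists (dotp u3 a3); rewrite trmxK; split=> //.
- by apply/esym/aE; rewrite Bv (dotpC u1) (dotpC u2) (dotpC u3) h1u h2u h3u uu.
- by rewrite ![dotp _ a1]dotpC ![dotp _ a2]dotpC ![dotp _ a3]dotpC.
split; apply: aE; rewrite Bv.
- by rewrite (dotpC u2) (dotpC u3) (dotpC u) h21 h31 a1u.
- by rewrite (dotpC u3) (dotpC u) h32 a2u.
- by rewrite (dotpC u) a3u.
Qed.

Definition flip (j : 'I_4) : 'M[R]_4 := diag_mx (\row_i (if i == j then -1 else 1)).

Lemma flipE j v : flip j *m v = \col_i ((if i == j then -1 else 1) * v i ord0).
Proof. by apply/matrixP => i k; rewrite (ord1 k) mul_diag_mx !mxE. Qed.

Lemma flip_orthogonal j : flip j *m (flip j)^T = 1%:M.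
Proof.
apply/matrixP => i k; rewrite tr_diag_mx mul_mx_diag !mxE.
case: (i =P k) => [->|_]; rewrite ?mulr0n ?mul0r// mulr1n.
by case: ifP => _; rewrite ?mulr1// mulrNN mulr1.
Qed.

Lemma det_flip j : \det (flip j) = -1.
Proof.
rewrite det_diag prod_ord4 !mxE; move: j; apply: ord4P => /=; ring.
Qed.

Lemma flip_SO4 F j : F *m F^T = 1%:M -> \det F != 1 -> SO4 (F *m flip j).
Proof.
move=> FF d1; split.
  by rewrite trmx_mul mulmxA -(mulmxA F) flip_orthogonal mulmx1 FF.
have : \det F ^+ 2 = 1 by rewrite expr2 -{2}det_tr -det_mulmx FF det1.
move=> /eqP; rewrite sqrf_eq1 (negbTE d1)/= => /eqP dF.
by rewrite det_mulmx dF det_flip mulrNN mulr1.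
Qed.

Lemma frame_SO4 a1 a2 a3 : exists F x (y y' z z' z'' : R),
  [/\ SO4 F, [/\ 0 <= x, 0 <= y' & 0 <= z''] &
    [/\ a1 = F *m cv x 0 0 0, a2 = F *m cv y y' 0 0 & a3 = F *m cv z z' z'' 0]].
Proof.
have [u [a1u a2u a3u uu _]] := orthogonal3 a1 a2 a3 0.
have [F [x [y [y' [z [z' [z'' [FF _ pos aE]]]]]]]] := adapted_frame uu a1u a2u a3u.
have [d1|d1] := eqVneq (\det F) 1; first by exists F, x, y, y', z, z', z''; split.
exists (F *m flip o3), x, y, y', z, z', z''; split=> //; first exact: flip_SO4.
have fE (r s t : R) : flip o3 *m cv r s t 0 = cv r s t 0.
  rewrite flipE; apply/matrixP => i k; rewrite (ord1 k) [LHS]mxE.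
  by move: i; apply: ord4P; rewrite !mxE/= ?mul1r ?mulr0.
by rewrite -!mulmxA !fE.
Qed.

Lemma frame_SO3 a1 a2 : a1 o3 ord0 = 0 -> a2 o3 ord0 = 0 ->
  exists F x (y y' : R), [/\ SO3 F, 0 <= x, 0 <= y',
    a1 = F *m cv x 0 0 0 & a2 = F *m cv y y' 0 0].
Proof.
move=> a10 a20; pose u := cv 0 0 0 1.
have du v : dotp v u = v o3 ord0.
  by rewrite {1}[v]cvE dotp_cv !mulr0 !add0r mulr1.
have uE : basis4 R 3 = u.
  apply/matrixP => i k; rewrite (ord1 k) (basis4E o3).
  by move: i; apply: ord4P; rewrite mxE.
have [||||F [x [y [y' [_ [_ [_ [FF Fu [x0 y0 _] [a1E a2E _]]]]]]]]] :=
  @adapted_frame a1 a2 0 u; rewrite ?du ?mxE//.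
have [d1|d1] := eqVneq (\det F) 1.
  by exists F, x, y, y'; split=> //; split; [|rewrite uE].
exists (F *m flip o2), x, y, y'.
have fE (r s t : R) : flip o2 *m cv r s 0 t = cv r s 0 t.
  rewrite flipE; apply/matrixP => i k; rewrite (ord1 k) [LHS]mxE.
  by move: i; apply: ord4P; rewrite !mxE/= ?mul1r ?mulr0.
rewrite -!mulmxA !fE; split=> //; split; first exact: flip_SO4.
by rewrite uE -mulmxA fE.
Qed.

(** Uniqueness of the Cholesky decomposition. *)
Lemma triangular_unique (x y y' z z' z'' s t t' w w' w'' : R) :
  0 <= x -> 0 <= y' -> 0 <= z'' -> 0 <= s -> 0 <= t' -> 0 <= w'' ->
  x * x = s * s -> x * y = s * t -> y * y + y' * y' = t * t + t' * t' ->
  0 < x ->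
  [/\ x = s, y = t, y' = t' & x * z = s * w -> y * z + y' * z' = t * w + t' * w' ->
   z * z + z' * z' + z'' * z'' = w * w + w' * w' + w'' * w'' -> 0 < y' ->
   [/\ z = w, z' = w' & z'' = w'']].
Proof.
move=> x0 y0 z0 s0 t0 w0 xs xy yy xp.
have sqr_inj (a b : R) : 0 <= a -> 0 <= b -> a * a = b * b -> a = b.
  by move=> a0 b0 ab; apply/eqP; rewrite -(@eqrXn2 _ 2)// !expr2 ab.
have xE : x = s by exact: sqr_inj.
have yE : y = t by apply: (mulfI (lt0r_neq0 xp)); rewrite xy xE.
have y'E : y' = t'.
  by apply: sqr_inj => //; apply: (addrI (y * y)); rewrite yy yE.
split=> // xz yz zz y'p.
have zE : z = w by apply: (mulfI (lt0r_neq0 xp)); rewrite xz xE.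
have z'E : z' = w'.
  apply: (mulfI (lt0r_neq0 y'p)); apply: (addrI (y * z)).
  by rewrite yz yE zE y'E.
split=> //; apply: sqr_inj => //; apply: (addrI (z * z + z' * z')).
by rewrite zz zE z'E.
Qed.

Lemma polar (x y r : R) : 0 <= y -> 0 <= r -> x ^+ 2 + y ^+ 2 = r ^+ 2 ->
  exists2 gamma, 0 <= gamma <= pi & x = r * cos gamma /\ y = r * sin gamma.
Proof.
move=> y0; rewrite le_eqVlt => /predU1P[<-|r0] xyr.
  exists 0; first by rewrite lexx pi_ge0.
  rewrite !mul0r; move/eqP: xyr; rewrite expr0n/= paddr_eq0 ?sqr_ge0//.
  by rewrite !sqrf_eq0 => /andP[/eqP-> /eqP->].
have xr : -1 <= x / r <= 1.
  rewrite -ler_norml -(@ler_pXn2r _ 2)// ?nnegrE// expr1n real_normK ?num_real//.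
  by rewrite expr_div_n ler_pdivrMr ?exprn_gt0// mul1r -xyr lerDl sqr_ge0.
exists (acos (x / r)); first by rewrite acos_ge0// acos_lepi.
rewrite acosK ?in_itv// mulrC divfK ?gt_eqF//; split=> //.
rewrite sin_acos// expr_div_n.
have -> : 1 - x ^+ 2 / r ^+ 2 = (y / r) ^+ 2.
  rewrite expr_div_n -{1}(divff (_ : r ^+ 2 != 0)) ?expf_neq0 ?gt_eqF//.
  by rewrite -mulrBl -xyr addrAC subrr add0r.
by rewrite sqrtr_sqr ger0_norm ?divr_ge0 ?(ltW r0)// mulrC divfK ?gt_eqF.
Qed.

End AdaptedFrames.
(** * Reference triangles and tetrahedra *)

Section ReferenceSimplices.
Variable R : realType.
Implicit Types (F g : 'M[R]_4).

Notation cv x y z t := (vec4 (x, y, z, t) : 'cV[R]_4).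
Notation e4 := (cv 0 0 0 1).

Lemma basis4_3 : basis4 R 3 = e4.
Proof.
apply/matrixP => i k; rewrite (ord1 k) (basis4E R o3).
by move: i; apply: ord4P; rewrite mxE.
Qed.

Lemma h_entry (phi : R) i j : h phi i j =
  nth 0 (nth [::] [:: [:: 1; 0; 0; 0]; [:: 0; 1; 0; 0];
    [:: 0; 0; cos phi; - sin phi]; [:: 0; 0; sin phi; cos phi]] i) j.
Proof.
have [e0 e1] : @Ordinal 4 0 isT = @lshift 2 2 ord0 /\
  @Ordinal 4 1 isT = @lshift 2 2 ord_max by split; apply: val_inj.
have [e2 e3] : @Ordinal 4 2 isT = @rshift 2 2 ord0 /\
  @Ordinal 4 3 isT = @rshift 2 2 ord_max by split; apply: val_inj.
have sl (k : 'I_2) : fintype.split (@lshift 2 2 k) = inl k := unsplitK (inl k).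
have sr (k : 'I_2) : fintype.split (@rshift 2 2 k) = inr k := unsplitK (inr k).
move: i j; apply: ord4P; apply: ord4P => /=;
  by rewrite ?e0 ?e1 ?e2 ?e3 !mxE ?sl ?sr ?row_mxEl ?row_mxEr !mxE.
Qed.

Lemma hE (phi x y z t : R) : h phi *m cv x y z t =
  cv x y (cos phi * z - sin phi * t) (sin phi * z + cos phi * t).
Proof.
apply/matrixP => i j; rewrite (ord1 j) mxE sum_ord4 !h_entry.
by move: i; apply: ord4P; rewrite !mxE /=; ring.
Qed.

Lemma h_SO4 (phi : R) : SO4 (h phi).
Proof.
have cs := cos2Dsin2 phi; have sc : sin phi ^+ 2 + cos phi ^+ 2 = 1 by rewrite addrC.
split.
  apply/matrixP => i j; rewrite mxE sum_ord4 ![_^T _ _]mxE !h_entry.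
  move: i j; apply: ord4P; apply: ord4P; rewrite mxE /=; try by ring.
    by rewrite -[RHS]cs; ring.
  by rewrite -[RHS]sc; ring.
rewrite (@det4E _ _ (fun i j => nth 0 (nth [::] [:: [:: 1; 0; 0; 0];
    [:: 0; 1; 0; 0]; [:: 0; 0; cos phi; - sin phi]; [:: 0; 0; sin phi; cos phi]] i) j)).
  by rewrite /det4/= -[RHS]cs; ring.
by move=> i j; rewrite h_entry.
Qed.

Lemma same_from0 k n (p q : 'I_k.+1 -> 'cV[R]_n) :
  (forall i, i != ord0 -> edge p ord0 i = edge q ord0 i) -> same_simplex p q.
Proof.
move=> pq i j; have E0 m : edge p ord0 m = edge q ord0 m.
  by have [->|/pq//] := eqVneq m ord0; rewrite /edge !subrr.
have split0 (r : 'I_k.+1 -> 'cV[R]_n) : edge r i j = edge r ord0 j - edge r ord0 i.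
  by rewrite /edge opprB addrA subrK.
by rewrite (split0 p) (split0 q) !E0.
Qed.

Lemma edge_rotate k n (g : 'M[R]_n) (p : 'I_k -> 'cV[R]_n) i j :
  edge (rotate g p) i j = g *m edge p i j.
Proof. by rewrite /edge /rotate mulmxBr. Qed.

Lemma realizes_rotate k l (p : 'I_k -> 'cV[R]_4) F : F^T *m F = 1%:M ->
  realizes l p -> realizes l (rotate F p).
Proof.
by move=> FF pl i j ij; rewrite edge_rotate /enorm dotp_orthogonal//; exact: pl.
Qed.

(** By polarization. *)
Lemma realizes_dot k n (l : 'I_k -> 'I_k -> R) (p q : 'I_k -> 'cV[R]_n) :
  realizes l p -> realizes l q -> forall i j m,
  dotp (edge p i j) (edge p i m) = dotp (edge q i j) (edge q i m).
Proof.
move=> pl ql i j m.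
have sqE a b : dotp (edge p a b) (edge p a b) = dotp (edge q a b) (edge q a b).
  have swap (r : 'I_k -> 'cV[R]_n) : dotp (edge r a b) (edge r a b) =
      dotp (edge r b a) (edge r b a).
    by rewrite /edge -[r b - _]opprB dotpNl dotpNr opprK.
  have [ab|ba|/val_inj ->] := ltngtP a b.
  - by rewrite -!enorm_sqr pl// ql.
  - by rewrite swap [RHS]swap -!enorm_sqr pl// ql.
  - by rewrite /edge !subrr !dotp0l.
have polar (r : 'I_k -> 'cV[R]_n) : dotp (edge r i j) (edge r i m) =
    (dotp (edge r i j) (edge r i j) + dotp (edge r i m) (edge r i m)
     - dotp (edge r j m) (edge r j m)) / 2.
  have -> : edge r j m = edge r i m - edge r i j.
    by rewrite /edge opprB addrA subrK.
  move: (edge r i j) (edge r i m) => u v.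
  by rewrite !dotpBl !dotpBr (dotpC v u); field.
by rewrite polar [RHS]polar !sqE.
Qed.

Notation t0 := (@Ordinal 3 0 isT).
Notation t1 := (@Ordinal 3 1 isT).
Notation t2 := (@Ordinal 3 2 isT).

Lemma inord3 : (inord 0 = t0) * (inord 1 = t1) * (inord 2 = t2).
Proof. by split; [split|]; apply: val_inj; rewrite /= inordK. Qed.

Lemma inord4 : (inord 0 = o0) * (inord 1 = o1) * (inord 2 = o2) * (inord 3 = o3).
Proof. by do ![split]; apply: val_inj; rewrite /= inordK. Qed.

Lemma ord3P (P : 'I_3 -> Prop) : P t0 -> P t1 -> P t2 -> forall i, P i.
Proof.
by move=> P0 P1 P2 [[|[|[|//]]] iP]; [move: P0|move: P1|move: P2];
  congr P; apply: val_inj.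
Qed.

Let basisE : [/\ basis4 R 0 = cv 1 0 0 0, basis4 R 1 = cv 0 1 0 0 &
  basis4 R 2 = cv 0 0 1 0].
Proof.
split; apply/matrixP => i j; rewrite (ord1 j).
- by rewrite (basis4E R o0); move: i; apply: ord4P; rewrite mxE.
- by rewrite (basis4E R o1); move: i; apply: ord4P; rewrite mxE.
- by rewrite (basis4E R o2); move: i; apply: ord4P; rewrite mxE.
Qed.

Let c1E (x : R) : x *: basis4 R 0 = cv x 0 0 0.
Proof.
have [-> _ _] := basisE; apply/matrixP => i j; rewrite (ord1 j) !mxE.
by move: i; apply: ord4P => /=; ring.
Qed.

Let c2E (r x y : R) : r *: (x *: basis4 R 0 + y *: basis4 R 1) = cv (r * x) (r * y) 0 0.
Proof.
have [-> -> _] := basisE; apply/matrixP => i j; rewrite (ord1 j) !mxE.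
by move: i; apply: ord4P => /=; ring.
Qed.

Let c3E (a s x y : R) : a *: basis4 R 0 + s *: (x *: basis4 R 1 + y *: basis4 R 2) =
  cv a (s * x) (s * y) 0.
Proof.
have [-> -> ->] := basisE; apply/matrixP => i j; rewrite (ord1 j) !mxE.
by move: i; apply: ord4P => /=; ring.
Qed.

Definition triangle_form (x y y' : R) (p : 'I_3 -> 'cV[R]_4) : Prop :=
  [/\ 0 <= x, 0 <= y', edge p t0 t1 = cv x 0 0 0 & edge p t0 t2 = cv y y' 0 0].

Definition tetra_form (x y y' z z' z'' : R) (p : 'I_4 -> 'cV[R]_4) : Prop :=
  [/\ 0 <= x, 0 <= y' & 0 <= z''] /\
  [/\ edge p o0 o1 = cv x 0 0 0, edge p o0 o2 = cv y y' 0 0 &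
      edge p o0 o3 = cv z z' z'' 0].

Let enorm_cv x y z (r : R) : enorm (cv x y z 0) = r ->
  0 <= r /\ x ^+ 2 + y ^+ 2 + z ^+ 2 = r ^+ 2.
Proof.
move=> <-; split; first exact: sqrtr_ge0.
by rewrite enorm_sqr dotp_cv mulr0 addr0 !expr2.
Qed.

Let enorm1 (x r : R) : 0 <= x -> enorm (cv x 0 0 0) = r -> x = r.
Proof.
move=> x0 /enorm_cv[r0]; rewrite expr0n/= !addr0 => xr.
by apply/eqP; rewrite -(@eqrXn2 _ 2)// xr.
Qed.

Lemma ref_triangleP l (q : 'I_3 -> 'cV[R]_4) : realizes l q ->
  realizes l (ref_triangle l) /\ exists x y y', triangle_form x y y' (ref_triangle l).
Proof.
move=> ql; suff : is_ref_triangle l (ref_triangle l).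
  rewrite /is_ref_triangle !inord3 => -[rl [gamma [/andP[g0 gpi]]]].
  rewrite c1E c2E => e1 e2; split=> //.
  have l0 (i j : 'I_3) : (i < j)%N -> 0 <= l i j by move=> ij; rewrite -rl// sqrtr_ge0.
  exists (l t0 t1), (l t0 t2 * cos gamma), (l t0 t2 * sin gamma); split=> //.
    exact: l0.
  by rewrite mulr_ge0 ?l0// sin_ge0_pi// g0.
rewrite /ref_triangle; case: xgetP => [r ->//|/(_ _)].
have [F [x [y [y' [z [z' [z'' [[FF _] [x0 y0 _] [q1 q2 _]]]]]]]]] :=
  frame_SO4 (edge q t0 t1) (edge q t0 t2) 0.
have TF := orthogonalC FF.
have rl : realizes l (rotate F^T q) by apply: realizes_rotate ql; rewrite trmxK.
have r1 : edge (rotate F^T q) t0 t1 = cv x 0 0 0.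
  by rewrite edge_rotate q1 mulmxA TF mul1mx.
have r2 : edge (rotate F^T q) t0 t2 = cv y y' 0 0.
  by rewrite edge_rotate q2 mulmxA TF mul1mx.
move=> /(_ (rotate F^T q))[]; split=> //; rewrite !inord3.
have := rl t0 t2 isT; rewrite r2 => /enorm_cv[l2]; rewrite expr0n/= addr0 => y2.
have [gamma gb [yE y'E]] := polar y0 l2 y2.
exists gamma; split=> //; first by rewrite c1E r1 -(rl t0 t1)// r1 -(enorm1 x0 erefl).
by rewrite c2E r2 yE y'E.
Qed.

Lemma ref_tetrahedronP l (q : 'I_4 -> 'cV[R]_4) : realizes l q ->
  realizes l (ref_tetrahedron l) /\
  exists x y y' z z' z'', tetra_form x y y' z z' z'' (ref_tetrahedron l).
Proof.
move=> ql; suff : is_ref_tetrahedron l (ref_tetrahedron l).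
  rewrite /is_ref_tetrahedron !inord4.
  move=> [rl [c [c' [th [[/andP[a0 a1] /andP[a0' a1'] /andP[t0 t1]]]]]]].
  rewrite c1E c2E c3E => -[e1 e2 e3]; split=> //.
  have l0 (i j : 'I_4) : (i < j)%N -> 0 <= l i j by move=> ij; rewrite -rl// sqrtr_ge0.
  do 6 eexists; split; last by split; [exact: e1|exact: e2|exact: e3].
  by split; rewrite ?mulr_ge0 ?l0// sin_ge0_pi// ?a0 ?a0' ?t0.
rewrite /ref_tetrahedron; case: xgetP => [r ->//|/(_ _)].
have [F [x [y [y' [z [z' [z'' [[FF _] [x0 y0 z0] [q1 q2 q3]]]]]]]]] :=
  frame_SO4 (edge q o0 o1) (edge q o0 o2) (edge q o0 o3).
have TF := orthogonalC FF.
have rl : realizes l (rotate F^T q) by apply: realizes_rotate ql; rewrite trmxK.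
have r1 : edge (rotate F^T q) o0 o1 = cv x 0 0 0.
  by rewrite edge_rotate q1 mulmxA TF mul1mx.
have r2 : edge (rotate F^T q) o0 o2 = cv y y' 0 0.
  by rewrite edge_rotate q2 mulmxA TF mul1mx.
have r3 : edge (rotate F^T q) o0 o3 = cv z z' z'' 0.
  by rewrite edge_rotate q3 mulmxA TF mul1mx.
move=> /(_ (rotate F^T q))[]; split=> //; rewrite !inord4.
have := rl o0 o2 isT; rewrite r2 => /enorm_cv[l2]; rewrite expr0n/= addr0 => y2.
have [gamma gb [yE y'E]] := polar y0 l2 y2.
have := rl o0 o3 isT; rewrite r3 => /enorm_cv[l3 z2].
pose s := Num.sqrt (z' ^+ 2 + z'' ^+ 2); have s0 : 0 <= s by exact: sqrtr_ge0.
have s2 : z' ^+ 2 + z'' ^+ 2 = s ^+ 2 by rewrite sqr_sqrtr ?addr_ge0 ?sqr_ge0.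
have [gamma' gb' [zE sE]] := polar s0 l3 (etrans (congr1 (+%R _) (esym s2)) (etrans (addrA _ _ _) z2)).
have [theta tb [z'E z''E]] := polar z0 s0 s2.
exists gamma, gamma', theta; split; first by split.
split; first by rewrite c1E r1 -(rl o0 o1)// r1 -(enorm1 x0 erefl).
- by rewrite c2E r2 yE y'E.
- by rewrite c3E z'E z''E zE sE.
Qed.

End ReferenceSimplices.
(** * The rotations attached to the faces *)

Section MappingElements.
Variable R : realType.
Implicit Types (g F : 'M[R]_4).

Notation cv x y z t := (vec4 (x, y, z, t) : 'cV[R]_4).
Notation e4 := (cv 0 0 0 1).
Notation t0 := (@Ordinal 3 0 isT).
Notation t1 := (@Ordinal 3 1 isT).
Notation t2 := (@Ordinal 3 2 isT).

Definition area2 n (u v : 'cV[R]_n) : R := dotp u u * dotp v v - dotp u v ^+ 2.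

Lemma mapping_eltP k (G : set 'M[R]_4) (p q : 'I_k -> 'cV[R]_4) :
  (exists g, G g /\ same_simplex q (rotate g p)) ->
  G (mapping_elt G p q) /\ same_simplex q (rotate (mapping_elt G p q) p).
Proof.
by move=> [g gP]; rewrite /mapping_elt; case: xgetP => [_ _ //|/(_ g)].
Qed.

Let area2_form (x y y' : R) : area2 (cv x 0 0 0) (cv y y' 0 0) = (x * y') ^+ 2.
Proof. by rewrite /area2 !dotp_cv; ring. Qed.

Lemma triangle_form_gt0 l (q : 'I_3 -> 'cV[R]_4) x y y' : realizes l q ->
  0 < area2 (edge q t0 t1) (edge q t0 t2) ->
  triangle_form x y y' (ref_triangle l) -> 0 < x /\ 0 < y'.
Proof.
move=> ql qA [x0 y0 r1 r2]; have [rl _] := ref_triangleP ql.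
have := realizes_dot ql rl t0; rewrite /area2 in qA => D; rewrite !D in qA.
move: qA; rewrite r1 r2 -/(area2 _ _) area2_form lt0r sqr_ge0 andbT sqrf_eq0.
by rewrite mulf_eq0 negb_or => /andP[x_0 y_0]; rewrite !lt0r x_0 y_0 x0 y0.
Qed.

Lemma mapping_triangle l (q : 'I_3 -> 'cV[R]_4) : realizes l q ->
  (forall i j, edge q i j o3 ord0 = 0) ->
  0 < area2 (edge q t0 t1) (edge q t0 t2) ->
  exists k, SO3 k /\ same_simplex q (rotate k (ref_triangle l)).
Proof.
move=> ql q0 qA; have [rl [x [y [y' rf]]]] := ref_triangleP ql.
have [xp _] := triangle_form_gt0 ql qA rf; have [x0 y0 r1 r2] := rf.
have [F [s [t [t' [[[FF F1] F4] s0 t0' q1 q2]]]]] := frame_SO3 (q0 t0 t1) (q0 t0 t2).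
have FT := orthogonalC FF.
have D i j : dotp (edge q t0 i) (edge q t0 j) =
  dotp (edge (ref_triangle l) t0 i) (edge (ref_triangle l) t0 j) by exact: (realizes_dot ql rl).
have D11 := D t1 t1; have D12 := D t1 t2; have D22 := D t2 t2.
rewrite r1 q1 dotp_orthogonal// !dotp_cv !mulr0 !addr0 in D11.
rewrite r1 r2 q1 q2 dotp_orthogonal// !dotp_cv !(mulr0, mul0r) !addr0 in D12.
rewrite r2 q2 dotp_orthogonal// !dotp_cv !mulr0 !addr0 in D22.
have [xs yt yt' _] := triangular_unique 0 0 0 0 x0 y0 (lexx 0) s0 t0' (lexx 0)
  (esym D11) (esym D12) (esym D22) xp.
have z0 : ord0 = t0 by exact: val_inj.
exists F; split=> //; apply: same_from0; apply: ord3P => // _; rewrite edge_rotate.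
  by rewrite z0 q1 r1 xs.
by rewrite z0 q2 r2 yt yt'.
Qed.

Lemma mapping_tetra l (q : 'I_4 -> 'cV[R]_4) : realizes l q ->
  0 < area2 (edge q o0 o1) (edge q o0 o2) ->
  exists g, SO4 g /\ same_simplex q (rotate g (ref_tetrahedron l)).
Proof.
move=> ql qA; have [rl [x [y [y' [z [z' [z'' [[x0 y0 z0] [r1 r2 r3]]]]]]]]] :=
  ref_tetrahedronP ql.
have D i j : dotp (edge q o0 i) (edge q o0 j) =
    dotp (edge (ref_tetrahedron l) o0 i) (edge (ref_tetrahedron l) o0 j).
  exact: (realizes_dot ql rl).
have [xp yp] : 0 < x /\ 0 < y'.
  move: qA; rewrite /area2 !D r1 r2 -/(area2 _ _) area2_form lt0r sqr_ge0 andbT.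
  rewrite sqrf_eq0 mulf_eq0 negb_or => /andP[x_0 y_0].
  by rewrite !lt0r x_0 y_0 x0 y0.
have [F [s [t [t' [w [w' [w'' [[FF F1] [s0 t0 w0] [q1 q2 q3]]]]]]]]] :=
  frame_SO4 (edge q o0 o1) (edge q o0 o2) (edge q o0 o3).
have FT := orthogonalC FF.
have := (D o1 o1, D o1 o2, D o2 o2, D o1 o3, D o2 o3, D o3 o3).
rewrite r1 r2 r3 q1 q2 q3 !dotp_orthogonal// !dotp_cv !(mulr0, mul0r) !addr0.
move=> -[[[[[D11 D12] D22] D13] D23] D33].
have [xs yt yt' zw] := triangular_unique z z' w w' x0 y0 z0 s0 t0 w0
  (esym D11) (esym D12) (esym D22) xp.
have [zE zE' zE''] := zw (esym D13) (esym D23) (esym D33) yp.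
have oz : ord0 = o0 by exact: val_inj.
exists F; split=> //; apply: same_from0; apply: ord4P => // _; rewrite edge_rotate.
- by rewrite oz q1 r1 xs.
- by rewrite oz q2 r2 yt yt'.
- by rewrite oz q3 r3 zE zE' zE''.
Qed.

Definition rows4 (v : seq 'cV[R]_4) : 'M[R]_4 := \matrix_(r < 4) (nth 0 v r)^T.

Lemma rows4_mul g u1 u2 u3 u4 : rows4 [:: g *m u1; g *m u2; g *m u3; g *m u4] =
  rows4 [:: u1; u2; u3; u4] *m g^T.
Proof.
apply/row_matrixP => i; rewrite rowK row_mul rowK.
by move: i; apply: ord4P; rewrite /= trmx_mul.
Qed.

Lemma det_rows4 (v : seq 'cV[R]_4) (a : nat -> nat -> R) :
  (forall r j : 'I_4, nth 0 v r j ord0 = a r j) -> \det (rows4 v) = det4 a.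
Proof. by move=> va; apply: det4E => i j; rewrite !mxE. Qed.

Definition ref_tet (bar : bool) (l : 'I_4 -> 'I_4 -> R) : 'I_4 -> 'cV[R]_4 :=
  if bar then flipped_ref_tetrahedron l else ref_tetrahedron l.

(** The rotations attached to the faces of a tetrahedron send e_4 to the same
    normal vector; the flip of the reference tetrahedron reverses it. *)
Lemma face_frame (bar : bool) l (q : 'I_4 -> 'cV[R]_4) : realizes l q ->
  (forall i j m : 'I_4, i != j -> i != m -> j != m ->
     0 < area2 (edge q i j) (edge q i m)) ->
  exists N, [/\ dotp N N = 1, forall i j, dotp N (edge q i j) = 0,
    0 <= (-1) ^+ bar * \det (rows4 [:: edge q o0 o1; edge q o0 o2; edge q o0 o3; N]) &
    forall f : 'I_4, let M := mapping_elt (@SO4 R) (ref_tet bar l) q *m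
        face_elt (ref_tet bar l) l f in
      [/\ SO4 M, M *m e4 = N & forall i j, edge q (lift f i) (lift f j) =
        M *m edge (ref_triangle (fun i j => l (lift f i) (lift f j))) i j]].
Proof.
move=> ql qA; have [rl [x [y [y' [z [z' [z'' [[x0 y0 z0] [r1 r2 r3]]]]]]]]] :=
  ref_tetrahedronP ql.
have [g0 [[g0g0 g01] g0q]] := mapping_tetra ql (qA o0 o1 o2 isT isT isT).
set tau := ref_tet bar l; pose eps : R := (-1) ^+ bar.
have hpi (u v w : R) : h pi *m cv u v w 0 = cv u v (- w) 0.
  by rewrite hE cospi sinpi; congr (vec4 (_, _, _, _)); ring.
have tau_form : [/\ edge tau o0 o1 = cv x 0 0 0, edge tau o0 o2 = cv y y' 0 0 &
    edge tau o0 o3 = cv z z' (eps * z'') 0].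
  rewrite /tau /ref_tet /eps; case: (bar); rewrite ?expr1 ?expr0 ?mul1r; last by split.
  by rewrite /flipped_ref_tetrahedron !edge_rotate r1 r2 r3 !hpi oppr0 mulN1r.
have [e1 e2 e3] := tau_form.
have [hh h1] := @h_SO4 R pi; have hT := orthogonalC hh.
have [[gg g1] gq] : SO4 (mapping_elt (@SO4 R) tau q) /\
    same_simplex q (rotate (mapping_elt (@SO4 R) tau q) tau).
  apply: mapping_eltP; rewrite /tau /ref_tet; case: (bar); last by exists g0.
  exists (g0 *m (h pi)^T); split; first split.
  - by rewrite trmx_mul trmxK mulmxA -(mulmxA g0) hT mulmx1.
  - by rewrite det_mulmx det_tr g01 h1 mulr1.
  - move=> i j; rewrite g0q !edge_rotate.
    by rewrite -!mulmxA (mulmxA _ (h pi)) hT mul1mx.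
set g := mapping_elt (@SO4 R) tau q in gg g1 gq *; have gT := orthogonalC gg.
have qE i j : edge q i j = g *m edge tau i j by rewrite gq edge_rotate.
have tau0 i j : edge tau i j o3 ord0 = 0.
  have c0 k : edge tau o0 k o3 ord0 = 0.
    move: k; apply: ord4P; rewrite ?e1 ?e2 ?e3; last 3 first; try by rewrite mxE.
    by rewrite /edge subrr mxE.
  have -> : edge tau i j = edge tau o0 j - edge tau o0 i.
    by rewrite /edge opprB addrA subrK.
  by rewrite mxE [X in _ + X]mxE !c0 subr0.
have taul : realizes l tau.
  move=> i j ij; rewrite -(ql i j ij) qE /enorm dotp_orthogonal//.
exists (g *m e4); split.
- by rewrite dotp_orthogonal// dotp_cv; ring.
- move=> i j; rewrite qE dotp_orthogonal// (cvE (edge tau i j)) dotp_cv tau0; ring.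
- rewrite !qE rows4_mul det_mulmx det_tr g1 mulr1 e1 e2 e3.
  rewrite (@det_rows4 _ (fun r j => nth 0 (nth [::] [:: [:: x; 0; 0; 0];
    [:: y; y'; 0; 0]; [:: z; z'; eps * z''; 0]; [:: 0; 0; 0; 1]] r) j)); last first.
    by apply: ord4P => j /=; rewrite mxE.
  rewrite /det4/= -/eps [X in 0 <= X](_ : _ = (eps * eps) * (x * y' * z'')); last by ring.
  by rewrite /eps -expr2 sqrr_sign mul1r !mulr_ge0.
move=> f M; have lift_neq (i j : 'I_3) : i != j -> lift f i != lift f j.
  by move=> ij; rewrite (inj_eq (@lift_inj _ f)).
have [[[kk k1] k4] kq] : SO3 (face_elt tau l f) /\
    same_simplex (tau \o lift f) (rotate (face_elt tau l f)
      (ref_triangle (fun i j => l (lift f i) (lift f j)))).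
  apply: mapping_eltP; apply: mapping_triangle => [i j ij|i j|].
  - by apply: taul; rewrite /= ltnNge leq_bump2 -ltnNge.
  - exact: tau0.
  - have := qA (lift f t0) (lift f t1) (lift f t2) (@lift_neq t0 t1 isT)
      (@lift_neq t0 t2 isT) (@lift_neq t1 t2 isT).
    by rewrite !qE /area2 !dotp_orthogonal.
split; first split.
- by rewrite /M trmx_mul mulmxA -(mulmxA g) kk mulmx1.
- by rewrite /M det_mulmx g1 k1 mulr1.
- by rewrite /M -mulmxA -basis4_3 k4.
- move=> i j; rewrite qE -[edge tau _ _]/(edge (tau \o lift f) i j) kq.
  by rewrite edge_rotate mulmxA.
Qed.

(** The remaining block is orthogonal with determinant 1. *)
Lemma fix_plane (H : 'M[R]_4) : SO4 H -> H *m cv 1 0 0 0 = cv 1 0 0 0 ->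
  H *m cv 0 1 0 0 = cv 0 1 0 0 -> exists theta, H = h theta.
Proof.
move=> [HH H1] c0 c1; have HT := orthogonalC HH.
have c0E i : H i o0 = (i == o0)%:R.
  have /matrixP/(_ i ord0) := c0; rewrite [LHS]mxE sum_ord4 !mxE/= !mulr0 !addr0 mulr1 => ->.
  by move: i; apply: ord4P.
have c1E i : H i o1 = (i == o1)%:R.
  have /matrixP/(_ i ord0) := c1; rewrite [LHS]mxE sum_ord4 !mxE/= !mulr0 !addr0 add0r mulr1 => ->.
  by move: i; apply: ord4P.
have dot_rows i j : \sum_(k < 4) H i k * H j k = (i == j)%:R.
  have /matrixP/(_ i j) := HH; rewrite !mxE => <-; apply: eq_bigr => k _.
  by rewrite mxE.
have dot_cols i j : \sum_(k < 4) H k i * H k j = (i == j)%:R.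
  have /matrixP/(_ i j) := HT; rewrite !mxE => <-; apply: eq_bigr => k _.
  by rewrite mxE.
have r0E j : j != o0 -> H o0 j = 0.
  move=> j0; have := dot_cols o0 j; rewrite sum_ord4 !c0E/= !mul0r !addr0 mul1r => ->.
  by rewrite eq_sym (negbTE j0).
have r1E j : j != o1 -> H o1 j = 0.
  move=> j1; have := dot_cols o1 j; rewrite sum_ord4 !c1E/= !mul0r !addr0 add0r mul1r => ->.
  by rewrite eq_sym (negbTE j1).
have := dot_cols o2 o2; rewrite sum_ord4 r0E// r1E// !mul0r !add0r/= => n1.
have := dot_cols o3 o3; rewrite sum_ord4 r0E// r1E// !mul0r !add0r/= => n2.
have d1 : H o2 o2 * H o3 o3 - H o2 o3 * H o3 o2 = 1.
  rewrite -H1 (@det4E _ _ (fun i j => nth 0 (nth [::] [:: [:: 1; 0; 0; 0];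
    [:: 0; 1; 0; 0]; [:: 0; 0; H o2 o2; H o2 o3]; [:: 0; 0; H o3 o2; H o3 o3]] i) j)).
    by rewrite /det4/=; ring.
  by apply: ord4P; apply: ord4P; rewrite ?c0E ?c1E ?r0E ?r1E.
have sq0 : (H o3 o3 - H o2 o2) ^+ 2 + (H o2 o3 + H o3 o2) ^+ 2 = 0.
  rewrite (_ : _ + _ = (H o2 o2 * H o2 o2 + H o3 o2 * H o3 o2) +
    (H o2 o3 * H o2 o3 + H o3 o3 * H o3 o3) -
    2 * (H o2 o2 * H o3 o3 - H o2 o3 * H o3 o2)); last by ring.
  by rewrite n1 n2 d1; ring.
have [h33 h23] : H o3 o3 = H o2 o2 /\ H o2 o3 = - H o3 o2.
  move/eqP: sq0; rewrite paddr_eq0 ?sqr_ge0// !sqrf_eq0 subr_eq0 addr_eq0.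
  by move=> /andP[/eqP-> /eqP->].
have [theta [cE sE]] : exists theta : R, H o2 o2 = cos theta /\ H o3 o2 = sin theta.
  have [s0|s0] := leP 0 (H o3 o2).
    have [|t _ []] := @polar R (H o2 o2) (H o3 o2) 1 s0 ler01.
      by rewrite expr1n !expr2.
    by rewrite !mul1r; exists t.
  have [||t _ []] := @polar R (H o2 o2) (- H o3 o2) 1 _ ler01.
  - by rewrite oppr_ge0 ltW.
  - by rewrite expr1n sqrrN !expr2.
  rewrite !mul1r => cE /(canRL (@opprK R)) sE.
  by exists (- t); rewrite cosN sinN.
exists theta; apply/matrixP => i j; rewrite h_entry.
by move: i j; apply: ord4P; apply: ord4P;
  rewrite /= ?c0E ?c1E ?r0E ?r1E ?h33 ?h23 ?cE ?sE.
Qed.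

End MappingElements.
(** * Phases around a triangle *)

Section UnitComplexNumbers.
Variable R : realType.

Definition cis (x : R) : R[i] := cos x +i* sin x.

Lemma cisD x y : cis (x + y) = cis x * cis y.
Proof. by rewrite /cis cosD sinD; simpc; rewrite addrC [sin x * _]mulrC [sin y * _]mulrC; congr (_ +i* _); ring. Qed.

Lemma cis0 : cis 0 = 1.
Proof. by rewrite /cis cos0 sin0. Qed.

Lemma cis_neq0 x : cis x != 0.
Proof.
have : cis x * cis (- x) = 1 by rewrite -cisD subrr cis0.
by apply: contra_eq_neq => ->; rewrite mul0r eq_sym oner_neq0.
Qed.

Lemma cisN x : cis (- x) = (cis x)^-1.
Proof.
apply: (mulfI (cis_neq0 x)); rewrite -cisD subrr cis0 mulfV//.
exact: cis_neq0.
Qed.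

Lemma cis_int (s : int) x : cis (s%:~R * x) = cis x ^ s.
Proof.
have nat_case n : cis (n%:R * x) = cis x ^+ n.
  elim: n => [|n IH]; first by rewrite mul0r cis0 expr0.
  by rewrite -natr1 mulrDl mul1r cisD IH exprSr.
case: s => n; first exact: nat_case.
by rewrite NegzE mulrNz mulNr cisN nat_case.
Qed.

(** Interior and exterior angles differ by a sign of the exponential. *)
Lemma cis_supplement (s : int) (sg theta phi : R) : sg ^+ 2 = 1 ->
  cos theta = - cos phi -> sin theta = - (sg * sin phi) ->
  cis (s%:~R * theta) = (-1) ^ s * cis (sg * (s%:~R * phi)).
Proof.
move=> /eqP sg1 cE sE; have -> : sg * (s%:~R * phi) = s%:~R * (sg * phi) by ring.
rewrite !cis_int; have -> : cis theta = -1 * cis (sg * phi).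
  rewrite /cis cE sE mulN1r; move: sg1; rewrite sqrf_eq1 => /orP[]/eqP->.
    by rewrite !mul1r; simpc.
  by rewrite !mulN1r cosN sinN; simpc.
by rewrite expfzMl.
Qed.

End UnitComplexNumbers.

Section FacePhases.
Variables (R : realType) (p : 'I_5 -> 'cV[R]_4) (l : 'I_5 -> 'I_5 -> R).
Hypothesis pl : realizes l p.
Let D := \det (edge_mx (vertex_edges p)).
Hypothesis D0 : D != 0.

Notation cv x y z t := (vec4 (x, y, z, t) : 'cV[R]_4).
Notation e4 := (cv 0 0 0 1).
Notation t0 := (@Ordinal 3 0 isT).
Notation t1 := (@Ordinal 3 1 isT).
Notation t2 := (@Ordinal 3 2 isT).

Lemma area2_gt0 (i j m : 'I_5) : i != j -> i != m -> j != m ->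
  0 < area2 (edge p i j) (edge p i m).
Proof.
move=> ij im jm; set a := edge p i j; set b := edge p i m.
have a0 : 0 < dotp a a.
  rewrite lt0r dotp_ge0 andbT dotp_eq0; apply/eqP => aE.
  have := dual_edge D0 j i j; rewrite -/a aE dotpC dotp0l eqxx (negbTE ij) subr0.
  by move/eqP; rewrite eq_sym oner_eq0.
pose v := dotp a a *: b - dotp a b *: a.
have vv : dotp v v = dotp a a * area2 a b.
  rewrite /v; move: a b {a0 v} => u w.
  by rewrite dotpBl !dotpBr !dotpZl !dotpZr /area2 (dotpC w u); ring.
rewrite -(pmulr_rgt0 _ a0) -vv lt0r dotp_ge0 andbT dotp_eq0; apply/eqP => v0.
have : dotp (dual p m) v = dotp a a.
  have da : dotp (dual p m) a = 0.
    by rewrite dual_edge// (negbTE im) (negbTE jm) subrr.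
  have db : dotp (dual p m) b = 1 by rewrite dual_edge// eqxx (negbTE im) subr0.
  by rewrite /v dotpBr !dotpZr da db mulr1 mulr0 subr0.
by rewrite v0 dotpC dotp0l => /eqP; rewrite eq_sym gt_eqF.
Qed.

Let det_rows (e0 : 'I_5) (s : seq 'I_5) : size s = 4 ->
  \det (rows4 [seq edge p e0 v | v <- s]) =
  det4 (fun r t => (t < nth e0 s r)%:R - (t < e0)%:R) * D.
Proof.
move=> s4; rewrite /D -det_from_vertex; congr (\det _); apply/row_matrixP => r.
by rewrite !rowK (nth_map e0) ?s4.
Qed.

Definition tet_ref (a : 'I_5) := ref_tet (odd a)
  (fun i j => l (lift a i) (lift a j)).

Definition tet_rotation (a : 'I_5) (f : 'I_4) : 'M[R]_4 :=
  mapping_elt (@SO4 R) (tet_ref a) (p \o lift a) *m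
  face_elt (tet_ref a) (fun i j => l (lift a i) (lift a j)) f.

(** The common normal of the face rotations is a positive multiple of the
    oriented gradient D * dual p a: the alternation between the two reference
    tetrahedra compensates the sign of the facet opposite to a. *)
Lemma tet_frame (a : 'I_5) : exists n : R, let N := n *: dual p a in
  [/\ dotp N N = 1, 0 < n * D &
    forall f : 'I_4, [/\ SO4 (tet_rotation a f), tet_rotation a f *m e4 = N &
      forall i j, edge p (lift a (lift f i)) (lift a (lift f j)) =
        tet_rotation a f *m edge (ref_triangle (fun i j =>
          l (lift a (lift f i)) (lift a (lift f j)))) i j]].
Proof.
have lift_neq (i j : 'I_4) : i != j -> lift a i != lift a j.
  by move=> ij; rewrite (inj_eq (@lift_inj _ a)).
have ql : realizes (fun i j => l (lift a i) (lift a j)) (p \o lift a).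
  by move=> i j ij; apply: pl; rewrite /= ltnNge leq_bump2 -ltnNge.
have [|N [NN Nq Ndet NM]] := face_frame (odd a) ql.
  by move=> i j m ij im jm; apply: area2_gt0; exact: lift_neq.
have N0 i j : i != a -> j != a -> dotp N (edge p i j) = 0.
  by case: (unliftP a i) => [i' ->|->]; case: (unliftP a j) => [j' ->|->];
    rewrite ?eqxx// => _ _; exact: Nq.
pose c0 := lift a o0; pose n := dotp N (edge p c0 a).
have NE : N = n *: dual p a by apply: facet_normal; rewrite // eq_sym neq_lift.
exists n; rewrite -NE /=; split=> //.
pose ws := [:: edge p c0 (lift a o1); edge p c0 (lift a o2); edge p c0 (lift a o3); N].
pose ts := [:: edge p c0 (lift a o1); edge p c0 (lift a o2); edge p c0 (lift a o3);
  edge p c0 a].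
have detT : \det (rows4 ts) = (-1) ^+ odd a * D.
  rewrite -[ts]/[seq edge p c0 v | v <- [:: lift a o1; lift a o2; lift a o3; a]].
  rewrite det_rows//; congr (_ * _); rewrite /c0 /=.
  rewrite /det4/=; move: (nat_of_ord a) (ltn_ord a).
  by move=> [|[|[|[|[|//]]]]] _; rewrite /bump/=; ring.
pose g : 'I_4 -> 'cV[R]_4 := fun i => nth 0 ts i.
have G0 : 0 < \det (gram 3 g).
  apply: (@det_gram_gt0 _ _ _ (rows4 ts)) => [//|i _|]; first by rewrite rowK.
  by rewrite detT mulf_neq0// signr_eq0.
have nG : \det (rows4 ws) * \det (rows4 ts) = n * \det (gram 3 g).
  rewrite -(det_tr (rows4 ts)) -det_mulmx.
  rewrite (@det4E _ (rows4 ws *m _) (fun i j => dotp (nth 0 ws i) (nth 0 ts j))); last first.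
    by move=> i j; rewrite mxE; apply: eq_bigr => k _; rewrite !mxE.
  rewrite (@det4E _ (gram 3 g) (fun i j => if (i < 3)%N && (j < 3)%N
    then dotp (nth 0 ts i) (nth 0 ts j) else (i == j)%:R)); last first.
    by move=> i j; rewrite mxE.
  rewrite /det4/= -/n !N0 ?neq_lift//; try by rewrite eq_sym neq_lift.
  ring.
rewrite -(pmulr_rgt0 _ G0) mulrA [_ * n]mulrC -nG detT.
have -> : \det (rows4 ws) * ((-1) ^+ odd a * D) * D =
    ((-1) ^+ odd a * \det (rows4 ws)) * D ^+ 2 by ring.
rewrite lt0r mulr_ge0 ?sqr_ge0 ?Ndet// andbT.
have n0 : n != 0.
  by apply: contra_eq_neq NN => n0; rewrite NE n0 scale0r dotp0l eq_sym oner_neq0.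
have : \det (rows4 ws) * \det (rows4 ts) != 0 by rewrite nG mulf_neq0// gt_eqF.
rewrite mulf_eq0 negb_or => /andP[w0 _].
by rewrite !mulf_neq0// signr_eq0.
Qed.

Let V0 : simplex_lengths l -> length_volume l = `|D|.
Proof. by move=> Hl; rewrite -(sqr_orientation (realizes_sqlen pl)). Qed.

(** The two rotations attached to a triangle differ by a rotation fixing the
    triangle, by an angle supplementary to the dihedral angle. *)
Lemma pair_phase (Phi : int -> 'M[R]_4 -> R[i]) (Hl : simplex_lengths l)
    (a b : 'I_5) (f f' : 'I_4) (e : 'I_3 -> 'I_5) (s : int) :
  phase_family Phi ->
  (forall i, lift a (lift f i) = e i) -> (forall i, lift b (lift f' i) = e i) ->
  a != b ->
  det4 (fun r t => (t < nth (e t0) [:: e t1; e t2; a; b] r)%:R - (t < e t0)%:R) =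
    1 :> R ->
  Phi s (tet_rotation a f) = (-1) ^ s *
    cis (Num.sg D * (s%:~R * dihedral_angle l a b)) * Phi s (tet_rotation b f').
Proof.
move=> HPhi ae be ab detab.
have [n [Nn nD Nf]] := tet_frame a; have [[MM M1] Me4 Mr] := Nf f.
have [n' [Nn' nD' Nf']] := tet_frame b; have [[KK K1] Ke4 Kr] := Nf' f'.
set M := tet_rotation a f in MM M1 Me4 Mr *; set K := tet_rotation b f' in KK K1 Ke4 Kr *.
pose q := ref_triangle (fun i j => l (e i) (e j)).
have MrE i j : edge p (e i) (e j) = M *m edge q i j.
  rewrite -!ae Mr; congr (_ *m edge (ref_triangle _) _ _).
  by apply/funext => k; apply/funext => m; rewrite !ae.
have KrE i j : edge p (e i) (e j) = K *m edge q i j.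
  rewrite -!be Kr; congr (_ *m edge (ref_triangle _) _ _).
  by apply/funext => k; apply/funext => m; rewrite !be.
have e_inj : injective e.
  by move=> i j; rewrite -!ae => /lift_inj/lift_inj.
have e_neq i j : i != j -> e i != e j by rewrite (inj_eq e_inj).
have e_a i : e i != a by rewrite -ae eq_sym neq_lift.
have e_b i : e i != b by rewrite -be eq_sym neq_lift.
have ql : realizes (fun i j => l (e i) (e j)) (p \o e).
  by move=> i j ij; apply: pl; rewrite /= -!ae /= ltnNge !leq_bump2 -ltnNge.
have [rl [x [y [y' rf]]]] := ref_triangleP ql.
have eA : 0 < area2 (edge p (e t0) (e t1)) (edge p (e t0) (e t2)).
  by apply: area2_gt0; exact: e_neq.
have [xp yp] := triangle_form_gt0 ql eA rf.
have [_ _ r1 r2] := rf; rewrite -/q in r1 r2.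
have KT := orthogonalC KK; have MT := orthogonalC MM.
pose H := K^T *m M.
have MH : M = K *m H by rewrite /H mulmxA KK mul1mx.
have Hq i j : H *m edge q i j = edge q i j.
  by rewrite /H -mulmxA -MrE KrE mulmxA KT mul1mx.
have H_SO4 : SO4 H.
  split; last by rewrite /H det_mulmx det_tr K1 M1 mulr1.
  by rewrite /H [(K^T *m M)^T]trmx_mul trmxK mulmxA -(mulmxA K^T) MM mulmx1.
have scale_cv c u v w t : c *: cv u v w t = cv (c * u) (c * v) (c * w) (c * t).
  by apply/matrixP => i j; rewrite (ord1 j) !mxE; move: i; apply: ord4P.
have H0 : H *m cv 1 0 0 0 = cv 1 0 0 0.
  have -> : cv 1 0 0 0 = x^-1 *: edge q t0 t1.
    by rewrite r1 scale_cv mulVf ?gt_eqF// !mulr0.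
  by rewrite -scalemxAr Hq.
have H1 : H *m cv 0 1 0 0 = cv 0 1 0 0.
  have -> : cv 0 1 0 0 = y'^-1 *: (edge q t0 t2 - y *: cv 1 0 0 0).
    rewrite r2 scale_cv; apply/matrixP => i j; rewrite (ord1 j) !mxE.
    by move: i; apply: ord4P => /=; field; rewrite gt_eqF.
  by rewrite -scalemxAr mulmxBr -scalemxAr Hq H0.
have [theta HE] := fix_plane H_SO4 H0 H1.
have He4 : H *m e4 = cv 0 0 (- sin theta) (cos theta).
  by rewrite HE hE; congr (vec4 (_, _, _, _)); ring.
have NM : n *: dual p a = K *m cv 0 0 (- sin theta) (cos theta).
  by rewrite -Me4 MH -mulmxA He4.
have cosE : cos theta = dotp (n *: dual p a) (n' *: dual p b).
  by rewrite NM -Ke4 dotp_orthogonal// dotp_cv; ring.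
have n0 : 0 < n * n'.
  have : 0 < (n * D) * (n' * D) by rewrite mulr_gt0.
  by rewrite mulrACA pmulr_lgt0// -expr2 lt0r sqr_ge0 sqrf_eq0 D0.
have sinD : sin theta * D < 0.
  pose ws := [:: edge p (e t0) (e t1); edge p (e t0) (e t2); n *: dual p a; n' *: dual p b].
  pose ts := [:: edge p (e t0) (e t1); edge p (e t0) (e t2); edge p (e t0) a; edge p (e t0) b].
  have detW : \det (rows4 ws) = - (x * y' * sin theta).
    rewrite /ws NM -Ke4 !KrE rows4_mul det_mulmx det_tr K1 mulr1 r1 r2.
    rewrite (@det_rows4 _ _ (fun r j => nth 0 (nth [::] [:: [:: x; 0; 0; 0];
      [:: y; y'; 0; 0]; [:: 0; 0; - sin theta; cos theta]; [:: 0; 0; 0; 1]] r) j)).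
      by rewrite /det4/=; ring.
    by apply: ord4P => j /=; rewrite mxE.
  have detT : \det (rows4 ts) = D.
    rewrite -[ts]/[seq edge p (e t0) v | v <- [:: e t1; e t2; a; b]].
    by rewrite det_rows// detab mul1r.
  have WT : \det (rows4 ws) * \det (rows4 ts) =
      area2 (edge p (e t0) (e t1)) (edge p (e t0) (e t2)) * (n * n').
    rewrite -(det_tr (rows4 ts)) -det_mulmx.
    rewrite (@det4E _ (rows4 ws *m _) (fun i j => dotp (nth 0 ws i) (nth 0 ts j))); last first.
      by move=> i j; rewrite mxE; apply: eq_bigr => k _; rewrite !mxE.
    rewrite /det4/= /area2 !dotpZl !dual_edge// !eqxx !(negbTE (e_a _)) !(negbTE (e_b _)).
    rewrite (negbTE ab) [b == a]eq_sym (negbTE ab).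
    rewrite (dotpC (edge p (e t0) (e t2)) (edge p (e t0) (e t1))).
    by rewrite ?mulr1n ?mulr0n subr0 subrr; ring.
  have : 0 < \det (rows4 ws) * \det (rows4 ts) by rewrite WT mulr_gt0.
  by rewrite detW detT mulNr oppr_gt0 -[_ * _ * D]mulrA pmulr_rlt0 ?mulr_gt0.
pose c := dotp (outward_normal (euclidean_simplex l) a)
  (outward_normal (euclidean_simplex l) b).
have cE : c = cos theta.
  have pl' : realizes l (euclidean_simplex l).
    rewrite /euclidean_simplex; case: xgetP => [//|/(_ p)]; exact.
  have D0' : \det (edge_mx (vertex_edges (euclidean_simplex l))) != 0.
    by rewrite -normr_eq0 (sqr_orientation (realizes_sqlen pl')) V0// normr_eq0.
  have dd i j : dotp (dual (euclidean_simplex l) i) (dual (euclidean_simplex l) j) =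
      dotp (dual p i) (dual p j).
    rewrite !dot_dual// -(edge_gramE (realizes_sqlen pl)).
    by rewrite -(edge_gramE (realizes_sqlen pl')).
  rewrite /c dot_outward_normal// !dd cosE dotpZl dotpZr mulrA.
  rewrite mulrC; congr (_ * _).
  have := congr2 *%R Nn Nn'; rewrite /= mulr1 !dotpZl !dotpZr => nn.
  have [da db] := (dual_neq0 D0 a, dual_neq0 D0 b).
  rewrite -sqrtrM ?ltW//; apply: (mulIf (_ : Num.sqrt (dotp (dual p a) (dual p a) *
    dotp (dual p b) (dual p b)) != 0)); first by rewrite gt_eqF// sqrtr_gt0 mulr_gt0.
  rewrite mulVf; last by rewrite gt_eqF// sqrtr_gt0 mulr_gt0.
  rewrite -[n * n']ger0_norm ?ltW// -sqrtr_sqr -sqrtrM ?sqr_ge0//.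
  by rewrite -[LHS]sqrtr1 -nn; congr Num.sqrt; ring.
have c1 : -1 <= c <= 1 by rewrite cE cos_geN1 cos_le1.
set phi := dihedral_angle l a b.
have phiE : phi = pi - acos c by [].
have cos_phi : cos phi = - c by rewrite phiE cosB cospi sinpi acosK ?in_itv//; ring.
have sin_phi : sin phi = Num.sqrt (1 - c ^+ 2).
  by rewrite phiE sinB cospi sinpi sin_acos//; ring.
have sg2 : Num.sg D ^+ 2 = 1 by rewrite sqr_sg D0.
have sinE : sin theta = - (Num.sg D * sin phi).
  rewrite sin_phi cE.
  have -> : 1 - cos theta ^+ 2 = sin theta ^+ 2.
    by rewrite -(cos2Dsin2 theta) addrAC subrr add0r.
  rewrite sqrtr_sqr; case: (ltgtP D 0) sinD D0 => [D_lt|D_gt|->]; rewrite ?eqxx// => sD _.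
    rewrite ltr0_sg// gtr0_norm ?mulN1r ?opprK//.
    by move: sD; rewrite nmulr_llt0.
  rewrite gtr0_sg// ltr0_norm ?mul1r ?opprK//.
  by move: sD; rewrite pmulr_llt0.
have cosE' : cos theta = - cos phi by rewrite cos_phi opprK cE.
have [_ _ Phi_h] := HPhi s.
rewrite MH HE Phi_h; last by split.
by rewrite -[(_ +i* _)]/(cis (s%:~R * theta)) (cis_supplement s sg2 cosE' sinE).
Qed.

End FacePhases.
(** * The 10j symbol of a simplex *)

Notation p0 := (@Ordinal 5 0 isT).
Notation p1 := (@Ordinal 5 1 isT).
Notation p2 := (@Ordinal 5 2 isT).
Notation p3 := (@Ordinal 5 3 isT).
Notation p4 := (@Ordinal 5 4 isT).

Section SumsOverPairs.

Lemma inord5 : (inord 0 = p0) * (inord 1 = p1) * (inord 2 = p2) *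
  (inord 3 = p3) * (inord 4 = p4).
Proof. by do ![split]; apply: val_inj; rewrite /= inordK. Qed.

Lemma sum_pairs (V : nmodType) (F : 'I_5 -> 'I_5 -> V) :
  \sum_(a < 5) \sum_(b < 5 | (a < b)%N) F a b =
  F p0 p1 + F p0 p2 + F p0 p3 + F p0 p4 + F p1 p2 + F p1 p3 + F p1 p4 +
  F p2 p3 + F p2 p4 + F p3 p4.
Proof.
under eq_bigr do rewrite big_mkcond !big_ord_recl big_ord0.
rewrite !big_ord_recl big_ord0 /= !(add0r, addr0) !addrA.
by do ![congr (_ + _)|congr F|apply: val_inj].
Qed.

Lemma signz (F : fieldType) (n : int) : (-1 : F) ^ n = (-1) ^+ odd `|n|%N.
Proof.
case: n => n; first by rewrite -exprnP signr_odd.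
by rewrite NegzE -exprnN abszN signr_odd -signr_odd invr_sign signr_odd.
Qed.

End SumsOverPairs.

Section Integrand.
Variables (R : realType) (Phi : int -> 'M[R]_4 -> R[i]).
Hypothesis HPhi : phase_family Phi.
Variables (l : 'I_5 -> 'I_5 -> R) (s : 'I_5 -> 'I_5 -> 'I_5 -> int).
Hypothesis Hl : simplex_lengths l.

Notation t0 := (@Ordinal 3 0 isT).
Notation t1 := (@Ordinal 3 1 isT).
Notation t2 := (@Ordinal 3 2 isT).

(* The label of the triangle opposite to the vertices a and b. *)
Variable S : 'I_5 -> 'I_5 -> int.
Hypothesis HS : forall (a : 'I_5) (f : 'I_4),
  s (lift a (lift f t0)) (lift a (lift f t1)) (lift a (lift f t2)) = S a (lift a f).
Hypothesis S_sym : forall a b, S a b = S b a.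

Definition angle_sum : R :=
  \sum_(a < 5) \sum_(b < 5 | (a < b)%N) (S a b)%:~R * dihedral_angle l a b.

Definition label_sum : int := \sum_(a < 5) \sum_(b < 5 | (a < b)%N) S a b.

Lemma orientationE (p : pentagon R) :
  orientation p = \det (edge_mx (vertex_edges (pentagon_simplex p))).
Proof.
congr (\det _); apply/row_matrixP => k; rewrite !rowK; congr (_ ^T).
rewrite /vertex_edges -[_ - _]/(edge _ _ _) edge_pentagon !inordK ?leqnSn//;
  try by rewrite ltnS ?ltn_ord// ltnW// ltn_ord.
by rewrite path_edgeS.
Qed.

(** In each of the ten quotients the numerator belongs to the tetrahedron with
    the smaller index exactly when the indices have different parity; this is
    the order in which the determinant of pair_phase is 1. *)
Lemma integrandE (p : pentagon R) : P_l l p ->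
  tenj_integrand Phi l s p =
  (-1) ^ label_sum * cis (Num.sg (orientation p) * angle_sum).
Proof.
move=> pl; set q := pentagon_simplex p in pl *.
have D0 : \det (edge_mx (vertex_edges q)) != 0.
  rewrite -normr_gt0 (sqr_orientation (realizes_sqlen pl)).
  exact: length_volume_gt0.
pose P a f := Phi (S a (lift a f)) (tet_rotation q l a f).
have P0 a f : P a f != 0.
  have [n [_ _ /(_ f)[SM _ _]]] := tet_frame pl D0 a.
  by have [nz _ _] := HPhi (S a (lift a f)); exact: nz.
have dihC a b : dihedral_angle l a b = dihedral_angle l b a.
  by rewrite /dihedral_angle dotpC.
set sg := Num.sg _; pose z a b := (-1) ^ S a b *
  cis (sg * ((S a b)%:~R * dihedral_angle l a b)).
have zC a b : z a b = z b a by rewrite /z S_sym dihC.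
have pair (a b : 'I_5) (f f' : 'I_4) : (forall i, lift b (lift f' i) = lift a (lift f i)) -> a != b ->
    lift a f = b -> lift b f' = a ->
    det4 (fun r t => (t < (nth (lift a (lift f t0)) [:: lift a (lift f t1);
      lift a (lift f t2); a; b] r : 'I_5))%:R - (t < lift a (lift f t0))%:R) = 1 :> R ->
    P a f = z a b * P b f'.
  move=> ff ab fb fa d1; rewrite /P fb fa (S_sym b a) /z /sg orientationE.
  by apply: (pair_phase pl D0 Hl (e := fun i => lift a (lift f i))).
have -> : tenj_integrand Phi l s p =
    (P p1 o3 * P p1 o1) / (P p1 o2 * P p1 o0) *
    ((P p3 o3 * P p3 o1) / (P p3 o2 * P p3 o0)) *
    ((P p0 o2 * P p0 o0) / (P p0 o3 * P p0 o1)) *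
    ((P p2 o2 * P p2 o0) / (P p2 o3 * P p2 o1)) *
    ((P p4 o2 * P p4 o0) / (P p4 o3 * P p4 o1)).
  rewrite /P -!HS /tenj_integrand /mbar_tet /m_tet /face_phase /face_label.
  by rewrite /= !inord5 !inord4 !inord3.
have E (a b : 'I_5) (f f' : 'I_4) : b = bump a f :> nat -> a = bump b f' :> nat ->
    det4 (fun r t => (t < nth (bump a (bump f 0)) [:: bump a (bump f 1);
      bump a (bump f 2); nat_of_ord a; nat_of_ord b] r)%:R -
      (t < bump a (bump f 0))%:R) = 1 :> R ->
    (forall i : 'I_3, bump b (bump f' i) = bump a (bump f i)) ->
    P a f = z a b * P b f'.
  move=> bE aE d1 ee; apply: pair; try by [apply: val_inj|move=> i; apply: val_inj; rewrite /= ee].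
    by rewrite -val_eqE/= bE neq_bump.
  rewrite -[RHS]d1; congr det4; apply/funext => r; apply/funext => t.
  by case: r => [|[|[|[|r]]]] //=; rewrite !nth_nil.
have e01 : P p0 o0 = z p0 p1 * P p1 o0.
  by apply: E; [| |rewrite /det4 /bump/=; ring|exact: ord3P].
have e02 : P p2 o0 = z p2 p0 * P p0 o1.
  by apply: E; [| |rewrite /det4 /bump/=; ring|exact: ord3P].
have e03 : P p0 o2 = z p0 p3 * P p3 o0.
  by apply: E; [| |rewrite /det4 /bump/=; ring|exact: ord3P].
have e04 : P p4 o0 = z p4 p0 * P p0 o3.
  by apply: E; [| |rewrite /det4 /bump/=; ring|exact: ord3P].
have e12 : P p1 o1 = z p1 p2 * P p2 o1.
  by apply: E; [| |rewrite /det4 /bump/=; ring|exact: ord3P].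
have e13 : P p3 o1 = z p3 p1 * P p1 o2.
  by apply: E; [| |rewrite /det4 /bump/=; ring|exact: ord3P].
have e14 : P p1 o3 = z p1 p4 * P p4 o1.
  by apply: E; [| |rewrite /det4 /bump/=; ring|exact: ord3P].
have e23 : P p2 o2 = z p2 p3 * P p3 o2.
  by apply: E; [| |rewrite /det4 /bump/=; ring|exact: ord3P].
have e24 : P p4 o2 = z p4 p2 * P p2 o3.
  by apply: E; [| |rewrite /det4 /bump/=; ring|exact: ord3P].
have e34 : P p3 o3 = z p3 p4 * P p4 o3.
  by apply: E; [| |rewrite /det4 /bump/=; ring|exact: ord3P].
transitivity (z p0 p1 * z p0 p2 * z p0 p3 * z p0 p4 * z p1 p2 * z p1 p3 *
  z p1 p4 * z p2 p3 * z p2 p4 * z p3 p4).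
  rewrite (zC p0 p2) (zC p0 p4) (zC p1 p3) (zC p2 p4).
  move: (P) (z) P0 e01 e02 e03 e04 e12 e13 e14 e23 e24 e34 => Q y Q0.
  by move=> -> -> -> -> -> -> -> -> -> ->; field; rewrite !Q0.
have m1 : (-1 : R[i]) != 0 by rewrite oppr_eq0 oner_eq0.
rewrite /label_sum /angle_sum !sum_pairs /z; move: (dihedral_angle l) => dih.
rewrite !expfzDr// !mulrDr !cisD.
have [m mE] : exists m : int -> R[i], forall n, (-1) ^ n = m n by eexists.
by rewrite !mE; ring.
Qed.

Variables (mu : {measure set (pentagon R) -> \bar R}).
Hypothesis Hmu : is_P_l_measure l mu.

Let part sg : set (pentagon R) := P_l l `&` [set p | 0 < sg * orientation p].

Let m_part sg : measurable (part sg).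
Proof. by apply: measurableI; [exact: measurable_P_l|exact: measurable_oriented]. Qed.

Let P_l_split : P_l l = part 1 `|` part (-1).
Proof.
apply/seteqP; split=> [p pl|p [[]|[]]//].
have : orientation p != 0.
  rewrite orientationE -normr_gt0 (sqr_orientation (realizes_sqlen pl)).
  exact: length_volume_gt0.
rewrite neq_lt => /orP[neg|pos]; [right|left]; split=> //=; rewrite ?mul1r//.
by rewrite mulN1r oppr_gt0.
Qed.

Let part_excl p : part 1 p -> part (-1) p -> False.
Proof.
move=> [_ /= pos] [_ /=]; rewrite mulN1r oppr_gt0; rewrite mul1r in pos.
by move=> /(lt_trans pos); rewrite ltxx.
Qed.

Let part_disjoint : [disjoint part 1 & part (-1)].
Proof. by apply/disj_setPS => p [/part_excl]; apply. Qed.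

(** The two orientations contribute complex conjugate values with equal mass,
    which leaves the cosine. *)
Lemma tenj_symbolE (mu' : ('I_5 -> 'I_5 -> R) -> {measure set (pentagon R) -> \bar R}) :
  mu' l = mu ->
  tenj_symbol Phi mu' l s = (-1) ^ label_sum * (cos angle_sum / V4 l)%:C.
Proof.
move=> muE; rewrite /tenj_symbol muE (V4E Hl) signz.
set b := odd _; set V := length_volume l; set Th := angle_sum.
have V0 : 0 < V by exact: length_volume_gt0.
have mass sg : `|sg| = 1 -> mu (part sg) = ((2 * V)^-1)%:E.
  by move=> sg1; rewrite (oriented_mass Hmu Hl sg1).
have intE sg (f : pentagon R -> R) (c : R) : `|sg| = 1 ->
    (forall p, part sg p -> f p = c) ->
    (\int[mu]_(p in part sg) (f p)%:E = (c / (2 * V))%:E)%E.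
  move=> sg1 fc; rewrite (eq_integral (cst c%:E)); last first.
    by move=> p; rewrite inE => /fc ->.
  by rewrite integral_cst// mass// -EFinM.
have RintE (f : pentagon R -> R) (c1 c2 : R) :
    (forall p, part 1 p -> f p = c1) -> (forall p, part (-1) p -> f p = c2) ->
    Rintegral mu (P_l l) f = (c1 + c2) / (2 * V).
  move=> f1 f2; rewrite /Rintegral P_l_split.
  rewrite (eq_integral (fun p => (c1 * \1_(part 1) p + c2 * \1_(part (-1)) p)%:E)); last first.
    move=> p; rewrite inE !indicE => -[pp|pp].
      rewrite (f1 p pp) (mem_set pp) memNset ?mulr1 ?mulr0 ?addr0//.
      by move=> pp'; apply: (@part_excl p).
    rewrite (f2 p pp) (mem_set pp) memNset ?mulr1 ?mulr0 ?add0r//.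
    by move=> pp'; apply: (@part_excl p).
  rewrite integral_setU_EFin//=; last first.
    apply: measurable_funTS; apply: measurable_funD; apply: measurable_funM => //;
      by apply: measurable_indic.
  rewrite (intE 1 _ c1) ?normr1//; last first.
    move=> p pp; rewrite !indicE (mem_set pp) memNset ?mulr1 ?mulr0 ?addr0//.
    by move=> pp'; apply: (@part_excl p).
  rewrite (intE (-1) _ c2) ?normrN1//; last first.
    move=> p pp; rewrite !indicE (mem_set pp) memNset ?mulr1 ?mulr0 ?add0r//.
    by move=> pp'; apply: (@part_excl p).
  by rewrite -EFinD /= [RHS]mulrDl.
have integrand sg p : sg ^+ 2 = 1 -> part sg p -> tenj_integrand Phi l s p =
    ((-1) ^+ b * cos Th) +i* ((-1) ^+ b * (sg * sin Th)).
  move=> /eqP sg1 [pl /= sp]; rewrite integrandE// signz -/b -/Th.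
  have -> : Num.sg (orientation p) = sg.
    move: sg1 sp; rewrite sqrf_eq1 => /orP[]/eqP->.
      by rewrite mul1r => /gtr0_sg.
    by rewrite mulN1r oppr_gt0 => /ltr0_sg.
  rewrite /cis; move: sg1; rewrite sqrf_eq1 => /orP[]/eqP->;
    rewrite ?mulN1r ?mul1r ?cosN ?sinN; case: b; rewrite ?expr0 ?expr1; simpc => //;
    by rewrite ?opprK.
have [r1 r2] : (1 : R) ^+ 2 = 1 /\ (-1 : R) ^+ 2 = 1.
  by rewrite expr1n sqrrN expr1n.
rewrite (RintE _ ((-1) ^+ b * cos Th) ((-1) ^+ b * cos Th)); last 2 first.
- by move=> p pp; rewrite (integrand 1 p r1 pp).
- by move=> p pp; rewrite (integrand (-1) p r2 pp).
rewrite (RintE _ ((-1) ^+ b * sin Th) (- ((-1) ^+ b * sin Th))); last 2 first.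
- by move=> p pp; rewrite (integrand 1 p r1 pp)/= mul1r.
- by move=> p pp; rewrite (integrand (-1) p r2 pp)/= mulN1r mulrN.
rewrite subrr mul0r.
have -> : ((-1) ^+ b * cos Th + (-1) ^+ b * cos Th) / (2 * V) =
    (-1) ^+ b * (cos Th / V).
  by field; rewrite gt_eqF.
by case: (b); rewrite ?expr0 ?expr1 ?mul1r ?mulN1r//; simpc.
Qed.

End Integrand.
(** * Increasing enumerations of simplices *)

Section IncreasingEnumerations.
Variables (d : Order.disp_t) (V : finOrderType d).
Implicit Types (F t : {set V}).

Definition increasing k (f : 'I_k -> V) : Prop :=
  forall i j : 'I_k, (i < j)%N -> (f i < f j)%O.

Lemma increasing_inj k (f : 'I_k -> V) : increasing f -> injective f.
Proof.
move=> fI i j fij; apply: val_inj; apply/eqP.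
by case: ltngtP => // /fI; rewrite fij ltxx.
Qed.

Lemma simplicesP k (K : {set {set V}}) (f : {ffun 'I_k.+1 -> V}) :
  reflect (increasing f /\ vertex_set f \in K) (f \in simplices k K).
Proof.
rewrite inE; apply: (iffP andP) => -[fI fK]; split=> //.
  by move=> i j ij; move: fI => /forallP/(_ i)/forallP/(_ j)/implyP; exact.
by apply/forallP => i; apply/forallP => j; apply/implyP; exact: fI.
Qed.

Lemma card_vertex_set k (f : 'I_k -> V) : increasing f -> #|vertex_set f| = k.
Proof.
by move=> /increasing_inj fI; rewrite /vertex_set card_imset// card_ord.
Qed.

Let codom_sorted k (f : 'I_k -> V) : increasing f -> sorted <%O (codom f).
Proof.
move=> fI; apply: (homo_sorted_in (e := fun i j : 'I_k => (i < j)%N) (P := xpredT)).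
- by move=> i j _ _; exact: fI.
- by apply/allP.
- by have := iota_ltn_sorted 0 k; rewrite -val_enum_ord sorted_map.
Qed.

Lemma vertex_set_inj k (f g : {ffun 'I_k -> V}) : increasing f -> increasing g ->
  vertex_set f = vertex_set g -> f = g.
Proof.
move=> fI gI fg; have /lt_sorted_eq := codom_sorted fI.
move=> /(_ _ (codom_sorted gI)) E.
have {}E : codom f = codom g.
  apply: E => x; apply/codomP/codomP => -[i ->].
    have : f i \in vertex_set g by rewrite -fg imset_f.
    by move=> /imsetP[j _ ->]; exists j.
  have : g i \in vertex_set f by rewrite fg imset_f.
  by move=> /imsetP[j _ ->]; exists j.
move: E; rewrite !codomE => /eq_in_map E.
by apply/ffunP => i; apply: E; rewrite mem_enum.
Qed.

Lemma increasing_enum k F : #|F| = k.+1 -> exists2 f : {ffun 'I_k.+1 -> V},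
  increasing f & vertex_set f = F.
Proof.
move=> Fk; have [x0 _] : exists x0, x0 \in F by apply/card_gt0P; rewrite Fk.
pose s := sort <=%O (enum F).
have ss : size s = k.+1 by rewrite size_sort -cardE.
have s_lt : sorted <%O s by rewrite sort_lt_sorted enum_uniq.
have sF x : (x \in s) = (x \in F) by rewrite mem_sort mem_enum.
exists [ffun i : 'I_k.+1 => nth x0 s i].
  move=> i j ij; rewrite !ffunE; apply: (sorted_ltn_nth lt_trans x0 s_lt) => //;
    by rewrite inE ss.
apply/setP => x; apply/imsetP/idP => [[i _ ->]|xF].
  by rewrite ffunE -sF mem_nth// ss.
have xs : x \in s by rewrite sF.
have ix : (index x s < k.+1)%N by rewrite -ss index_mem.
by exists (Ordinal ix) => //; rewrite ffunE nth_index.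
Qed.

(** Products over the increasingly enumerated simplices are products over the
    simplices as vertex sets. *)
Lemma prod_simplices (A : comRingType) k (K : {set {set V}}) (P : pred {set V})
    (G : {set V} -> A) :
  \prod_(f in simplices k K | P (vertex_set f)) G (vertex_set f) =
  \prod_(F in K | (#|F| == k.+1) && P F) G F.
Proof.
pose A0 : {set {ffun 'I_k.+1 -> V}} :=
  [set f : {ffun 'I_k.+1 -> V} | (f \in simplices k K) && P (vertex_set f)]%SET.
have memA (f : {ffun 'I_k.+1 -> V}) : (f \in A0) = (f \in simplices k K) && P (vertex_set f).
  exact: finset.in_set.
transitivity (\prod_(F in [set vertex_set (f : {ffun _ -> _}) | f in A0]%SET) G F).
  rewrite big_imset /=; first by apply: eq_bigl => f; rewrite memA.
  move=> f g; rewrite !memA.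
  by move=> /andP[/simplicesP[fI _] _] /andP[/simplicesP[gI _] _]; exact: vertex_set_inj.
apply: eq_bigl => F; apply/imsetP/and3P => [[f + ->]|[FK /eqP Fk PF]].
  rewrite memA => /andP[/simplicesP[fI fK] Pf]; split=> //.
  by rewrite card_vertex_set.
have [f fI fF] := increasing_enum Fk; exists f => //.
by rewrite memA fF PF andbT; apply/simplicesP; rewrite fF.
Qed.

(** The sum of the labels of the triangles of a simplex. *)
Definition triangle_sum (s : {set V} -> int) F : int :=
  \sum_(t : {set V} | (#|t| == 3) && (t \subset F)) s t.

Lemma triangle_sum_tetra (s : {set V} -> int) (f : {ffun 'I_4 -> V}) : increasing f ->
  \sum_(a < 4) s (vertex_set (f \o lift a)) = triangle_sum s (vertex_set f).
Proof.
move=> fI; have f_inj := increasing_inj fI.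
have faceE (a : 'I_4) : vertex_set (f \o lift a) = (vertex_set f :\ f a)%SET.
  apply/setP => x; rewrite !inE; apply/imsetP/andP => [[i _ ->]|[xa /imsetP[i _ xi]]].
    by split; [rewrite (inj_eq f_inj) eq_sym neq_lift|exact: imset_f].
  move: xa; rewrite xi (inj_eq f_inj); case: (unliftP a i) => [j ->|->]; last by rewrite eqxx.
  by exists j.
transitivity (\sum_(t in [set (vertex_set f :\ f a)%SET | a : 'I_4]%SET) s t).
  rewrite big_imset /=; first by apply: eq_bigr => a _; rewrite faceE.
  move=> a b _ _ /setP/(_ (f b)); rewrite !inE eqxx /= imset_f// andbT.
  by move=> /negbFE/eqP/f_inj.
apply: eq_bigl => t; apply/imsetP/andP => [[a _ ->]|[/eqP t3 tf]].
  split; last exact: finset.subD1set.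
  have := cardsD1 (f a) (vertex_set f); rewrite card_vertex_set// imset_f//.
  by rewrite add1n => -[<-].
have /cards1P[x xE] : #|vertex_set f :\: t| == 1.
  by rewrite cardsDS// card_vertex_set// t3.
have : x \in vertex_set f :\: t by rewrite xE finset.set11.
rewrite inE => /andP[_ /imsetP[a _ xa]]; exists a => //.
by rewrite -xa -xE finset.setDDr finset.setDv finset.set0U; apply/esym/finset.setIidPr.
Qed.

Lemma triangle_sum_simplex (s : {set V} -> int) (f : {ffun 'I_5 -> V}) : increasing f ->
  \sum_(a < 5) \sum_(b < 5 | (a < b)%N) s (vertex_set f :\ f a :\ f b)%SET =
  triangle_sum s (vertex_set f).
Proof.
move=> fI; have f_inj := increasing_inj fI.
pose face (u : 'I_5 * 'I_5) := (vertex_set f :\ f u.1 :\ f u.2)%SET.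
have faceP (u : 'I_5 * 'I_5) i : (f i \in face u) = (i != u.2) && (i != u.1).
  by rewrite !inE !(inj_eq f_inj) imset_f// andbT.
rewrite pair_big_dep /=.
pose U : {set 'I_5 * 'I_5} := [set u : 'I_5 * 'I_5 | (u.1 < u.2)%N]%SET.
have memU u : (u \in U) = (u.1 < u.2)%N by exact: finset.in_set.
transitivity (\sum_(t in [set face u | u in U]%SET) s t).
  rewrite big_imset /=; first by apply: eq_bigl => u; rewrite memU.
  move=> [a b] [a' b']; rewrite !memU /= => ab ab' /setP E.
  have E' i : (i != b) && (i != a) = (i != b') && (i != a').
    by have := E (f i); rewrite !faceP.
  have := (E' a, E' b, E' a', E' b'); rewrite !eqxx !andbF /=.
  move=> -[[[/esym/negbT A /esym/negbT B] _] _]; move: A B ab ab'.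
  rewrite !negb_and !negbK => /orP[]/eqP-> /orP[]/eqP-> //; rewrite ?ltnn//.
  by move=> /ltn_trans/[apply]; rewrite ltnn.
apply: eq_bigl => t; apply/imsetP/andP => [[[a b] + ->]|[/eqP t3 tf]].
  rewrite memU /= => ab; split; last by apply/fintype.subsetP => x; rewrite !inE => /and3P[].
  have := cardsD1 (f a) (vertex_set f); rewrite card_vertex_set// imset_f//.
  have := cardsD1 (f b) (vertex_set f :\ f a)%SET; rewrite !inE (inj_eq f_inj).
  rewrite -val_eqE /= gtn_eqF// imset_f// -/(face (a, b)) add1n => ->.
  by rewrite add1n => -[<-].
have : #|vertex_set f :\: t| == 2 by rewrite cardsDS// card_vertex_set// t3.
move=> /cards2P[x [y [xy xyE]]].
have : x \in vertex_set f :\: t by rewrite xyE finset.set21.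
have : y \in vertex_set f :\: t by rewrite xyE finset.set22.
rewrite !inE => /andP[_ /imsetP[b _ yb]] /andP[_ /imsetP[a _ xa]].
have tE : t = (vertex_set f :\ x :\ y)%SET.
  by rewrite finset.setDDl -xyE finset.setDDr finset.setDv finset.set0U;
    apply/esym/finset.setIidPr.
move: xy; rewrite xa yb (inj_eq f_inj) -val_eqE neq_ltn /= => /orP[ab|ba].
  by exists (a, b); rewrite ?memU// /face /= -xa -yb.
exists (b, a); rewrite ?memU// /face /= -xa -yb tE.
by apply/setP => z; rewrite !inE andbCA.
Qed.

End IncreasingEnumerations.
(** * Counting tetrahedra modulo 2 *)

Section TetrahedronDegrees.
Variables (R : realType) (d : Order.disp_t) (V : finOrderType d).
Variable K : {set {set V}}.
Hypothesis HK : triangulated_4manifold R K.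
Implicit Types (T F t : {set V}).

Definition tet_degree T : nat :=
  #|[set F in K | (#|F| == 5) && (T \subset F)]%SET|.

Let cofaces T : {set V} := [set v : V | (v \notin T) && ((v |: T)%SET \in K)]%SET.

Let cofacesE T v : (v \in cofaces T) = (v \notin T) && ((v |: T)%SET \in K).
Proof. exact: finset.in_set. Qed.

Let degreeE T : #|T| = 4 -> tet_degree T = #|cofaces T|.
Proof.
move=> T4; rewrite /tet_degree.
have -> : [set F in K | (#|F| == 5) && (T \subset F)]%SET =
    [set (v |: T)%SET | v in cofaces T]%SET.
  apply/setP => F; rewrite !inE; apply/idP/imsetP.
    move=> /and3P[FK /eqP F5 TF].
    have /cards1P[x xE] : #|F :\: T| == 1 by rewrite cardsDS// F5 T4.
    have : x \in F :\: T by rewrite xE finset.set11.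
    rewrite inE => /andP[xT xF]; have FE : F = (x |: T)%SET.
      apply/setP => y; rewrite -xE !inE; case: (boolP (y \in T)) => yT /=.
        by rewrite (fintype.subsetP TF).
      by rewrite orbF.
    by exists x; rewrite ?cofacesE ?xT -?FE.
  move=> [v]; rewrite cofacesE => /andP[vT vK] ->.
  by rewrite vK cardsU1 vT T4/= finset.subsetUr.
rewrite card_in_imset// => v w; rewrite !cofacesE => /andP[vT _] /andP[wT _] /setP/(_ v).
by rewrite !inE eqxx/= (negbTE vT) orbF => /esym/eqP.
Qed.

Let link_vertex T v : #|T| = 4 -> ([set v]%SET \in link K T) = (v \in cofaces T).
Proof.
move=> T4; have [[_ closed] _] := HK; rewrite cofacesE.
transitivity (([set v]%SET \in K) && ([disjoint [set v]%SET & T] && (v |: T \in K))).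
  exact: finset.in_set.
rewrite disjoints1; case: (boolP (v |: T \in K)) => vK; rewrite ?andbF ?andbT//.
rewrite (closed _ _ vK)//.
- by rewrite finset.sub1set !inE eqxx.
- by apply/set0Pn; exists v; rewrite finset.set11.
Qed.

(* The points of the realization of the link of a tetrahedron. *)
Let point (v : V) : 'rV[R]_#|V| := delta_mx ord0 (enum_rank v).

Let pointE v w : point v ord0 (enum_rank w) = (w == v)%:R.
Proof. by rewrite mxE eqxx (inj_eq enum_rank_inj). Qed.

Let link_point T v : #|T| = 4 -> v \in cofaces T -> @realization R d V (link K T) (point v).
Proof.
move=> T4 vT; split.
- by move=> i; rewrite mxE; case: (_ && _).
- rewrite (bigD1 (enum_rank v))//= big1 ?addr0 ?pointE ?eqxx//.
  by move=> i iv; rewrite mxE (negbTE iv) andbF.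
- rewrite (_ : [set _ | _]%SET = [set v]%SET) ?link_vertex//.
  apply/setP => w; rewrite !inE pointE.
  by case: (w == v); rewrite ?eqxx ?oner_eq0.
Qed.

Let link_points T x : T \in K -> #|T| = 4 -> @realization R d V (link K T) x ->
  exists2 v, v \in cofaces T & x = point v.
Proof.
move=> TK T4 [x0 x1]; set A := [set v | _]%SET => AL.
have [[K0 closed] dimK] := HK.
have memA w : (w \in A) = (x ord0 (enum_rank w) != 0) by exact: finset.in_set.
have /and3P[AK AT ATK] : [&& A \in K, [disjoint A & T] & A :|: T \in K].
  by move: AL; rewrite finset.in_set.
have A_neq0 : A != finset.set0 by apply: contraNneq K0 => <-.
have cardA : #|A| = 1.
  have [+ _] := dimK _ ATK; rewrite cardsU disjoint_setI0// cards0 subn0 T4 => A5.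
  have : (#|A| + 4 <= 1 + 4)%N by exact: A5.
  rewrite leq_add2r => A1; apply/eqP; rewrite eqn_leq A1.
  by rewrite card_gt0.
have /cards1P[v vE] : #|A| == 1 by rewrite cardA.
exists v; first by rewrite -link_vertex// -vE.
have x_out i : i != enum_rank v -> x ord0 i = 0.
  move=> iv; apply/eqP; move: (memA (enum_val i)); rewrite vE finset.in_set1 enum_valK.
  have -> : (enum_val i == v) = false.
    by apply: contra_neqF iv => /eqP <-; rewrite enum_valK.
  by move/esym/negbFE.
apply/rowP => i; rewrite mxE /=; have [->|/x_out->//] := eqVneq i (enum_rank v).
by rewrite -x1 (bigD1 (enum_rank v))//= big1 ?addr0.
Qed.

(** The link of a tetrahedron is a sphere of dimension 0, two points, or a ball
    of dimension 0, one point. *)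
Lemma tet_degreeP T : T \in K -> #|T| = 4 -> tet_degree T = 1%N \/ tet_degree T = 2%N.
Proof.
move=> TK T4; rewrite degreeE//.
have point_inj : injective point.
  move=> v w /matrixP/(_ ord0 (enum_rank v)); rewrite !pointE eqxx.
  by case: eqP => // _ /eqP; rewrite oner_eq0.
have [_ [|[_]]] := (HK.2 T TK); rewrite T4 /= => -[phi [psi [_ _ to from]]].
  right; pose y (c : R) : 'rV[R]_1 := const_mx c.
  have sphereE z : sphere z <-> z = y 1 \/ z = y (-1).
    rewrite /sphere/= big_ord1; split.
      move/eqP; rewrite sqrf_eq1 => /orP[]/eqP zE; [left|right];
        by apply/rowP => i; rewrite mxE (ord1 i).
    by move=> [->|->]; rewrite mxE ?sqrrN expr1n.
  have [|r1 f1] := from (y 1); first by apply/sphereE; left.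
  have [|r2 f2] := from (y (-1)); first by apply/sphereE; right.
  have [v1 v1T e1] := link_points TK T4 r1; have [v2 v2T e2] := link_points TK T4 r2.
  have v12 : v1 != v2.
    apply/eqP => v12; have : y 1 = y (-1) by rewrite -f1 -f2 e1 e2 v12.
    move=> /rowP/(_ ord0)/eqP; rewrite !mxE -subr_eq0 opprK.
    by rewrite -(natrD _ 1 1) pnatr_eq0.
  rewrite (_ : cofaces T = [set v1; v2]%SET) ?cards2 ?v12//.
  apply/setP => v; rewrite !inE -cofacesE; apply/idP/orP => [vT|[]/eqP->//].
  have [/sphereE yv pv] := to _ (link_point T4 vT).
  by case: yv => yv; [left|right]; apply/eqP/point_inj; rewrite -pv yv ?e1 ?e2.
left; have [|r1 f1] := from 0; first by rewrite /cball/= big_ord0.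
have [v1 v1T e1] := link_points TK T4 r1.
rewrite (_ : cofaces T = [set v1]%SET) ?cards1//.
apply/setP => v; rewrite !inE -cofacesE; apply/idP/eqP => [vT|->//].
have [_ pv] := to _ (link_point T4 vT).
apply: point_inj; rewrite -pv -e1; congr psi; apply/rowP => i.
by case: i => [[]].
Qed.

End TetrahedronDegrees.

Section Signs.
Variables (R : realType) (d : Order.disp_t) (V : finOrderType d).
Implicit Types (K B : {set {set V}}) (T F t : {set V}) (s : {set V} -> int).

(** Each boundary triangle counts half the number of its boundary tetrahedra,
    which is even. *)
Definition boundary_sign B (l : {set V} -> R) s : bool :=
  odd (absz (\sum_(t in B | #|t| == 3)
    s t *+ (#|[set T in B | (#|T| == 4) && (t \subset T)]%SET|)./2)).

Lemma boundary_sign_local B (l l' : {set V} -> R) s s' :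
  same_labels B l l' s s' -> boundary_sign B l s = boundary_sign B l' s'.
Proof.
move=> ss; rewrite /boundary_sign; congr (odd (absz _)); apply: eq_bigr => t.
by move=> /andP[tB /eqP t3]; have [_ ->] := ss t tB.
Qed.

Variable K : {set {set V}}.
Hypothesis HK : triangulated_4manifold R K.
Let B := boundary K.

Let deg T := tet_degree K T.

Let boundary_tet T : #|T| = 4 -> (T \in B) = (T \in K) && (deg T == 1).
Proof.
move=> T4; rewrite /B finset.in_set; case: (boolP (T \in K)) => //= TK.
apply/existsP/idP => [[T' /and4P[TK' /eqP T4' TT' dT']]|dT].
  have -> : T = T' by apply/eqP; rewrite eqEcard TT' T4 T4'.
  exact: dT'.
by exists T; rewrite TK T4 eqxx fintype.subxx /=.
Qed.

Let K_sub F t : F \in K -> t \subset F -> #|t| = 3 -> t \in K.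
Proof.
have [[_ closed] _] := HK => FK tF t3; apply: (closed t F) => //.
by rewrite -card_gt0 t3.
Qed.

Let n5 t := #|[set F in K | (#|F| == 5) && (t \subset F)]%SET|.
Let nint t := #|[set T in K | [&& #|T| == 4, T \notin B & t \subset T]]%SET|.
Let nbd t := #|[set T in B | (#|T| == 4) && (t \subset T)]%SET|.

(** Flags are counted in two ways: each 4-simplex around a triangle t has two tetrahedra around t, and each
    tetrahedron lies in two 4-simplices, or one on the boundary. *)
Let count_flags t : #|t| = 3 -> (n5 t).*2 = ((nint t).*2 + nbd t)%N.
Proof.
move=> t3; pose flag T F := [&& #|T| == 4, t \subset T & T \subset F].
have two F : F \in K -> #|F| = 5 -> t \subset F ->
    \sum_(T : {set V} | flag T F) 1 = 2 :> nat.
  move=> FK F5 tF; rewrite sum1_card.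
  have -> : #|[pred T | flag T F]| = #|[set (F :\ v)%SET | v in F :\: t]%SET|.
    apply: eq_card => T; rewrite inE; apply/and3P/imsetP => [[/eqP T4 tT TF]|[v + ->]].
      have /cards1P[v vE] : #|F :\: T| == 1 by rewrite cardsDS// F5 T4.
      have : v \in F :\: T by rewrite vE finset.set11.
      rewrite inE => /andP[vT vF]; exists v.
        by rewrite inE vF andbT; apply: contra vT => /(fintype.subsetP tT).
      by rewrite -vE finset.setDDr finset.setDv finset.set0U; apply/esym/finset.setIidPr.
    rewrite inE => /andP[vt vF]; split; last exact: finset.subD1set.
      by have := cardsD1 v F; rewrite F5 vF add1n => -[<-].
    by rewrite finset.subsetD1 tF.
  rewrite card_in_imset ?cardsDS ?F5 ?t3// => v w; rewrite !inE => /andP[_ vF] _.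
  by move=> /setP/(_ v); rewrite !inE eqxx vF /= andbT => /esym/negbFE/eqP.
have L : (\sum_(F in K | (#|F| == 5) && (t \subset F))
    \sum_(T : {set V} | flag T F) 1 = (n5 t).*2)%N.
  rewrite (eq_bigr (fun=> 2)) => [|F /and3P[FK /eqP F5 tF]]; last exact: two.
  rewrite sum_nat_const muln2; congr _.*2; apply: eq_card => F.
  by rewrite finset.in_set.
have inner T : (#|T| == 4) && (t \subset T) -> T \in K ->
    (\sum_(F in K | (#|F| == 5) && (t \subset F) && flag T F) 1 = deg T)%N.
  move=> /andP[/eqP T4 tT] TK; rewrite sum1_card /deg /tet_degree; apply: eq_card => F.
  rewrite [RHS]finset.in_set unfold_in /flag T4 tT /= -!andbA; congr (_ && (_ && _)).
  by case: (boolP (T \subset F)) => TF; rewrite ?andbF// (fintype.subset_trans tT TF).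
rewrite -L (exchange_big_dep (fun T => (T \in K) && ((#|T| == 4) && (t \subset T)))) /=; last first.
  move=> F T /and3P[FK F5 tF] /and3P[T4 tT TF]; rewrite T4 tT !andbT.
  have [[_ closed] _] := HK; apply: (closed T F) => //.
  by rewrite -card_gt0 (eqP T4).
rewrite (eq_bigr deg) => [|T /andP[TK Tt]]; last first.
  by rewrite -inner//; apply: eq_bigl => F; rewrite -!andbA.
rewrite (bigID (fun T => T \in B)) /= addnC; congr addn.
  rewrite (eq_bigr (fun=> 2)) => [|T /andP[/and3P[TK /eqP T4 tT] TB]].
    rewrite sum_nat_const muln2; congr _.*2; apply: eq_card => T.
    rewrite [RHS]finset.in_set unfold_in; case: (T \in K) => //=.
    by case: (#|T| == 4) => //=; rewrite andbC.
  have [d1|//] := tet_degreeP HK TK T4.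
  by move: TB; rewrite boundary_tet// TK /deg d1.
rewrite (eq_bigr (fun=> 1)) => [|T /andP[/and3P[TK /eqP T4 tT] TB]].
  rewrite sum1_card; apply: eq_card => T; rewrite [RHS]finset.in_set unfold_in.
  case: (boolP (T \in B)) => TB; rewrite ?andbF//= andbT.
  by move: TB; rewrite /B finset.in_set => /andP[-> _].
by move: TB; rewrite boundary_tet// => /andP[_ /eqP].
Qed.

Let nbd_out t : #|t| = 3 -> t \notin B -> nbd t = 0%N.
Proof.
move=> t3 tB; apply/eqP; rewrite cards_eq0; apply/eqP/setP => T.
rewrite finset.in_set finset.in_set0; apply/negP => /and3P[TB /eqP T4 tT].
move: (TB); rewrite boundary_tet// => /andP[TK dT].
case/negP: tB; rewrite /B finset.in_set (K_sub TK tT t3) /=.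
by apply/existsP; exists T; rewrite TK T4 eqxx tT.
Qed.

(** Each triangle appears as often as there are interior tetrahedra and
    4-simplices around it, which modulo 2 is half its number of boundary
    tetrahedra. *)
Lemma total_sign (F : fieldType) (l : {set V} -> R) s :
  \prod_(T in K | (#|T| == 4) && (T \notin B)) (-1 : F) ^ triangle_sum s T *
  \prod_(S in K | (#|S| == 5) && true) (-1) ^ triangle_sum s S =
  (-1) ^+ boundary_sign B l s.
Proof.
have m1 : (-1 : F) != 0 by rewrite oppr_eq0 oner_eq0.
have expD : {morph (fun n : int => (-1 : F) ^ n) : x y / x + y >-> x * y}.
  by move=> x y; rewrite expfzDr.
rewrite -!(big_morph _ expD (expr0z _)) -expD.
have tri (P : pred {set V}) (n : {set V} -> nat) :
    (forall t : {set V}, #|t| = 3 -> #|[pred T | P T && (t \subset T)]| = n t) ->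
    \sum_(T | P T) triangle_sum s T = \sum_(t : {set V} | #|t| == 3) s t *+ n t.
  move=> Pn; rewrite (exchange_big_dep (fun t : {set V} => #|t| == 3)) /=.
    apply: eq_bigr => t /eqP t3; rewrite -Pn// -sumr_const.
    by apply: eq_bigl => T; rewrite inE t3.
  by move=> T t _ /andP[].
rewrite (tri _ nint) ?(tri _ n5); last 2 first.
- move=> t t3; apply: eq_card => T; rewrite [RHS]finset.in_set inE.
  by rewrite andbT -!andbA.
- move=> t t3; apply: eq_card => T; rewrite [RHS]finset.in_set inE.
  by rewrite -!andbA.
have -> : \sum_(t : {set V} | #|t| == 3) s t *+ nint t +
    \sum_(t : {set V} | #|t| == 3) s t *+ n5 t =
   \sum_(t : {set V} | #|t| == 3) s t *+ (nbd t)./2 +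
   (\sum_(t : {set V} | #|t| == 3) s t *+ nint t) *+ 2.
  rewrite -sumrMnl -!big_split /=; apply: eq_bigr => t /eqP t3.
  have n5E : n5 t = (nint t + (nbd t)./2)%N.
    have := count_flags t3; move: (n5 t) (nint t) (nbd t) => x y z E.
    by rewrite -(doubleK x) E halfD odd_double/= add0n doubleK.
  by rewrite n5E mulrnDr -mulrnA muln2 -addnn mulrnDr; ring.
rewrite expD mulr2n expD [X in _ * (X * _)]signz [X in _ * (_ * X)]signz.
rewrite -signr_addb addbb expr0 mulr1 signz /boundary_sign; congr (_ ^+ odd (absz _)).
rewrite (bigID (fun t => t \in B)) /= [X in _ + X]big1 ?addr0.
  by apply: eq_bigl => t; rewrite andbC.
by move=> t /andP[/eqP t3 tB]; rewrite nbd_out.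
Qed.

End Signs.
(** * The state sum *)

Section OneSimplex.
Variables (R : realType) (Phi : int -> 'M[R]_4 -> R[i]).
Hypothesis HPhi : phase_family Phi.
Variable mu : ('I_5 -> 'I_5 -> R) -> {measure set (pentagon R) -> \bar R}.
Hypothesis Hmu : forall l, simplex_lengths l -> is_P_l_measure l (mu l).
Variables (d : Order.disp_t) (V : finOrderType d).

Lemma tenj_symbol_simplex (l : {set V} -> R) (s : {set V} -> int)
    (f : {ffun 'I_5 -> V}) : increasing f -> simplex_lengths (edge_labels l f) ->
  tenj_symbol Phi mu (edge_labels l f) (triangle_labels s f) =
  (-1) ^ triangle_sum s (vertex_set f) *
  (cos (\sum_(a < 5) \sum_(b < 5 | (a < b)%N)
      (s (vertex_set f :\ f a :\ f b)%SET)%:~R *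
      dihedral_angle (edge_labels l f) a b) / V4 (edge_labels l f))%:C.
Proof.
move=> fI Hl; have f_inj := increasing_inj fI.
pose S a b := s (vertex_set f :\ f a :\ f b)%SET.
have HS (a : 'I_5) (g : 'I_4) : triangle_labels s f
    (lift a (lift g (@Ordinal 3 0 isT))) (lift a (lift g (@Ordinal 3 1 isT)))
    (lift a (lift g (@Ordinal 3 2 isT))) = S a (lift a g).
  rewrite /triangle_labels /S; congr s; apply/setP => x; rewrite !inE.
  apply/idP/and3P => [|[xb xa /imsetP[i _ xi]]].
    have out k : [&& f (lift a (lift g k)) != f (lift a g),
        f (lift a (lift g k)) != f a & f (lift a (lift g k)) \in vertex_set f].
      rewrite !(inj_eq f_inj) (inj_eq (@lift_inj _ a)) imset_f// andbT.
      by rewrite eq_sym neq_lift eq_sym neq_lift.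
    by move=> /orP[/orP[]|] /eqP->; apply/and3P/out.
  move: xb xa; rewrite xi !(inj_eq f_inj).
  case: (unliftP a i) => [j ->|->]; last by rewrite eqxx.
  rewrite (inj_eq (@lift_inj _ a)); case: (unliftP g j) => [k -> _ _|->]; last by rewrite eqxx.
  rewrite !(inj_eq (@lift_inj _ a)) !(inj_eq (@lift_inj _ g)).
  by move: k; apply: ord3P; rewrite eqxx ?orbT.
have S_sym a b : S a b = S b a.
  by rewrite /S; congr s; apply/setP => x; rewrite !inE andbCA.
rewrite (tenj_symbolE HPhi Hl HS S_sym (Hmu Hl) erefl) /label_sum /S.
by rewrite triangle_sum_simplex.
Qed.

End OneSimplex.

Lemma closed_formula (R : realType)
    (Phi : int -> 'M[R]_4 -> R[i]) (HPhi : phase_family Phi)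
    (mu : ('I_5 -> 'I_5 -> R) -> {measure set (pentagon R) -> \bar R})
    (Hmu : forall l, simplex_lengths l -> is_P_l_measure l (mu l))
    (d : Order.disp_t) (V : finOrderType d)
    (K : {set {set V}}) (l : {set V} -> R) (s : {set V} -> int) :
  triangulated_4manifold R K -> admissible_lengths K l ->
  W Phi mu K l s = (-1) ^+ boundary_sign (boundary K) l s * W_angles K l s.
Proof.
move=> HK [_ Hl]; rewrite /W /W_angles.
pose m T : R[i] := (-1) ^ triangle_sum s T.
have tets : \prod_(f in interior_simplices 3 K)
    (-1 : R[i]) ^ (\sum_(a < 4) s (vertex_set (f \o lift a))) =
    \prod_(T in K | (#|T| == 4) && (T \notin boundary K)) m T.
  rewrite -prod_simplices; apply: eq_big => [f|f].
    exact: finset.in_set.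
  rewrite finset.in_set => /andP[/simplicesP[fI _] _].
  by rewrite triangle_sum_tetra.
pose c (f : {ffun 'I_5 -> V}) : R :=
  cos (\sum_(a < 5) \sum_(b < 5 | (a < b)%N)
      (s (vertex_set f :\ f a :\ f b)%SET)%:~R *
      dihedral_angle (edge_labels l f) a b) / V4 (edge_labels l f).
have simps : \prod_(f in simplices 4 K)
    tenj_symbol Phi mu (edge_labels l f) (triangle_labels s f) =
    (\prod_(F in K | (#|F| == 5) && true) m F) * (\prod_(f in simplices 4 K) c f)%:C.
  rewrite rmorph_prod -(@prod_simplices _ _ _ 4 K predT m).
  rewrite (eq_bigl (mem (simplices 4 K)) (fun f => m (vertex_set f))); last first.
    by move=> f; rewrite andbT.
  rewrite -big_split /=; apply: eq_bigr => f fK; have /simplicesP[fI _] := fK.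
  exact: (tenj_symbol_simplex HPhi Hmu s fI (Hl f fK)).
rewrite tets simps (rmorphM (real_complex R)) -(total_sign HK _ l s).
by rewrite /m; ring.
Qed.

Theorem mainTheorem2 (R : realType)
    (Phi : int -> 'M[R]_4 -> R[i]) (HPhi : phase_family Phi)
    (mu : ('I_5 -> 'I_5 -> R) -> {measure set (pentagon R) -> \bar R})
    (Hmu : forall l, simplex_lengths l -> is_P_l_measure l (mu l))
    (d : Order.disp_t) (V : finOrderType d) :
  (forall (K : {set {set V}}) (l : {set V} -> R) (s : {set V} -> int),
     triangulated_4manifold R K -> orientable K -> admissible_lengths K l ->
     boundary K = finset.set0 ->
     W Phi mu K l s = W_angles K l s) /\
  (exists eps : {set {set V}} -> ({set V} -> R) -> ({set V} -> int) -> bool,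
     (forall (B : {set {set V}}) (l l' : {set V} -> R) (s s' : {set V} -> int),
        same_labels B l l' s s' -> eps B l s = eps B l' s') /\
     forall (K : {set {set V}}) (l : {set V} -> R) (s : {set V} -> int),
       triangulated_4manifold R K -> orientable K -> admissible_lengths K l ->
       W Phi mu K l s = (-1) ^+ eps (boundary K) l s * W_angles K l s).
Proof.
  (* your proof *)
Proof.
split=> [K l s HK _ Hl B0|].
  rewrite (closed_formula HPhi Hmu s HK Hl) B0.
  rewrite (_ : boundary_sign finset.set0 l s = false) ?expr0 ?mul1r//.
  by rewrite /boundary_sign big_pred0// => t; rewrite finset.in_set0.
exists (@boundary_sign R d V); split=> [*|K l s HK _ Hl].
  exact: boundary_sign_local.
exact: closed_formula.
Qed.
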